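(* For each fixed integer $(r,s)\times t$ bimatrix $A$ and each fixed integer $(p,q)\times t$ bimatrix $W$, there is an algorithm that, given a positive integer $n$, $l,u\in\mathbb{Z}_\infty^{nt}$, $\hat l,\hat u\in\mathbb{Z}_\infty^{p+nq}$, $b\in\mathbb{Z}^{r+ns}$, and separable convex functions $f:\mathbb{Z}^{p+nq}\to\mathbb{Z}$ and $g:\mathbb{Z}^{nt}\to\mathbb{Z}$ presented by evaluation oracles, solves, in time polynomial in $n$ and $\langle l,u,\hat l,\hat u,b,\hat f,\hat g\rangle$, the program $$\min\left\{f(W^{(n)}x)+g(x)\ :\ x\in\mathbb{Z}^{nt},\ A^{(n)}x=b,\ \hat l\le W^{(n)}x\le\hat u,\ l\le x\le u\right\}.$$
   Context: $\mathbb{Z}_\infty:=\mathbb{Z}\uplus\{\pm\infty\}$. An integer $(r,s)\times t$ bimatrix is an integer matrix $A$ with two blocks $A_1,A_2$: $A_1$ is the $r\times t$ submatrix consisting of its first $r$ rows and $A_2$ is the $s\times t$ submatrix consisting of its last $s$ rows (a block may be empty). The $n$-fold product of $A$ is the $(r+ns)\times nt$ matrix $$A^{(n)}:=\begin{pmatrix} A_1 & A_1 & \cdots & A_1 \\ A_2 & 0 & \cdots & 0 \\ 0 & A_2 & \cdots & 0 \\ \vdots & \vdots & \ddots & \vdots \\ 0 & 0 & \cdots & A_2 \end{pmatrix},$$ and $W^{(n)}$ is the $(p+nq)\times nt$ matrix defined in the same way from the blocks $W_1,W_2$ of $W$. A function $f$ is separable convex if $f(x)=\sum_i f_i(x_i)$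 with each $f_i:\mathbb{Z}\to\mathbb{Z}$ univariate convex. An evaluation oracle for $f$ returns $f(x)$ for any vector $x$. $\hat f$ and $\hat g$ are the maximum values of $|f(W^{(n)}x)|$ and $|g(x)|$ over the feasible set; they need not be part of the input (and are relevant only when the feasible set is nonempty and finite). $\langle\cdot\rangle$ denotes binary-encoding length. Convention: an algorithm solves an integer programming problem if it either finds an optimal solution $x$ or concludes that the feasible set is infinite or empty. *)

(* Defs.v *)
From HB Require Import structures.
From mathcomp Require Import all_boot all_order all_algebra.
From mathcomp Require Import finmap boolp classical_sets cardinality.
From mathcomp Require Import constructive_ereal.

Set Implicit Arguments.
Unset Strict Implicit.
Unset Printing Implicit Defensive.

Import Order.TTheory GRing.Theory Num.Theory.

Local Open Scope classical_set_scope.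
Local Open Scope ring_scope.

Lemma sum_ord_const n m : (\sum_(k < n) m = n * m)%N.
Proof. by rewrite sum_nat_const card_ord. Qed.

(* The casts only identify the block dimensions \sum_(k < n) s and
   \sum_(k < n) t of the library with n * s and n * t. *)
Definition nfold (r s t n : nat) (A : 'M[int]_(r + s, t)) :
    'M[int]_(r + n * s, n * t) :=
  castmx (congr1 (addn r) (sum_ord_const n s), sum_ord_const n t)
    (col_mx (\mxrow_(k < n) usubmx A)
            (\mxblock_(i < n, j < n) if i == j then dsubmx A else 0)).

Definition in_box (m : nat) (l u : 'cV[\bar int]_m) (x : 'cV[int]_m) : Prop :=
  forall i, (l i 0%R <= (x i 0%R)%:E <= u i 0%R)%E.

Definition feasible (r s p q t n : nat)
    (A : 'M[int]_(r + s, t)) (W : 'M[int]_(p + q, t))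
    (l u : 'cV[\bar int]_(n * t)) (lh uh : 'cV[\bar int]_(p + n * q))
    (b : 'cV[int]_(r + n * s)) : set 'cV[int]_(n * t) :=
  [set x | [/\ nfold n A *m x = b,
               in_box lh uh (nfold n W *m x) & in_box l u x]].

(* Jensen's inequality at every integer point of every integer segment. *)
Definition convex1 (h : int -> int) : Prop :=
  forall x y z : int, x <= y -> y <= z ->
    (z - x) * h y <= (z - y) * h x + (y - x) * h z.

Definition separable_convex (m : nat) (f : 'cV[int]_m -> int) : Prop :=
  exists fi : 'I_m -> int -> int,
    (forall i, convex1 (fi i)) /\ forall x, f x = \sum_i fi i (x i 0).

(* fset_set S is empty when S is infinite, so max_abs S h is the maximum of
   |h| over S when S is finite and nonempty, and 0 otherwise. *)
Definition max_abs (m : nat) (S : set 'cV[int]_m) (h : 'cV[int]_m -> int) : nat :=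
  (\max_(x <- fset_set S) `|h x|)%N.

(* None stands for the conclusion "the feasible set is infinite or empty". *)
Definition solves (m : nat) (S : set 'cV[int]_m) (obj : 'cV[int]_m -> int)
    (out : option 'cV[int]_m) : Prop :=
  match out with
  | Some x => S x /\ forall y, S y -> obj x <= obj y
  | None => infinite_set S \/ S = set0
  end.

(* 1 + ceil(log2(|z| + 1)): a sign bit and the binary digits of |z|. *)
Definition bitlen (z : int) : nat := (up_log 2 `|z|.+1).+1.

Definition ebitlen (z : \bar int) : nat :=
  if z is EFin a then bitlen a else 1%N.

Definition vbitlen (m : nat) (v : 'cV[int]_m) : nat :=
  (\sum_i bitlen (v i ord0))%N.

Definition vebitlen (m : nat) (v : 'cV[\bar int]_m) : nat :=
  (\sum_i ebitlen (v i ord0))%N.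

(******************************************************************************)
(* Random access machines with oracles, under the logarithmic cost criterion  *)
(*                                                                            *)
(* Programs are structured (while) programs over finitely many arrays of      *)
(* arbitrarily large integers: a program only mentions arrays by fixed names. *)
(* As for the logarithmic cost RAM of Aho, Hopcroft and Ullman, the cost of a *)
(* step is the total binary length of the integers it manipulates, addresses  *)
(* included, so that up to a polynomial this is Turing machine time.          *)
(******************************************************************************)

Definition store := nat -> nat -> int.

Definition update (st : store) (a i : nat) (v : int) : store :=
  fun a' i' => if (a' == a) && (i' == i) then v else st a' i'.

Variant arith := Add | Sub | Mul | Div.

Definition arith_sem (o : arith) (x y : int) : int :=
  match o with
  | Add => x + y
  | Sub => x - y
  | Mul => x * y
  | Div => (x %/ y)%Z
  end.

(* Get a e is the entry of array a at index |e|. *)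
Inductive expr :=
  | Cst of int
  | Get of nat & expr
  | Bin of arith & expr & expr.

Fixpoint eval (st : store) (e : expr) : int :=
  match e with
  | Cst z => z
  | Get a e1 => st a `|eval st e1|%N
  | Bin o e1 e2 => arith_sem o (eval st e1) (eval st e2)
  end.

(* The value of e itself is charged by the context that uses it. *)
Fixpoint ecost (st : store) (e : expr) : nat :=
  match e with
  | Cst z => bitlen z
  | Get a e1 => ecost st e1 + bitlen (eval st e1) + bitlen (eval st e)
  | Bin o e1 e2 => ecost st e1 + ecost st e2 +
                   (bitlen (eval st e1) + bitlen (eval st e2))
  end%N.

(* Cost of evaluating e and using its value. *)
Definition ucost (st : store) (e : expr) : nat :=
  (ecost st e + bitlen (eval st e))%N.

Variant oracle_name := OracleF | OracleG.

Record oracle := Oracle { odim : nat; ofun : 'cV[int]_odim -> int }.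

Definition read_vec (st : store) (a m : nat) : 'cV[int]_m :=
  \col_(i < m) st a i.

(* Asg a i e     stores the value of e in array a at index |i|;
   If, While     test whether the value of e is positive;
   Ask o a d     queries oracle o at the vector held in array a (of the
                 dimension of the domain of the oracle) and stores the answer
                 in array d at index 0. *)
Inductive cmd :=
  | Skip
  | Asg of nat & expr & expr
  | Seq of cmd & cmd
  | If of expr & cmd & cmd
  | While of expr & cmd
  | Ask of oracle_name & nat & nat.

(* exec orc P st c st' : started in st, the program P halts in st' after time c. *)
Inductive exec (orc : oracle_name -> oracle) :
    cmd -> store -> nat -> store -> Prop :=
  | exec_skip st : exec orc Skip st 1 st
  | exec_asg st a i e :
      exec orc (Asg a i e) st (ucost st i + ucost st e)%N
        (update st a `|eval st i|%N (eval st e))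
  | exec_seq st1 st2 st3 c1 c2 P Q :
      exec orc P st1 c1 st2 -> exec orc Q st2 c2 st3 ->
      exec orc (Seq P Q) st1 (c1 + c2)%N st3
  | exec_if_true st st' c e P Q :
      0 < eval st e -> exec orc P st c st' ->
      exec orc (If e P Q) st (ucost st e + c)%N st'
  | exec_if_false st st' c e P Q :
      eval st e <= 0 -> exec orc Q st c st' ->
      exec orc (If e P Q) st (ucost st e + c)%N st'
  | exec_while_true st1 st2 st3 c1 c2 e P :
      0 < eval st1 e -> exec orc P st1 c1 st2 ->
      exec orc (While e P) st2 c2 st3 ->
      exec orc (While e P) st1 (ucost st1 e + c1 + c2)%N st3
  | exec_while_false st e P :
      eval st e <= 0 -> exec orc (While e P) st (ucost st e) st
  | exec_ask st o a d :
      let x := read_vec st a (odim (orc o)) in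
      let v := ofun x in
      exec orc (Ask o a d) st (vbitlen x + bitlen v)%N (update st d 0 v).

Lemma exec_det orc P st c1 st1 c2 st2 :
  exec orc P st c1 st1 -> exec orc P st c2 st2 -> c1 = c2 /\ st1 = st2.
Proof.
move=> E1; elim: E1 c2 st2 => {P st c1 st1}.
- by move=> st c2 st2 E; inversion E.
- by move=> st a i e c2 st2 E; inversion E.
- move=> s1 s2 s3 c1 c2 P Q _ IHP _ IHQ c st E.
  inversion E as [| |? ? ? ? ? ? ? EP EQ| | | | |]; subst.
  have [? ?] := IHP _ _ EP; subst; have [? ?] := IHQ _ _ EQ; subst.
  by [].
- move=> s s' c e P Q e0 _ IH c2 st2 E.
  inversion E as [| | |? ? ? ? ? ? t EP|? ? ? ? ? ? t EP| | |]; subst.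
    by have [? ?] := IH _ _ EP; subst.
  by move: e0; rewrite ltNge t.
- move=> s s' c e P Q e0 _ IH c2 st2 E.
  inversion E as [| | |? ? ? ? ? ? t EP|? ? ? ? ? ? t EP| | |]; subst.
    by move: t; rewrite ltNge e0.
  by have [? ?] := IH _ _ EP; subst.
- move=> s1 s2 s3 c1 c2 e P e0 _ IHP _ IHW c st E.
  inversion E as [| | | | |? ? ? ? ? ? ? t EP EW|? ? ? t|]; subst.
    have [? ?] := IHP _ _ EP; subst; have [? ?] := IHW _ _ EW; subst.
    by [].
  by move: e0; rewrite ltNge t.
- move=> s e P e0 c st E.
  inversion E as [| | | | |? ? ? ? ? ? ? t EP EW|? ? ? t|]; subst.
    by move: t; rewrite ltNge e0.
  by [].
- move=> st o a d x v c2 st2 E; inversion E; subst.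
  by [].
Qed.

Definition etag (z : \bar int) : int :=
  match z with EFin _ => 0 | EPInf => 1 | ENInf => -1 end.

Definition efin (z : \bar int) : int := if z is EFin a then a else 0.

Definition entries (T : Type) (m : nat) (v : 'cV[T]_m) : seq T :=
  [seq v i ord0 | i <- enum 'I_m].

(* Array k initially holds the k-th of these sequences; a vector over
   \bar int is given by the array of its tags followed by the array of its
   finite values. All other cells are 0. *)
Definition init_store (mx mw mb n : nat) (l u : 'cV[\bar int]_mx)
    (lh uh : 'cV[\bar int]_mw) (b : 'cV[int]_mb) : store :=
  let input := [:: [:: n%:Z];
                   map etag (entries l);  map efin (entries l);
                   map etag (entries u);  map efin (entries u);
                   map etag (entries lh); map efin (entries lh);
                   map etag (entries uh); map efin (entries uh);
                   entries b] in
  fun a i => nth 0 (nth [::] input a) i.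

(* A positive entry in array 10 at index 0 announces an optimal solution,
   which is then held in array 11. *)
Definition output (m : nat) (st : store) : option 'cV[int]_m :=
  if 0 < st 10%N 0%N then Some (read_vec st 11 m) else None.

Definition oracles (m1 m2 : nat) (f : 'cV[int]_m1 -> int)
    (g : 'cV[int]_m2 -> int) (o : oracle_name) : oracle :=
  match o with OracleF => Oracle f | OracleG => Oracle g end.

(* Main.v *)
Require Import Defs.
From mathcomp Require Import all_boot all_order all_algebra.
From mathcomp Require Import finmap boolp classical_sets cardinality.
From mathcomp Require Import constructive_ereal.
From mathcomp Require Import zify ring.

Import Order.TTheory GRing.Theory Num.Theory.

(** The program is a descent along test vectors. The test vectors are all integer
    vectors of 1-norm at most K, where K depends on A and W alone; there are
    polynomially many of them. They suffice because of [nfold_graver]: every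
    integer vector is a sum of such vectors that are conformal to it, meaning
    that no coordinate and no row of the two n-fold matrices sees any
    cancellation in the sum. To obtain K, one splits the blocks of a vector into
    conformal bricks from a finite set given by the lower blocks of A and W.
    Only the number of bricks of each kind matters to the upper blocks, and the
    count vectors again have a finite basis. Both finiteness statements are
    instances of Dickson's lemma ([finite_conf_basis]).

    If x and y are feasible, then so is x plus any summand of a conformal
    decomposition of y - x, and a separable convex function is superadditive
    over the decomposition ([convex_along_superadd]). Hence some multiple of a
    test vector attains at least the average gain ([progress]). Trying only the
    step lengths 1, 2, 4, ... while they improve loses a factor 2
    ([doubling_gain]), so that one round of the descent shrinks the distance to
    the optimal value by the factor 1 - 1 / (2C), where C is the number of test
    vectors, and the number of rounds is polynomial ([geometric_bound]). By
    integrality, a step length that is accepted is at most twice the gain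
    ([convex1_slope]); so all points that occur have polynomial length.

    The descent is run twice. Its first run minimizes the total violation of all
    constraints, itself a separable convex function of the coordinates and of
    the rows, starting from 0; the minimum is 0 exactly if the program is
    feasible. Next, a feasible set is infinite exactly if some test vector is an
    unbounded direction ([infinite_ray], [finite_feasible]), and this is tested
    by a single step that is longer than all finite bounds. Finally, if the
    feasible set is finite, the second run minimizes the objective function over
    it. The oracles are asked at feasible points only, where their values are
    bounded by the maxima that enter the length of the input.

    Running times are computed from the program text: loops are annotated with
    bounds on their iterations ([acmd], [time]), and a triple ([runs]) keeps all
    cells below a common bound, whose length bounds the cost of every step. *)

Set Implicit Arguments.
Unset Strict Implicit.
Unset Printing Implicit Defensive.

(** * Dickson's lemma and finite bases *)

Section Dickson.

(** Each index is chosen to minimize [u] over all indices after the previous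
    one. *)
Lemma nondecreasing_subseq (u : nat -> nat) :
  exists2 phi : nat -> nat, {homo phi : i j / i < j} &
    {homo (u \o phi) : i j / i <= j}.
Proof.
have pickP N : {k : nat | N <= k & forall j, N <= j -> u k <= u j}.
  apply: cid2.
  have exu : exists m, `[< exists2 k, N <= k & u k = m >].
    by exists (u N); apply/asboolP; exists N.
  have [m /asboolP[k Nk <-] min_m] := ex_minnP exu; exists k => // j Nj.
  by apply: min_m; apply/asboolP; exists j.
pose pick N := s2val (pickP N).
have pick_ge N : N <= pick N := s2valP (pickP N).
have pick_le N j : N <= j -> u (pick N) <= u j by apply: s2valP' (pickP N) j.
pose phi k := iter k (fun m => pick m.+1) (pick 0).
have phiS k : phi k < phi k.+1 by apply: pick_ge.
have phi_mono : {homo phi : i j / i < j} by apply: homo_ltn => //; apply: ltn_trans.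
exists phi => // i j; rewrite leq_eqVlt => /predU1P[->//|ij] /=.
by case: i ij => [|i] ij; apply: pick_le => //; apply/phi_mono/ltnW.
Qed.

Lemma dickson (I : eqType) (s : seq I) (u : nat -> I -> nat) :
  exists2 phi : nat -> nat, {homo phi : i j / i < j} &
    {in s, forall c, {homo (fun k => u (phi k) c) : i j / i <= j}}.
Proof.
elim: s u => [|c s IHs] u; first by exists id.
have [phi phi_lt phi_le] := IHs u.
have [psi psi_lt psi_le] := nondecreasing_subseq (fun k => u (phi k) c).
have psi_mono : {mono psi : i j / i <= j} by apply/leq_mono.
exists (phi \o psi) => [i j ij|d]; first by apply/phi_lt/psi_lt.
rewrite inE => /predU1P[-> //|ds] i j ij.
by apply: phi_le; rewrite // psi_mono.
Qed.

(** Were the sizes of the minimal elements unbounded, one could pick elements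
    that dominate no earlier one, against Dickson's lemma. *)
Lemma finite_basis (T : Type) (I : finType) (e : T -> I -> nat)
    (sz : T -> nat) (P : T -> Prop) :
  exists K, forall y, P y ->
    exists x, [/\ P x, forall i, e x i <= e y i & sz x <= K].
Proof.
apply/not_existsP => noK.
have /choice[y yP] K : exists y, P y /\
    forall x, P x -> (forall i, e x i <= e y i) -> K < sz x.
  have /existsNP[y /not_implyP[Py noy]] := noK K; exists y; split=> // x Px exy.
  by rewrite ltnNge; apply/negP => szx; apply: noy; exists x.
pose K k := iter k (fun m => maxn m (sz (y m))) 0.
have K_le : {homo K : i j / i <= j}.
  by apply: homo_leq => // [i j k|i]; [apply: leq_trans | apply: leq_maxl].
have [phi phi_lt phi_le] := dickson (enum I) (fun k => e (y (K k))).
have [_ /(_ (y (K (phi 0))))] := yP (K (phi 1)).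
have [P0 _] := yP (K (phi 0)) => /(_ P0).
move=> le_K; have {le_K} := le_K (fun i => phi_le i (mem_enum _ i) 0 1 isT).
rewrite ltnNge => /negP[]; apply: leq_trans (K_le _ _ (phi_lt 0 1 isT)).
exact: leq_maxr.
Qed.

End Dickson.

(** * Conformal order on integer vectors *)

Section Conformality.
Local Open Scope ring_scope.

Definition conf (a b : int) : bool := (0 <= a <= b) || (b <= a <= 0).

Lemma conf_eq0 a : conf a 0 -> a = 0. Proof. rewrite /conf; lia. Qed.

Lemma conf_trans b a c : conf a b -> conf b c -> conf a c.
Proof. rewrite /conf; lia. Qed.

Lemma conf_subr a b : conf a b -> conf (b - a) b.
Proof. rewrite /conf; lia. Qed.

(** All summands used on the right lie on the same side of 0, namely that of b. *)
Lemma conf_sum (I : finType) (a : I -> int) (b : int) (m m' : I -> nat) :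
    (forall i, (m' i <= m i)%N) -> (forall i, (0 < m i)%N -> conf (a i) b) ->
  conf (\sum_i a i *+ m' i) (\sum_i a i *+ m i).
Proof.
move=> le_m conf_a.
have [b0|b0] := leP 0 b; rewrite /conf; apply/orP; [left|right].
  have a0 i : (0 < m i)%N -> 0 <= a i.
    by move=> /conf_a; rewrite /conf; lia.
  apply/andP; split.
    apply: sumr_ge0 => i _; case: (posnP (m' i)) => [->//|m'0].
    by rewrite mulrn_wge0 // a0 // (leq_trans m'0).
  apply: ler_sum => i _; case: (posnP (m i)) => [m0|m0].
    by have := le_m i; rewrite m0 leqn0 => /eqP->.
  by rewrite ler_wpMn2l ?a0.
have a0 i : (0 < m i)%N -> a i <= 0.
  by move=> /conf_a; rewrite /conf; lia.
apply/andP; split.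
  apply: ler_sum => i _; case: (posnP (m i)) => [m0|m0].
    by have := le_m i; rewrite m0 leqn0 => /eqP->.
  by rewrite -lerN2 -!mulNrn ler_wpMn2l ?oppr_ge0 ?a0.
apply: sumr_le0 => i _; case: (posnP (m' i)) => [->//|m'0].
by rewrite mulrn_wle0 // a0 // (leq_trans m'0).
Qed.

Definition signed_part (a : int) (b : bool) : nat :=
  if b then (if a is Posz k then k else 0%N) else if a is Negz k then k.+1 else 0%N.

(** On sign-split integers conformality is the product order of naturals. *)
Lemma conf_signed_part a b :
  (forall s, (signed_part a s <= signed_part b s)%N) -> conf a b.
Proof.
move=> le_ab; have := le_ab true; have := le_ab false; rewrite /conf.
by case: a {le_ab} => a; case: b => b; rewrite /signed_part ?NegzE /=; lia.
Qed.

Lemma finite_conf_basis (T : Type) (I : finType) (e : T -> I -> int)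
    (sz : T -> nat) (P : T -> Prop) :
  exists K, forall y, P y ->
    exists x, [/\ P x, forall i, conf (e x i) (e y i) & (sz x <= K)%N].
Proof.
have [K basis] := finite_basis (fun x (i : I * bool) => signed_part (e x i.1) i.2)
  sz P.
exists K => y /basis[x [Px le_xy szx]]; exists x; split => // i.
by apply: conf_signed_part => s; apply: le_xy (i, s).
Qed.

Definition norm1 m (v : 'cV[int]_m) : nat := (\sum_i `|v i ord0|)%N.

Lemma norm1D_le m (v w : 'cV[int]_m) : (norm1 (v + w) <= norm1 v + norm1 w)%N.
Proof. by rewrite -big_split; apply: leq_sum => i _; rewrite mxE /=; lia. Qed.

Definition conformal M N (C : 'M[int]_(M, N)) (x y : 'cV[int]_N) : Prop :=
  (forall i, conf (x i ord0) (y i ord0)) /\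
  (forall i, conf ((C *m x) i ord0) ((C *m y) i ord0)).

Lemma norm1_eq0 m (v : 'cV[int]_m) : norm1 v = 0%N -> v = 0.
Proof.
move=> /eqP; rewrite sum_nat_eq0 => /forallP v0; apply/colP => i.
by rewrite mxE; apply/eqP; rewrite -absz_eq0; apply: v0.
Qed.

Lemma norm1_sum_le (I : finType) m (v : I -> 'cV[int]_m) :
  (norm1 (\sum_i v i) <= \sum_i norm1 (v i))%N.
Proof.
rewrite exchange_big; apply: leq_sum => j _; rewrite summxE.
elim/big_rec2: _ => // i a b _ IH /=; lia.
Qed.

Section Decomposition.
Variables (M N : nat) (C : 'M[int]_(M, N)).
Implicit Types x y z : 'cV[int]_N.

Lemma conformal_trans y x z : conformal C x y -> conformal C y z -> conformal C x z.
Proof.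
by move=> [xy Cxy] [yz Cyz]; split=> i; [apply: conf_trans (yz i)|apply: conf_trans (Cyz i)].
Qed.

Lemma conformal_subr x y : conformal C x y -> conformal C (y - x) y.
Proof.
move=> [xy Cxy]; split=> i; rewrite ?mulmxBr !mxE; apply: conf_subr => //.
by have := Cxy i; rewrite !mxE.
Qed.

(** Conformal summands do not cancel. *)
Lemma norm1_subr x y : conformal C x y -> norm1 y = (norm1 x + norm1 (y - x))%N.
Proof.
move=> [xy _]; rewrite -big_split; apply: eq_bigr => i _ /=; rewrite !mxE.
by have := xy i; rewrite /conf /=; move: (x i ord0) (y i ord0) => a b; lia.
Qed.

(** A conformal summand strictly decreases the 1-norm of what remains. *)
Lemma conformal_decomposition (I : finType) (d : I -> 'cV[int]_N) :
    (forall y, y != 0 -> exists2 i, d i != 0 & conformal C (d i) y) ->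
  forall y, exists2 m : I -> nat, y = \sum_i d i *+ m i &
    forall i, (0 < m i)%N -> d i != 0 /\ conformal C (d i) y.
Proof.
move=> basis y; have [k] := ubnP (norm1 y); elim: k y => // k IHk y le_yk.
have [->|y0] := eqVneq y 0; first by exists (fun=> 0%N); rewrite ?big1.
have [i di0 diy] := basis y y0.
have [|m Dm m_conf] := IHk (y - d i).
  move: le_yk; rewrite (norm1_subr diy); suff: (0 < norm1 (d i))%N by lia.
  by rewrite lt0n; apply: contra_neq di0 => /norm1_eq0.
exists (fun j => (m j + (j == i))%N) => [|j].
  under eq_bigr do rewrite mulrnDr; rewrite big_split /= -Dm.
  by rewrite (bigD1 i) //= eqxx big1 ?addr0 ?subrK // => j /negPf->.
case: (eqVneq j i) => [-> // _|_]; rewrite addn0 => /m_conf[-> dj]; split=> //.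
by apply: conformal_trans dj _; apply: conformal_subr.
Qed.

End Decomposition.

(** The finite type by which bricks of bounded 1-norm are indexed. *)
Definition box K m := {ffun 'I_m -> 'I_(K + K).+1}.

Definition box_vec K m (v : box K m) : 'cV[int]_m :=
  \col_i ((v i : nat)%:Z - K%:Z).

Lemma box_vecP K m (v : 'cV[int]_m) :
  (forall i, `|v i ord0| <= K)%N -> exists w : box K m, box_vec w = v.
Proof.
move=> vK; exists [ffun i => inord (absz (v i ord0 + K%:Z))].
apply/colP => i; rewrite !mxE ffunE; have := vK i.
move: (v i ord0) => a aK; rewrite inordK; lia.
Qed.

Lemma norm1_box_vec K m (v : box K m) : (norm1 (box_vec v) <= m * K)%N.
Proof.
rewrite -[X in (_ <= X * _)%N]card_ord -sum_nat_const; apply: leq_sum => i _.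
by rewrite mxE /=; move: (v i) => [a /= aK]; lia.
Qed.

Lemma norm1_ge m (v : 'cV[int]_m) i : (`|v i ord0| <= norm1 v)%N.
Proof. by rewrite /norm1 (bigD1 i) //= leq_addr. Qed.

End Conformality.

(** * Rows and blocks of n-fold products *)

Section NFold.
Local Open Scope ring_scope.

(** Programs compute the row and column numbers of entries, as naturals. *)
Definition ent m n (A : 'M[int]_(m, n)) (i j : nat) : int :=
  if (insub i, insub j) is (Some i', Some j') then A i' j' else 0.

Lemma ent_ord m n (A : 'M[int]_(m, n)) (i : 'I_m) (j : 'I_n) : ent A i j = A i j.
Proof. by rewrite /ent !valK. Qed.

Lemma tagnat_const n m (i : 'I_(\sum_(k < n) m)) :
  (i %/ m = tagnat.sig1 i)%N /\ (i %% m = tagnat.sig2 i)%N.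
Proof.
have m0 : (0 < m)%N by apply: leq_ltn_trans (ltn_ord (tagnat.sig2 i)).
have le_n : (tagnat.sig1 i <= n)%N by apply/ltnW/ltn_ord.
have := tagnat.rect i; rewrite [X in (X + _)%N](big_ord_narrow le_n) sum_ord_const => ->.
by rewrite divnMDl // modnMDl divn_small ?modn_small ?addn0.
Qed.

Lemma nfold_entry r s t n (A : 'M[int]_(r + s, t)) i j :
  nfold n A i j =
    if (i < r)%N then ent A i (j %% t)
    else if ((i - r) %/ s == j %/ t)%N then ent A (r + (i - r) %% s) (j %% t)
    else 0.
Proof.
rewrite /nfold castmxE mxE; set j' := cast_ord _ j.
set i0 := cast_ord (esym (congr1 (addn r) _)) i; have -> : i = i0 :> nat by [].
have Dj : j = j' :> nat by [].
have [j1 j2] := tagnat_const j'.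
case: (splitP i0) => i' /= ->; rewrite mxE.
  by rewrite Dj j2 mxE -(ent_ord A).
rewrite addKn.
have [i1 i2] := tagnat_const i'; rewrite Dj i1 i2 j1 j2.
rewrite -(inj_eq val_inj); case: eqP => // _; last by rewrite mxE.
by rewrite mxE -(ent_ord A).
Qed.

Lemma block_index_proof n t (k : 'I_n) (e : 'I_t) : (k * t + e < n * t)%N.
Proof. by have := ltn_ord k; have := ltn_ord e; nia. Qed.

Definition block_index n t (k : 'I_n) (e : 'I_t) : 'I_(n * t) :=
  Ordinal (block_index_proof k e).

Definition block n t (k : 'I_n) (z : 'cV[int]_(n * t)) : 'cV[int]_t :=
  \col_e z (block_index k e) ord0.

Lemma block_indexP n t (j : 'I_(n * t)) : exists k e, j = block_index k e.
Proof.
have t0 : (0 < t)%N.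
  by rewrite lt0n; apply: contraTneq (leq_ltn_trans (leq0n j) (ltn_ord j)) => ->; rewrite muln0.
have jn : (j %/ t < n)%N by rewrite ltn_divLR.
exists (Ordinal jn), (Ordinal (ltn_pmod j t0)).
by apply: val_inj; rewrite /= -divn_eq.
Qed.

Lemma block_index_div n t (k : 'I_n) (e : 'I_t) : (block_index k e %/ t = k)%N.
Proof.
have t0 : (0 < t)%N by apply: leq_ltn_trans (ltn_ord e).
by rewrite /= divnMDl // divn_small ?addn0.
Qed.

Lemma block_index_mod n t (k : 'I_n) (e : 'I_t) : (block_index k e %% t = e)%N.
Proof. by rewrite /= modnMDl modn_small. Qed.

Lemma exists_blocks n t (w : 'I_n -> 'cV[int]_t) :
  exists v, forall k, block k v = w k.
Proof.
pose v j := if insub (j %/ t)%N is Some k then ent (w k) (j %% t) 0 else 0.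
exists (\col_(j < n * t) v j) => k; apply/colP => e.
by rewrite !mxE /v block_index_div block_index_mod valK -(ent_ord (w k)).
Qed.

Lemma big_block_index (R : Type) (idx : R) (op : Monoid.com_law idx) n t
    (F : 'I_(n * t) -> R) :
  \big[op/idx]_j F j = \big[op/idx]_k \big[op/idx]_e F (block_index k e).
Proof.
pose G k := if insub k is Some j then F j else idx.
have FG j : F j = G j by rewrite /G valK.
under eq_bigr do rewrite FG.
rewrite -(big_mkord xpredT G) big_nat_mul big_mkord; apply: eq_bigr => k _.
rewrite mulSn -{1}[(k * t)%N]add0n big_addn addnK big_mkord.
by apply: eq_bigr => e _; rewrite FG /= addnC.
Qed.

(** A row of the n-fold product either sums the blocks of its argument or sees
    only one of them. *)
Lemma nfold_row r s t n (A : 'M[int]_(r + s, t)) i :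
  (exists i' : 'I_r, forall z, (nfold n A *m z) i ord0 =
    (usubmx A *m (\sum_k block k z)) i' ord0) \/
  (exists k, exists i' : 'I_s, forall z, (nfold n A *m z) i ord0 =
    (dsubmx A *m block k z) i' ord0).
Proof.
have [ir|ri] := ltnP i r.
  left; exists (Ordinal ir) => z; rewrite mulmx_sumr summxE !mxE big_block_index.
  apply: eq_bigr => k _; rewrite !mxE; apply: eq_bigr => e _.
  by rewrite nfold_entry ir block_index_mod !mxE -(ent_ord A).
have s0 : (0 < s)%N.
  by rewrite lt0n; apply: contraTneq (leq_ltn_trans ri (ltn_ord i)) => ->; rewrite muln0 addn0 ltnn.
have lt_in : ((i - r) %/ s < n)%N.
  by rewrite ltn_divLR //; have := ltn_ord i; lia.
right; exists (Ordinal lt_in), (Ordinal (ltn_pmod (i - r) s0)) => z.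
rewrite !mxE big_block_index (bigD1 (Ordinal lt_in)) //= [X in _ + X]big1.
  rewrite addr0; apply: eq_bigr => e _.
  by rewrite nfold_entry ltnNge ri block_index_div eqxx block_index_mod !mxE -(ent_ord A).
move=> k k_neq; apply: big1 => e _; rewrite nfold_entry ltnNge ri block_index_div.
by rewrite eq_sym -[X in _ == X]/(val (Ordinal lt_in)) (inj_eq val_inj) (negPf k_neq) mul0r.
Qed.

End NFold.

(** * Small conformal summands for n-fold matrices *)

Section GraverBasis.
Local Open Scope ring_scope.

Lemma conformal_basis M N (C : 'M[int]_(M, N)) :
  exists K, forall y : 'cV[int]_N, y != 0 ->
    exists x, [/\ x != 0, (norm1 x <= K)%N & conformal C x y].
Proof.
pose e (x : 'cV[int]_N) (i : 'I_N + 'I_M) :=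
  match i with inl j => x j ord0 | inr j => (C *m x) j ord0 end.
have [K basis] := finite_conf_basis e (@norm1 N) (fun x => x != 0).
exists K => y /basis[x [x0 xy xK]]; exists x; split=> //.
by split=> i; [apply: xy (inl i) | apply: xy (inr i)].
Qed.

Lemma split_nat_sum (I : finType) (a : I -> nat) m : (m <= \sum_i a i)%N ->
  exists2 a' : I -> nat, (forall i, a' i <= a i)%N & (\sum_i a' i = m)%N.
Proof.
elim: m => [|m IHm] le_m; first by exists (fun=> 0%N); rewrite ?big1.
have [a' le_a Dm] := IHm (ltnW le_m).
have /existsP[i lt_i] : [exists i, (a' i < a i)%N].
  apply: contraLR le_m => /existsPn no_i; rewrite -leqNgt -Dm.
  by apply: leq_sum => i _; rewrite leqNgt no_i.
exists (fun j => (a' j + (j == i))%N) => [j|].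
  by case: eqP => [->|_]; rewrite ?addn1 ?addn0.
rewrite big_split /= Dm (bigD1 i) //= eqxx big1 ?addn0 ?addn1 //.
by move=> j /negPf->.
Qed.

(** The blocks of a vector split conformally into bricks from a finite set that
    depends on the lower blocks of the matrices only. For the upper blocks only
    the numbers of bricks of each kind matter, whatever their positions; and
    these count vectors have a finite basis as well. *)
Theorem nfold_graver r s p q t (A : 'M[int]_(r + s, t)) (W : 'M[int]_(p + q, t)) :
  exists K, forall n (z : 'cV[int]_(n * t)), z != 0 ->
    exists v, [/\ v != 0, (norm1 v <= K)%N &
                  conformal (col_mx (nfold n A) (nfold n W)) v z].
Proof.
pose C2 := col_mx (dsubmx A) (dsubmx W); pose C1 := col_mx (usubmx A) (usubmx W).
have [K1 basis1] := conformal_basis C2.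
pose G := box K1 t; pose d (g : G) := box_vec g.
have bricks : forall y, exists2 m : G -> nat, y = \sum_g d g *+ m g &
    forall g, (0 < m g)%N -> d g != 0 /\ conformal C2 (d g) y.
  apply: conformal_decomposition => y /basis1[x [x0 xK xy]].
  have [|g Dg] := @box_vecP K1 t x; last by exists g; rewrite /d Dg.
  by move=> i; apply: leq_trans (norm1_ge x i) xK.
pose e (l : G -> nat) (i : G + 'I_(r + p)) : int :=
  match i with
  | inl g => (l g)%:Z
  | inr j => (C1 *m \sum_g d g *+ l g) j ord0
  end.
have [K2 basis2] := finite_conf_basis e (fun l => \sum_g l g)%N
  (fun l => exists g, (0 < l g)%N).
exists (K2 * (t * K1))%N => n z z0.
(* [m k g] is the number of bricks [g] in block [k], [l g] in all of [z]. *)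
have /choice[m mP] : forall k : 'I_n, exists m : G -> nat,
    block k z = \sum_g d g *+ m g /\
    forall g, (0 < m g)%N -> d g != 0 /\ conformal C2 (d g) (block k z).
  by move=> k; have [m Dm Hm] := bricks (block k z); exists m.
pose l g := (\sum_k m k g)%N.
have sum_z : \sum_k block k z = \sum_g d g *+ l g.
  under eq_bigr do rewrite (mP _).1.
  by rewrite exchange_big; apply: eq_bigr => g _; rewrite sumrMnr.
have [|l' [[g0 l'g0] conf_l' l'K2]] := basis2 l.
  apply: contrapT => no_g; case/eqP: z0; apply/colP => j.
  have [k [i ->]] := block_indexP j.
  have -> : z (block_index k i) ord0 = block k z i ord0 by rewrite mxE.
  rewrite (mP k).1 big1 ?mxE // => g _.
  have [->//|m0] := posnP (m k g); case: no_g; exists g.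
  by apply: leq_trans m0 _; rewrite /l (bigD1 k) //= leq_addr.
(* The smaller counts [l'] are distributed over the blocks arbitrarily. *)
have /choice[m' m'P] : forall g, exists m' : 'I_n -> nat,
    (forall k, m' k <= m k g)%N /\ (\sum_k m' k = l' g)%N.
  move=> g; have [|m' le_m Dm] := @split_nat_sum _ (fun k => m k g) (l' g).
    by have := conf_l' (inl g); rewrite /conf /e -/(l g); lia.
  by exists m'.
have [v vP] := exists_blocks (fun k => \sum_g d g *+ m' g k).
have sum_v : \sum_k block k v = \sum_g d g *+ l' g.
  under eq_bigr do rewrite vP.
  by rewrite exchange_big; apply: eq_bigr => g _; rewrite sumrMnr (m'P g).2.
have conf_block k : conformal C2 (block k v) (block k z).
  have le_m g : (m' g k <= m k g)%N by apply: (m'P g).1.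
  split=> i; rewrite vP (mP k).1 ?mulmx_sumr !summxE.
    under eq_bigr do rewrite mulmxnE; under [X in conf _ X]eq_bigr do rewrite mulmxnE.
    by apply: conf_sum le_m _ => g /((mP k).2 g)[_ [conf_g _]]; apply: conf_g.
  under eq_bigr do rewrite raddfMn mulmxnE.
  under [X in conf _ X]eq_bigr do rewrite raddfMn mulmxnE.
  by apply: conf_sum le_m _ => g /((mP k).2 g)[_ [_ conf_g]]; apply: conf_g.
exists v; split.
- apply/eqP => v0.
  have [k m'k] : exists k, (0 < m' g0 k)%N.
    apply/existsP; apply: contraLR l'g0 => /existsPn no_k.
    rewrite -(m'P g0).2 -leqNgt leqn0 sum_nat_eq0; apply/forallP => k.
    by have := no_k k; rewrite -leqNgt leqn0.
  have [d0 [conf_g _]] := (mP k).2 g0 (leq_trans m'k ((m'P g0).1 k)).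
  case/eqP: d0; apply/colP => i.
  have le_m g : ((g == g0) <= m' g k)%N by case: eqP => // ->.
  have conf_m' g : (0 < m' g k)%N -> conf (d g i ord0) (block k z i ord0).
    by move=> m'0; apply: ((mP k).2 g (leq_trans m'0 ((m'P g).1 k))).2.1.
  have := conf_sum le_m conf_m'.
  have -> : \sum_g d g i ord0 *+ m' g k = 0.
    have := congr1 (fun u : 'cV_t => u i ord0) (vP k).
    rewrite v0 summxE !mxE => {2}->.
    by apply: eq_bigr => g _; rewrite mulmxnE.
  rewrite (bigD1 g0) //= eqxx big1 => [|g /negPf->//]; rewrite addr0 mulr1n.
  by rewrite [RHS]mxE; apply: conf_eq0.
- have -> : norm1 v = (\sum_k norm1 (block k v))%N.
    rewrite /norm1 big_block_index; apply: eq_bigr => k _.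
    by apply: eq_bigr => i _; rewrite mxE.
  apply: (@leq_trans (\sum_k \sum_g m' g k * (t * K1))%N).
    apply: leq_sum => k _; rewrite vP; apply: leq_trans (norm1_sum_le _) _.
    apply: leq_sum => g _; elim: (m' g k) => [|j IHj].
      by rewrite mulr0n /norm1 big1 // => i _; rewrite mxE.
    rewrite mulrS mulSn; apply: leq_trans (norm1D_le _ _) _.
    by rewrite leq_add // norm1_box_vec.
  rewrite exchange_big; under eq_bigr do rewrite -big_distrl /= (m'P _).2.
  by rewrite -big_distrl leq_mul2r l'K2 orbT.
split=> j.
  have [k [i ->]] := block_indexP j.
  by have [/(_ i) + _] := conf_block k; rewrite !mxE.
have upper i : conf ((C1 *m \sum_k block k v) i ord0) ((C1 *m \sum_k block k z) i ord0).
  by rewrite sum_v sum_z; apply: conf_l' (inr i).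
have lower k i := (conf_block k).2 i.
rewrite !mul_col_mx; case: (split_ordP j) => i ->; rewrite ?col_mxEu ?col_mxEd.
  have [[i' DA]|[k [i' DA]]] := nfold_row A i; rewrite !DA.
    by have := upper (lshift p i'); rewrite !mul_col_mx !col_mxEu.
  by have := lower k (lshift q i'); rewrite !mul_col_mx !col_mxEu.
have [[i' DW]|[k [i' DW]]] := nfold_row W i; rewrite !DW.
  by have := upper (rshift r i'); rewrite !mul_col_mx !col_mxEd.
by have := lower k (rshift s i'); rewrite !mul_col_mx !col_mxEd.
Qed.

End GraverBasis.

(** * Univariate convex functions on the integers *)

Section ConvexAnalysis.
Local Open Scope ring_scope.

Lemma convex1_cst c : convex1 (fun=> c).
Proof. by move=> x y z _ _; rewrite -mulrDl; lia. Qed.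

Lemma convex1_add h k : convex1 h -> convex1 k -> convex1 (fun a => h a + k a).
Proof. by move=> ch ck x y z xy yz; have := ch _ _ _ xy yz; have := ck _ _ _ xy yz; lia. Qed.

Lemma convex1_sum (I : finType) (h : I -> int -> int) :
  (forall i, convex1 (h i)) -> convex1 (fun a => \sum_i h i a).
Proof.
move=> ch x y z xy yz; rewrite !mulr_sumr -big_split /=.
by apply: ler_sum => i _; apply: ch.
Qed.

Lemma convex1_affine h a b : convex1 h -> convex1 (fun l => h (a + l * b)).
Proof.
move=> ch x y z xy yz /=.
have [b0|b0|b0] := ltgtP 0 b; last by rewrite -b0 !mulr0; lia.
  have := ch (a + x * b) (a + y * b) (a + z * b).
  rewrite !lerD2l !(ler_pM2r b0) => /(_ xy yz) H.
  by rewrite -(ler_pM2l b0); lia.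
have := ch (a + z * b) (a + y * b) (a + x * b).
rewrite !lerD2l !(ler_nM2r b0) => /(_ yz xy) H.
by rewrite -(ler_nM2l b0); lia.
Qed.

(** Jensen's inequality at the two inner points of the segment from x to
    x + a + b; the weights of the two instances add up to the claim. *)
Lemma convex1_superadd2 h x a b : convex1 h ->
  (0 <= a /\ 0 <= b) \/ (a <= 0 /\ b <= 0) ->
  h (x + a) + h (x + b) <= h x + h (x + a + b).
Proof.
move=> ch; wlog: x a b / 0 <= a /\ 0 <= b => [wlg|[a0 b0] _].
  case=> [ab|[a0 b0]]; first exact: wlg ab (or_introl ab).
  have := wlg (x + a + b) (- a) (- b).
  have -> : x + a + b - a = x + b by ring.
  have -> : x + a + b - b = x + a by ring.
  have -> : x + b - b = x by ring.
  by rewrite !oppr_ge0 => H; have := H (conj a0 b0) (or_introl (conj a0 b0)); lia.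
have [ab|ab] := eqVneq (a + b) 0.
  have [-> ->] : a = 0 /\ b = 0 by lia.
  by rewrite !addr0.
have ab0 : 0 < a + b by lia.
rewrite -(ler_pM2l ab0).
have := ch x (x + a) (x + a + b); have := ch x (x + b) (x + a + b).
have -> : x + a + b - x = a + b by lia.
have -> : x + b - x = b by lia. have -> : x + a - x = a by lia.
have -> : x + a + b - (x + b) = a by lia. have -> : x + a + b - (x + a) = b by lia.
by move=> H1 H2; have := H1 ltac:(lia) ltac:(lia); have := H2 ltac:(lia) ltac:(lia); lia.
Qed.

Lemma convex1_superadd (I : Type) (s : seq I) h x (a : I -> int) b :
  convex1 h -> (forall i, conf (a i) b) ->
  \sum_(i <- s) (h (x + a i) - h x) <= h (x + \sum_(i <- s) a i) - h x.
Proof.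
move=> ch conf_a; elim: s => [|i s IHs]; first by rewrite !big_nil addr0 subrr.
rewrite !big_cons.
have H := @convex1_superadd2 h x (a i) (\sum_(j <- s) a j) ch _.
suff /H {}H : (0 <= a i /\ 0 <= \sum_(j <- s) a j) \/
    (a i <= 0 /\ \sum_(j <- s) a j <= 0).
  rewrite addrA; move: IHs H; set S := \sum_(j <- s) (_ - _).
  by move: (h (x + _ + _)) (h (x + a i)) (h (x + _)) (h x) => *; lia.
have [b0|b0] := leP 0 b; [left|right]; split.
- by have := conf_a i; rewrite /conf; lia.
- by apply: sumr_ge0 => j _; have := conf_a j; rewrite /conf; lia.
- by have := conf_a i; rewrite /conf; lia.
- by apply: sumr_le0 => j _; have := conf_a j; rewrite /conf; lia.
Qed.

(** If the function still decreases between k and 2k, then each unit step up to k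
    decreases it, by integrality at least by 1. *)
Lemma convex1_slope h (k : nat) : convex1 h ->
  h (k * 2)%N%:Z < h k%:Z -> h k%:Z + k%:Z <= h 0.
Proof.
move=> ch lt_h.
suff H (j : nat) : (j <= k)%N -> h j%:Z + j%:Z <= h 0 by apply: H.
elim: j => [|j IHj] jk; first by rewrite addr0.
have {}IHj := IHj (ltnW jk).
suff : h j.+1%:Z < h j%:Z by lia.
rewrite ltNge; apply/negP => le_h.
have c1 := ch j%:Z j.+1%:Z k%:Z ltac:(lia) ltac:(lia).
have c2 := ch j%:Z k%:Z (k * 2)%N%:Z ltac:(lia) ltac:(lia).
have le_jk : h j%:Z <= h k%:Z.
  have m0 : 0 <= k%:Z - j%:Z - 1 by lia.
  by have := ler_wpM2l m0 le_h; lia.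
have k0 : (0 : int) <= k%:Z by [].
have kj0 : 0 < k%:Z - j%:Z by lia.
have := ler_wpM2l k0 le_jk; move: lt_h; rewrite -(ltr_pM2l kj0).
by rewrite PoszM in c2 *; lia.
Qed.

End ConvexAnalysis.

(** * Separable convex functions and augmentation steps *)

Section Augmentation.
Local Open Scope ring_scope.

(** The separable convex functions of exactly those linear forms that the
    conformal order controls. *)
Definition convex_along M N (C : 'M[int]_(M, N)) (F : 'cV[int]_N -> int) : Prop :=
  exists (h : 'I_N -> int -> int) (k : 'I_M -> int -> int),
  [/\ forall i, convex1 (h i), forall j, convex1 (k j) &
      forall y, F y = \sum_i h i (y i ord0) + \sum_j k j ((C *m y) j ord0)].

Lemma scalez_nat N (k : nat) (v : 'cV[int]_N) : k%:Z *: v = v *+ k.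
Proof. by rewrite -natz scaler_nat. Qed.

Section Functions.
Variables (M N : nat) (C : 'M[int]_(M, N)) (F : 'cV[int]_N -> int).
Hypothesis cF : convex_along C F.

Lemma convex_along_line x d : convex1 (fun l => F (x + l *: d)).
Proof.
have [h [k [ch ck DF]]] := cF.
have -> : (fun l => F (x + l *: d)) =
  (fun l => \sum_i h i (x i ord0 + l * d i ord0) +
            \sum_j k j ((C *m x) j ord0 + l * (C *m d) j ord0)).
  apply/funext => l; rewrite DF; congr (_ + _); apply: eq_bigr => i _.
    by rewrite !mxE.
  by rewrite mulmxDr -scalemxAr !mxE.
by apply: convex1_add; apply: convex1_sum => i; apply: convex1_affine.
Qed.

(** Each linear form maps all summands to the same side of 0, where
    univariate convex functions are superadditive. *)
Lemma convex_along_superadd (I : finType) x z (v : I -> 'cV[int]_N) :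
    z = \sum_i v i -> (forall i, conformal C (v i) z) ->
  \sum_i (F (x + v i) - F x) <= F (x + z) - F x.
Proof.
move=> Dz conf_v; have [h [k [ch ck DF]]] := cF.
have -> : F (x + z) - F x =
    \sum_j (h j (x j ord0 + z j ord0) - h j (x j ord0)) +
    \sum_j (k j ((C *m x) j ord0 + (C *m z) j ord0) - k j ((C *m x) j ord0)).
  rewrite !DF !big_split /= !sumrN addrACA -opprD; congr (_ + _ - _).
    by apply: eq_bigr => j _; rewrite mxE.
  by apply: eq_bigr => j _; rewrite mulmxDr mxE.
have -> : \sum_i (F (x + v i) - F x) =
    \sum_j \sum_i (h j (x j ord0 + v i j ord0) - h j (x j ord0)) +
    \sum_j \sum_i (k j ((C *m x) j ord0 + (C *m v i) j ord0) - k j ((C *m x) j ord0)).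
  rewrite exchange_big /= [X in _ = _ + X]exchange_big /= -big_split.
  apply: eq_bigr => i _ /=.
  rewrite !DF !big_split /= !sumrN addrACA -opprD; congr (_ + _ - _).
    by apply: eq_bigr => j _; rewrite mxE.
  by apply: eq_bigr => j _; rewrite mulmxDr mxE.
apply: lerD; apply: ler_sum => j _.
  have -> : z j ord0 = \sum_i v i j ord0 by rewrite Dz summxE.
  by apply: (@convex1_superadd _ _ _ _ _ (z j ord0)) => // i; apply: (conf_v i).1.
have -> : (C *m z) j ord0 = \sum_i (C *m v i) j ord0.
  by rewrite Dz mulmx_sumr summxE.
by apply: (@convex1_superadd _ _ _ _ _ ((C *m z) j ord0)) => // i; apply: (conf_v i).2.
Qed.

End Functions.

Section Progress.
Variables (M N : nat) (C : 'M[int]_(M, N)) (I : finType) (d : I -> 'cV[int]_N).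
Hypothesis basis :
  forall y, y != 0 -> exists2 i, d i != 0 & conformal C (d i) y.

Lemma conformal_multiples z : exists m : I -> nat,
  [/\ z = \sum_i d i *+ m i, forall i, conformal C (d i *+ m i) z &
      forall i, (0 < m i)%N -> d i != 0].
Proof.
have [m Dm conf_m] := conformal_decomposition basis z.
exists m; split=> // [i|i /conf_m[]//].
have le_m j : ((if j == i then m i else 0) <= m j)%N by case: eqP => // ->.
have pick_i (a : I -> int) : \sum_j a j *+ (if j == i then m i else 0) = a i *+ m i.
  by rewrite (bigD1 i) //= eqxx big1 ?addr0 // => j /negPf->; rewrite mulr0n.
split=> j; rewrite [in X in conf _ X]Dm ?mulmx_sumr ?summxE ?raddfMn mulmxnE.
  under [X in conf _ X]eq_bigr do rewrite mulmxnE.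
  rewrite -(pick_i (fun i => d i j ord0)).
  by apply: (@conf_sum _ _ (z j ord0)) => // i' /conf_m[_ [+ _]]; apply.
under [X in conf _ X]eq_bigr do rewrite raddfMn mulmxnE.
rewrite -(pick_i (fun i => (C *m d i) j ord0)).
by apply: (@conf_sum _ _ ((C *m z) j ord0)) => // i' /conf_m[_ [_ +]]; apply.
Qed.

Variables D F : 'cV[int]_N -> int.
Hypotheses (cD : convex_along C D) (cF : convex_along C F).
Hypothesis D0 : forall y, 0 <= D y.

(** By superadditivity the nonnegative defects of the intermediate points sum
    up to at most the defect at the end. *)
Lemma multiples_feasible x z m :
    z = \sum_i d i *+ m i -> (forall i, conformal C (d i *+ m i) z) ->
    D x = 0 -> D (x + z) = 0 ->
  forall i, D (x + d i *+ m i) = 0.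
Proof.
move=> Dz conf_m Dx Dxz i.
have := convex_along_superadd cD x Dz conf_m; rewrite Dxz Dx subrr.
under eq_bigr do rewrite subr0.
rewrite (bigD1 i) //=; set S := \sum_(_ | _) _.
have S0 : 0 <= S by apply: sumr_ge0.
by have := D0 (x + d i *+ m i); lia.
Qed.

(** The gain from x to y is at most the sum of the gains along the multiples of
    test vectors into which y - x decomposes. *)
Lemma progress x y (e : int) : D x = 0 -> D y = 0 ->
    (forall i (k : nat), D (x + d i *+ k) = 0 -> F x - F (x + d i *+ k) <= e) ->
  F x - F y <= #|I|%:Z * e.
Proof.
move=> Dx Dy gain_le; have [m [Dz conf_m _]] := conformal_multiples (y - x).
have Dxz : D (x + (y - x)) = 0 by rewrite subrKC.
have feas := multiples_feasible Dz conf_m Dx Dxz.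
have := convex_along_superadd cF x Dz conf_m; rewrite subrKC.
have -> : #|I|%:Z * e = \sum_(i : I) e by rewrite sumr_const -mulr_natl natz.
suff : \sum_(i : I) - e <= \sum_i (F (x + d i *+ m i) - F x) by rewrite sumrN; move: (\sum_i _) (\sum_(i : I) e) => a b; lia.
apply: ler_sum => i _ /=; have := gain_le i (m i) (feas i).
by move: (F _) (F _) => a b; lia.
Qed.

(** If every step of length L + 1 along a nonzero test vector leaves the feasible
    set, then so do all longer ones, and only finitely many combinations of
    test vectors remain. *)
Lemma finite_feasible x (L : nat) : D x = 0 ->
    (forall i, d i != 0 -> D (x + d i *+ L.+1) <> 0) ->
  finite_set [set y | D y = 0]%classic.
Proof.
move=> Dx no_step.
pose comb (m : {ffun I -> 'I_L.+1}) := x + \sum_i d i *+ m i.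
apply: (@sub_finite_set _ _ [set` [seq comb m | m : {ffun I -> 'I_L.+1}]]%classic);
  last exact: finite_seq.
move=> y /= Dy; have [m [Dz conf_m d_neq0]] := conformal_multiples (y - x).
have Dxz : D (x + (y - x)) = 0 by rewrite subrKC.
have feas := multiples_feasible Dz conf_m Dx Dxz.
have le_m i : (m i <= L)%N.
  rewrite leqNgt; apply/negP => lt_m; apply: (no_step i (d_neq0 _ (leq_trans _ lt_m))) => //.
  have := convex_along_line cD x (d i) (ltac:(lia) : 0 <= L.+1%:Z)
    (ltac:(lia) : L.+1%:Z <= (m i)%:Z).
  rewrite /= scale0r (addr0 x) Dx !scalez_nat (feas i) !mulr0 addr0 subr0.
  by have := D0 (x + d i *+ L.+1); move: (D _) => c c0; rewrite pmulr_rle0 //; lia.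
apply/mapP; exists [ffun i => inord (m i)]; first by rewrite mem_enum.
rewrite /comb -[LHS](subrKC x) Dz; congr (_ + _); apply: eq_bigr => i _.
by rewrite ffunE inordK // ltnS le_m.
Qed.

End Progress.

Section LineSearch.
Variables h e : int -> int.
Hypotheses (ch : convex1 h) (ce : convex1 e) (e_ge0 : forall l, 0 <= e l) (e0 : e 0 = 0).

Lemma feasible_segment (k l : int) : 0 <= k -> k <= l -> e l = 0 -> e k = 0.
Proof.
move=> k0 kl el; have := ce k0 kl; rewrite e0 el !mulr0 addr0 subr0.
have [l0|l0] := eqVneq l 0; first by have -> : k = 0 by lia.
by have := e_ge0 k; move: (e k) => c c0; rewrite pmulr_rle0; lia.
Qed.

(** Doubling the step length as long as this is feasible and an improvement
    attains half of the best possible gain: the last power of 2 below the best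
    step length gains at least half of it by convexity, and if the doubling
    stops before, then the minimum along the line has been passed. *)
Lemma doubling_gain (j : nat) (best : int) :
    (forall i, (i < j)%N -> best <= h (2 ^ i)%N%:Z) -> best <= h 0 ->
    best = h (2 ^ j)./2%:Z ->
    (e (2 ^ j)%N%:Z = 0 -> best <= h (2 ^ j)%N%:Z) ->
  forall k : nat, e k%:Z = 0 -> h 0 - h k%:Z <= 2 * (h 0 - best).
Proof.
move=> le_h le_h0 Dbest stop k ek.
have [->|k0] := posnP k; first by rewrite subrr; lia.
have [gain|gain] := leP (h 0 - h k%:Z) 0; first by lia.
have [lt_k|le_k] := ltnP k (2 ^ j).
  have /andP[le_ik lt_ki] := trunc_log_bounds (isT : (1 < 2)%N) k0.
  set i := trunc_log 2 k in le_ik lt_ki.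
  have ij : (i < j)%N by rewrite -(@ltn_exp2l 2) // (leq_ltn_trans le_ik).
  have := le_h _ ij; move: lt_ki le_ik; rewrite expnS mul2n -addnn.
  move: (2 ^ i)%N => p lt_kp le_pk hi.
  have p0 : 0 <= p%:Z by []. have pk : p%:Z <= k%:Z by lia.
  have := ch p0 pk; rewrite !subr0.
  have kp : 0 <= p%:Z + p%:Z - k%:Z by lia. have k0' : 0 <= k%:Z by lia.
  have := ler_wpM2l k0' hi; have := ler_wpM2l kp (ltW gain).
  have kpos : 0 < k%:Z by lia.
  rewrite -[_ <= 2 * _](ler_pM2l kpos).
  clear; move: (k%:Z) (p%:Z) (h 0) (h _) (h _) => *; lia.
have half_lt : ((2 ^ j)./2 < 2 ^ j)%N.
  have := expn_gt0 2 j; have := odd_double_half (2 ^ j); lia.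
have ej : e (2 ^ j)%N%:Z = 0.
  by apply: feasible_segment ek; rewrite ?lez_nat.
suff : best <= h k%:Z by move: le_h0; clear; move: (h 0) (h _) => *; lia.
have := stop ej; move: half_lt le_k Dbest.
move: (2 ^ j)%N (2 ^ j)./2 => p q lt_qp le_pk Dbest le_best.
have qp : q%:Z <= p%:Z by lia. have pk : p%:Z <= k%:Z by lia.
have := ch qp pk; rewrite -Dbest.
have kq : 0 <= k%:Z - q%:Z by lia. have pq : 0 < p%:Z - q%:Z by lia.
have := ler_wpM2l kq le_best; rewrite -[best <= h k%:Z](ler_pM2l pq).
by clear; move: (k%:Z) (p%:Z) (q%:Z) (h _) (h _) => *; lia.
Qed.

End LineSearch.

(** By Bernoulli's inequality M + 1 steps halve a quantity that is multiplied
    by M / (M + 1) in each step. *)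
Lemma geometric_bound (M J k : nat) : (0 < M)%N ->
  (M.+1 ^ k <= M ^ k * 2 ^ J -> k <= M.+1 * J)%N.
Proof.
move=> M0 le_k; rewrite leqNgt; apply/negP => lt_k.
have bernoulli i : (M ^ i.+1 + i.+1 * M ^ i <= M.+1 ^ i.+1)%N.
  elim: i => [|i IHi]; first by rewrite !expn1 expn0; lia.
  rewrite expnS [leqRHS]expnS; move: IHi; rewrite [(M ^ i.+1)%N]expnS.
  by move: (M ^ i)%N (M.+1 ^ i.+1)%N => a b; nia.
have double : (2 * M ^ M.+1 <= M.+1 ^ M.+1)%N.
  by apply: leq_trans (bernoulli M); rewrite expnS; lia.
have double_pow i : (2 ^ i * M ^ (M.+1 * i) <= M.+1 ^ (M.+1 * i))%N.
  by case: i => [|i]; rewrite ?muln0 // !expnM -expnMn leq_exp2r.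
have [i Di] : exists i, k = (M.+1 * J + i.+1)%N.
  by exists (k - (M.+1 * J).+1)%N; lia.
have M_exp m : (0 < M ^ m)%N by rewrite expn_gt0 M0.
move: le_k; rewrite Di !(expnD _ (M.+1 * J)%N i.+1) => le_k.
have lt_exp : (M ^ i.+1 < M.+1 ^ i.+1)%N by rewrite ltn_exp2r.
have := double_pow J; move: le_k (M_exp (M.+1 * J)%N) (expn_gt0 2 J) lt_exp.
move: (M ^ (M.+1 * J))%N (M.+1 ^ (M.+1 * J))%N (M ^ i.+1)%N (M.+1 ^ i.+1)%N (2 ^ J)%N.
move=> a b c f g le1 a0 g0 lt_cf le2.
have : (b * c < b * f)%N by rewrite ltn_pmul2l; nia.
have : (g * a * c <= b * c)%N by rewrite leq_mul2r le2 orbT.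
by lia.
Qed.

End Augmentation.

(** * Annotated programs and their total correctness *)

Declare Scope expr_scope.
Delimit Scope expr_scope with X.
Notation "x [+] y" := (Bin Defs.Add x y) (at level 50, left associativity) : expr_scope.
Notation "x [-] y" := (Bin Defs.Sub x y) (at level 50, left associativity) : expr_scope.
Notation "x [*] y" := (Bin Defs.Mul x y) (at level 40, left associativity) : expr_scope.
Notation "x [/] y" := (Bin Defs.Div x y) (at level 40, left associativity) : expr_scope.
Notation "# x" := (Get x (Cst 0)) (at level 1, x at level 0, format "# x") : expr_scope.

Section ProgramLogic.
Local Open Scope ring_scope.
Local Open Scope expr_scope.

Lemma bitlen_le (x : int) (B : nat) : (`|x| <= B)%N -> (bitlen x <= bitlen B%:Z)%N.
Proof. by move=> xB; rewrite /bitlen ltnS leq_up_log. Qed.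

Lemma bitlen_mono (x y z : int) : (`|x|.+1 <= `|y|.+1 * `|z|.+1)%N ->
  (bitlen x <= bitlen y + bitlen z)%N.
Proof.
move=> le_x; suff : (up_log 2 `|x|.+1 <= up_log 2 `|y|.+1 + up_log 2 `|z|.+1)%N.
  by rewrite /bitlen; lia.
apply: leq_trans (leq_up_log 2 le_x) _; apply: up_log_min => //.
by rewrite expnD; apply: leq_mul; apply: up_logP.
Qed.

Lemma absz_divz_le (x y : int) : (`|(x %/ y)%Z| <= `|x|)%N.
Proof.
have [->|y0] := eqVneq y 0; first by rewrite divz0.
have Dx := divz_eq x y; have r_ge0 := modz_ge0 x y0; have r_lt := ltz_mod x y0.
have : (absz ((x %/ y)%Z * y)%R < absz x + absz y)%N by lia.
rewrite abszM => lt_x; rewrite leqNgt; apply/negP => le_x.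
have : (0 < `|y|)%N by lia.
by move: lt_x le_x; move: (absz (x %/ y)%Z) (absz x) (absz y); nia.
Qed.

Lemma bitlen_arith o x y : (bitlen (arith_sem o x y) <= bitlen x + bitlen y)%N.
Proof.
apply: bitlen_mono; have := absz_divz_le x y; case: o => /= *; nia.
Qed.

(** In terms of the longest cell, [esize] bounds the length of the value of an
    expression and [kcost] the cost of its evaluation; this is possible because
    no operation yields more digits than its arguments have together. *)
Fixpoint esize (e : expr) : nat :=
  match e with
  | Cst z => bitlen z
  | Get _ _ => 1
  | Bin _ e1 e2 => esize e1 + esize e2
  end.

Fixpoint kcost (e : expr) : nat :=
  match e with
  | Cst z => bitlen z
  | Get _ e1 => kcost e1 + esize e1 + 1
  | Bin _ e1 e2 => kcost e1 + kcost e2 + (esize e1 + esize e2)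
  end.

Definition ksize e := (kcost e + esize e)%N.

Section Expressions.
Variables (st : store) (L : nat).
Hypothesis stL : forall a i, (bitlen (st a i) <= L)%N.

Lemma bitlen_eval e : (bitlen (eval st e) <= esize e * L)%N.
Proof.
have L0 : (0 < L)%N by apply: leq_trans (stL 0%N 0%N).
elim: e => [z|a e _|o e1 IH1 e2 IH2] /=; first by nia.
  by rewrite mul1n.
by apply: leq_trans (bitlen_arith _ _ _) _; rewrite mulnDl leq_add.
Qed.

Lemma ucost_le e : (ucost st e <= ksize e * L)%N.
Proof.
have L0 : (0 < L)%N by apply: leq_trans (stL 0%N 0%N).
rewrite /ucost /ksize mulnDl leq_add ?bitlen_eval //.
elim: e => [z|a e IH|o e1 IH1 e2 IH2] /=; first by nia.
  by rewrite !mulnDl mul1n !leq_add ?bitlen_eval.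
by rewrite !mulnDl !leq_add ?bitlen_eval.
Qed.

End Expressions.

(** Programs whose loops carry a bound c * M ^ k on their number of iterations,
    where M is a measure of the instance; this makes [time] a function of the
    program text and of M alone. *)
Inductive acmd :=
  | ASkip
  | AAsg of nat & expr & expr
  | ASeq of acmd & acmd
  | AIf of expr & acmd & acmd
  | AWhile (c k : nat) of expr & acmd
  | AAsk (c : nat) of oracle_name & nat & nat.

Fixpoint erase (P : acmd) : cmd :=
  match P with
  | ASkip => Skip
  | AAsg a i e => Asg a i e
  | ASeq P1 P2 => Seq (erase P1) (erase P2)
  | AIf e P1 P2 => If e (erase P1) (erase P2)
  | AWhile _ _ e P1 => While e (erase P1)
  | AAsk _ o a d => Ask o a d
  end.

Fixpoint time (M : nat) (P : acmd) : nat :=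
  match P with
  | ASkip => 1
  | AAsg a i e => (ksize i + ksize e) * M
  | ASeq P1 P2 => time M P1 + time M P2
  | AIf e P1 P2 => ksize e * M + (time M P1 + time M P2)
  | AWhile c k e P1 => (c * M ^ k).+1 * (ksize e * M + time M P1)
  | AAsk c o a d => (c * M).+1 * M
  end.

Definition poly_bounded (T : nat -> nat) :=
  exists c k, forall M, (0 < M)%N -> (T M <= c * M ^ k)%N.

Lemma poly_bounded_cst c : poly_bounded (fun=> c).
Proof. by exists c, 0 => M _; rewrite expn0 muln1. Qed.

Lemma poly_bounded_id : poly_bounded id.
Proof. by exists 1, 1 => M _; rewrite mul1n expn1. Qed.

Lemma poly_bounded_mul T1 T2 : poly_bounded T1 -> poly_bounded T2 ->
  poly_bounded (fun M => T1 M * T2 M)%N.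
Proof.
move=> [c1 [k1 H1]] [c2 [k2 H2]]; exists (c1 * c2)%N, (k1 + k2)%N => M M0.
by rewrite expnD mulnACA leq_mul ?H1 ?H2.
Qed.

Lemma poly_bounded_add T1 T2 : poly_bounded T1 -> poly_bounded T2 ->
  poly_bounded (fun M => T1 M + T2 M)%N.
Proof.
move=> [c1 [k1 H1]] [c2 [k2 H2]]; exists (c1 + c2)%N, (k1 + k2)%N => M M0.
rewrite mulnDl expnD leq_add //.
  by apply: leq_trans (H1 M M0) _; rewrite leq_mul2l leq_pmulr ?orbT // expn_gt0 M0.
by apply: leq_trans (H2 M M0) _; rewrite leq_mul2l leq_pmull ?orbT // expn_gt0 M0.
Qed.

Lemma poly_bounded_exp T k : poly_bounded T -> poly_bounded (fun M => T M ^ k)%N.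
Proof.
move=> pT; elim: k => [|k IHk]; first exact: poly_bounded_cst.
have [c [e H]] := poly_bounded_mul pT IHk; exists c, e => M M0.
by rewrite expnS H.
Qed.

Lemma poly_bounded_comp T1 T2 :
  (forall M, (0 < M)%N -> (0 < T2 M)%N) ->
  poly_bounded T1 -> poly_bounded T2 -> poly_bounded (fun M => T1 (T2 M)).
Proof.
move=> T2_gt0 [c [e H1]] pT2.
have [c' [e' H]] := poly_bounded_mul (poly_bounded_cst c) (poly_bounded_exp e pT2).
by exists c', e' => M M0; apply: leq_trans (H1 _ (T2_gt0 _ M0)) (H M M0).
Qed.

Lemma time_poly P : poly_bounded (time^~ P).
Proof.
have pM := poly_bounded_id.
elim: P => [|a i e|P1 IH1 P2 IH2|e P1 IH1 P2 IH2|c k e P IHP|c o a d] /=.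
- exact: poly_bounded_cst.
- by apply: poly_bounded_mul pM; apply: poly_bounded_cst.
- exact: poly_bounded_add.
- apply: poly_bounded_add; last exact: poly_bounded_add.
  by apply: poly_bounded_mul pM; apply: poly_bounded_cst.
- have [c1 [k1 H]] := poly_bounded_mul
    (poly_bounded_add (poly_bounded_cst 1)
      (poly_bounded_mul (poly_bounded_cst c) (poly_bounded_exp k pM)))
    (poly_bounded_add (poly_bounded_mul (poly_bounded_cst (ksize e)) pM) IHP).
  by exists c1, k1.
have [c1 [k1 H]] := poly_bounded_mul
  (poly_bounded_add (poly_bounded_cst 1) (poly_bounded_mul (poly_bounded_cst c) pM)) pM.
by exists c1, k1.
Qed.

(** Syntactic, so that frame conditions hold by computation. *)
Fixpoint writes (P : cmd) : seq nat :=
  match P with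
  | Skip => [::]
  | Asg a _ _ => [:: a]
  | Seq P1 P2 | If _ P1 P2 => writes P1 ++ writes P2
  | While _ P1 => writes P1
  | Ask _ _ d => [:: d]
  end.

Lemma exec_frame orc P st c st' : exec orc P st c st' ->
  forall a, a \notin writes P -> st' a = st a.
Proof.
elim=> {P st c st'} //=.
- by move=> st a i e b; rewrite inE /update => /negPf->.
- by move=> s1 s2 s3 c1 c2 P Q _ IHP _ IHQ a; rewrite mem_cat => /norP[aP aQ]; rewrite IHQ ?IHP.
- by move=> s s' c e P Q _ _ IH a; rewrite mem_cat => /norP[aP _]; apply: IH.
- by move=> s s' c e P Q _ _ IH a; rewrite mem_cat => /norP[_ aQ]; apply: IH.
- by move=> s1 s2 s3 c1 c2 e P _ _ IHP _ IHW a aP; rewrite IHW ?IHP.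
by move=> st o a d b; rewrite inE /update => /negPf->.
Qed.

Section Rules.
Variables (orc : oracle_name -> oracle) (B M : nat).
Hypothesis BM : (bitlen B%:Z <= M)%N.

Definition bounded (st : store) := forall a i, (`|st a i| <= B)%N.

(** Total correctness within the time bound. Boundedness of the cells is part of
    the triple because it is what bounds the cost of the steps. *)
Definition runs (P : acmd) (st : store) (Q : store -> Prop) := bounded st ->
  exists c st', [/\ exec orc (erase P) st c st', (c <= time M P)%N, bounded st' & Q st'].

Definition frame (P : acmd) (st st' : store) :=
  forall a, a \notin writes (erase P) -> st' a = st a.

Lemma ucost_bounded st e : bounded st -> (ucost st e <= ksize e * M)%N.
Proof. by move=> stB; apply: ucost_le => a i; apply: leq_trans BM; apply: bitlen_le. Qed.

Lemma runs_bounded P st Q : (bounded st -> runs P st Q) -> runs P st Q.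
Proof. by move=> H stB; apply: H. Qed.

Lemma runs_conseq P st (Q Q' : store -> Prop) : runs P st Q ->
  (forall st', frame P st st' -> bounded st' -> Q st' -> Q' st') -> runs P st Q'.
Proof.
move=> H HQ stB; have [c [st' [E cT st'B Qst']]] := H stB.
by exists c, st'; split=> //; apply: HQ => // a; apply: exec_frame E a.
Qed.

Lemma runs_skip st (Q : store -> Prop) : Q st -> runs ASkip st Q.
Proof. by move=> Qst stB; exists 1%N, st; split=> //; apply: exec_skip. Qed.

Lemma bounded_update st a i v : bounded st -> (`|v| <= B)%N -> bounded (update st a i v).
Proof. by move=> stB vB b j; rewrite /update; case: ifP. Qed.

Lemma runs_asg a i e st (Q : store -> Prop) : (`|eval st e| <= B)%N ->
  Q (update st a `|eval st i|%N (eval st e)) -> runs (AAsg a i e) st Q.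
Proof.
move=> eB Qst stB; do 2 eexists; split; [exact: exec_asg| | |exact: Qst].
  by rewrite /= mulnDl leq_add ?ucost_bounded.
exact: bounded_update.
Qed.

Lemma runs_seq P1 P2 st (Q : store -> Prop) :
  runs P1 st (fun st1 => runs P2 st1 Q) -> runs (ASeq P1 P2) st Q.
Proof.
move=> H stB; have [c1 [st1 [E1 cT1 st1B H2]]] := H stB.
have [c2 [st2 [E2 cT2 st2B Q2]]] := H2 st1B.
by exists (c1 + c2)%N, st2; split=> //; [apply: exec_seq E2 | rewrite /= leq_add].
Qed.

Lemma runs_call P1 P2 st (R Q : store -> Prop) : runs P1 st R ->
  (forall st1, frame P1 st st1 -> bounded st1 -> R st1 -> runs P2 st1 Q) ->
  runs (ASeq P1 P2) st Q.
Proof. by move=> H1 H2; apply: runs_seq; apply: runs_conseq H1 _. Qed.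

Lemma runs_if e P1 P2 st (Q : store -> Prop) :
  (0 < eval st e -> runs P1 st Q) -> (eval st e <= 0 -> runs P2 st Q) ->
  runs (AIf e P1 P2) st Q.
Proof.
move=> H1 H2 stB; have := ucost_bounded e stB.
have [e0|e0] := ltP 0 (eval st e).
  have [c [st' [E cT st'B Qst']]] := H1 e0 stB => cost_e.
  exists (ucost st e + c)%N, st'; split=> //; first exact: exec_if_true.
  by rewrite /= leq_add // (leq_trans cT) ?leq_addr.
have [c [st' [E cT st'B Qst']]] := H2 e0 stB => cost_e.
exists (ucost st e + c)%N, st'; split=> //; first exact: exec_if_false.
by rewrite /= leq_add // (leq_trans cT) ?leq_addl.
Qed.

Lemma runs_while c k e P st (I : nat -> store -> Prop) (Q : store -> Prop) :
    I 0 st ->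
    (forall j s, frame P st s -> bounded s -> I j s -> 0 < eval s e ->
       (j < c * M ^ k)%N /\ runs P s (I j.+1)) ->
    (forall j s, frame P st s -> bounded s -> I j s -> eval s e <= 0 -> Q s) ->
  runs (AWhile c k e P) st Q.
Proof.
move=> I0 step stop stB; pose b := (c * M ^ k)%N.
suff H n j s : frame P st s -> bounded s -> I j s -> (b - j <= n)%N ->
    exists t s', [/\ exec orc (While e (erase P)) s t s',
      (t <= n.+1 * (ksize e * M + time M P))%N, bounded s' & Q s'].
  by apply: (H b 0 st) => //; rewrite subn0.
elim: n j s => [|n IHn] j s fr sB Ij le_n; have := ucost_bounded e sB => cost_e;
  have [e0|e0] := ltP 0 (eval s e).
- by have [] := step j s fr sB Ij e0; rewrite -/b; lia.
- exists (ucost s e), s; split=> //; [exact: exec_while_false| |exact: (stop j s)].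
  by rewrite mul1n (leq_trans cost_e) ?leq_addr.
- have [lt_j /(_ sB)[t1 [s1 [E1 tT1 s1B I1]]]] := step j s fr sB Ij e0.
  have fr1 : frame P st s1 by move=> a aP; rewrite (exec_frame E1 aP) fr.
  have [|t2 [s2 [E2 tT2 s2B Q2]]] := IHn j.+1 s1 fr1 s1B I1; first by lia.
  exists (ucost s e + t1 + t2)%N, s2; split=> //; first exact: exec_while_true E2.
  by rewrite mulSn !leq_add.
exists (ucost s e), s; split=> //; [exact: exec_while_false| |exact: (stop j s)].
by rewrite (leq_trans cost_e) // mulSn -addnA leq_addr.
Qed.

Definition AFor (c k i : nat) (e : expr) (P : acmd) : acmd :=
  ASeq (AAsg i (Cst 0) (Cst 0))
    (AWhile c k (e [-] #i)
       (ASeq P (AAsg i (Cst 0) (#i [+] Cst 1)))).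

Lemma runs_for c k i e P st (m : nat) (I : nat -> store -> Prop) (Q : store -> Prop) :
    i \notin writes (erase P) -> (m <= c * M ^ k)%N -> (m <= B)%N ->
    (forall s, (forall a, a \notin i :: writes (erase P) -> s a = st a) ->
       eval s e = m%:Z) ->
    I 0 (update st i 0 0) ->
    (forall j s, (j < m)%N -> (forall a, a \notin i :: writes (erase P) -> s a = st a) ->
       s i 0%N = j%:Z -> bounded s -> I j s ->
       runs P s (fun s' => I j.+1 (update s' i 0%N j.+1%:Z))) ->
    (forall s, (forall a, a \notin i :: writes (erase P) -> s a = st a) ->
       bounded s -> I m s -> Q s) ->
  runs (AFor c k i e P) st Q.
Proof.
move=> iP mM mB em I0 step stop; apply: runs_seq; apply: runs_asg => //=.
pose st0 := update st i 0 0; rewrite -/st0.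
pose J j (s : store) := [/\ s i 0%N = j%:Z, (j <= m)%N & I j s].
set body := ASeq P _.
have fr_st s : frame body st0 s -> forall a, a \notin i :: writes (erase P) -> s a = st a.
  move=> fr a; rewrite inE negb_or => /andP[a_i aP]; rewrite fr /st0 /update ?(negPf a_i) //.
  by rewrite /= mem_cat negb_or aP inE.
apply: (@runs_while _ _ _ _ _ J) => //.
- by split=> //; rewrite /st0 /update !eqxx.
- move=> j s fr sB [si jm Ij] /=; rewrite (em _ (fr_st _ fr)) si subr_gt0 ltz_nat => lt_j.
  split; first exact: leq_trans lt_j mM.
  apply: runs_call (step j s lt_j (fr_st _ fr) si sB Ij) _ => s' fr' s'B Ij'.
  have s'i : s' i 0%N = j%:Z by rewrite fr'.
  apply: runs_asg; rewrite /= s'i; first by lia.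
  rewrite -[j%:Z + 1]/(j%:Z + 1%:Z) -PoszD addn1 /=.
  by split=> //; rewrite /update !eqxx.
move=> j s fr sB [si jm Ij] /=; rewrite (em _ (fr_st _ fr)) si subr_le0 lez_nat => mj.
have Dj : j = m by lia.
by apply: stop => //; rewrite -?Dj; first exact: fr_st.
Qed.

Lemma runs_ask c o a d st (Q : store -> Prop) :
    let v := ofun (read_vec st a (odim (orc o))) in
    (odim (orc o) <= c * M)%N -> (`|v| <= B)%N -> Q (update st d 0 v) ->
  runs (AAsk c o a d) st Q.
Proof.
move=> v dimM vB Qv stB; do 2 eexists; split; [exact: exec_ask| | |exact: Qv].
  have le_M x : (`|x| <= B)%N -> (bitlen x <= M)%N.
    by move=> xB; apply: leq_trans BM; apply: bitlen_le.
  rewrite /= mulSn addnC leq_add ?le_M //.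
  apply: leq_trans (_ : \sum_(i < odim (orc o)) M <= _)%N.
    by apply: leq_sum => i _; rewrite mxE le_M.
  by rewrite sum_nat_const card_ord leq_mul2r dimM orbT.
exact: bounded_update.
Qed.

End Rules.
End ProgramLogic.

(** * Multiplication by an n-fold matrix *)

Notation "P1 ;; P2" := (ASeq P1 P2) (at level 90, right associativity) : expr_scope.

(** Memory layout; scalars are kept at index 0 of arrays of their own. The
    arrays 0 to 9 hold the input. *)
Notation aFlag := 10%N (only parsing).
Notation aX := 11%N (only parsing).
Notation aTabA := 15%N (only parsing).
Notation aTabW := 16%N (only parsing).
Notation aZero := 17%N (only parsing).
Notation aZ := 19%N (only parsing).
Notation aCand := 20%N (only parsing).
Notation aBest := 21%N (only parsing).
Notation aOut := 22%N (only parsing).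
Notation vPhi := 24%N (only parsing).
Notation vAcc := 25%N (only parsing).
Notation vOk := 26%N (only parsing).
Notation vVal := 27%N (only parsing).
Notation vF := 28%N (only parsing).
Notation vG := 29%N (only parsing).
Notation vPhase := 30%N (only parsing).
Notation vDigits := 31%N (only parsing).
Notation vCode := 32%N (only parsing).
Notation vLam := 33%N (only parsing).
Notation vPrev := 34%N (only parsing).
Notation vBest := 35%N (only parsing).
Notation vCur := 36%N (only parsing).
Notation vGo := 37%N (only parsing).
Notation vGoOn := 38%N (only parsing).
Notation vI := 39%N (only parsing).
Notation vJ := 40%N (only parsing).
Notation vInf := 41%N (only parsing).
Notation vNorm := 42%N (only parsing).

Section Program.
Local Open Scope ring_scope.
Local Open Scope expr_scope.

Definition mod_expr e d := e [-] (e [/] d) [*] d.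

Definition assign a e := AAsg a (Cst 0) e.
Definition add_to a i e := AAsg a i (Get a i [+] e).

Lemma eval_mod st e d (m k : nat) :
  eval st e = m%:Z -> eval st d = k%:Z -> eval st (mod_expr e d) = (m %% k)%N%:Z.
Proof.
rewrite /mod_expr /= => -> ->; rewrite divz_nat.
have := congr1 Posz (divn_eq m k); rewrite PoszD PoszM.
by move: (m %/ k)%N (m %% k)%N => a b ->; ring.
Qed.

(** Entries of the n-fold matrix are found in the table of the bimatrix by
    division with remainder, see [nfold_entry]. *)
Definition mul_nfold (r s t tab : nat) : acmd :=
  let size e := #0 [*] Cst e in
  let term row :=
    add_to aOut #vI (Get tab (row [*] Cst t [+] mod_expr #vJ (Cst t)) [*] Get aCand #vJ) in
  let i' := #vI [-] Cst r in
  let diff := i' [/] Cst s [-] #vJ [/] Cst t in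
  AFor (r + s) 1 vI (Cst r [+] size s%:Z)
    (AAsg aOut #vI (Cst 0) ;;
     AFor t 1 vJ (size t%:Z)
       (AIf (Cst r%:Z [-] #vI) (term #vI)
         (AIf (Cst 1 [-] diff [*] diff) (term (Cst r [+] mod_expr i' (Cst s))) ASkip))).

Section Instance.
Variables (n t : nat) (orc : oracle_name -> oracle) (B M : nat).
Hypotheses (BM : (bitlen B%:Z <= M)%N) (nM : (n <= M)%N).
Let N := (n * t)%N.

Lemma size_le (c e : nat) : (c + n * e <= (c + e) * M ^ 1)%N.
Proof.
have M0 : (0 < M)%N by apply: leq_trans BM.
rewrite expn1 mulnDl leq_add ?leq_pmulr //.
by rewrite mulnC leq_mul2l nM orbT.
Qed.

Lemma runs_mul_nfold r s (A : 'M[int]_(r + s, t)) tab st (alpha Y : nat) :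
    tab \notin [:: aOut; vI; vJ] -> st 0 0%N = n%:Z ->
    (forall i j, (i < r + s)%N -> (j < t)%N -> st tab (i * t + j)%N = ent A i j) ->
    (forall i j, `|ent A i j| <= alpha)%N ->
    (forall j, (j < N)%N -> (`|st aCand j| <= Y)%N) ->
    (r + n * s <= B)%N -> (N <= B)%N -> (N * (alpha * Y) <= B)%N ->
  runs orc B M (mul_nfold r s t tab) st (fun st' =>
    forall i, st' aOut i = if insub i is Some i' then
       (nfold n A *m read_vec st aCand N) i' ord0 else st aOut i).
Proof.
move=> tab_fresh st0 stA le_alpha le_Y mB NB sumB.
pose F (i j : nat) := (if (i < r)%N then ent A i (j %% t)
    else if ((i - r) %/ s == j %/ t)%N then ent A (r + (i - r) %% s) (j %% t) else 0)
  * st aCand j.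
have F_le i j : (j < N)%N -> (`|F i j| <= alpha * Y)%N.
  move=> jN; rewrite /F abszM leq_mul ?le_Y //.
  by case: ifP => // _; case: ifP.
have sumF_le i k : (k <= N)%N -> (`|(\sum_(j < k) F i j)%R| <= B)%N.
  move=> kN; apply: leq_trans sumB; apply: (@leq_trans (k * (alpha * Y))); last first.
    by rewrite leq_mul2r kN orbT.
  elim: k kN => [|k IHk] kN; first by rewrite big_ord0.
  rewrite big_ord_recr /= mulSn; have := IHk (ltnW kN); have := F_le i k kN.
  by move: (F i k) (\sum_(j < k) _) => a b; lia.
have row_out (i : 'I_(r + n * s)) :
    (nfold n A *m read_vec st aCand N) i ord0 = \sum_(j < N) F i j.
  rewrite mxE; apply: eq_bigr => j _; rewrite nfold_entry mxE.
  by rewrite /F.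
pose I (k : nat) (s' : store) := forall i, s' aOut i =
  if (i < k)%N then \sum_(j < N) F i j else st aOut i.
have tab_out : (tab == aOut) = false /\ (tab == vI) = false /\ (tab == vJ) = false.
  by move: tab_fresh; rewrite !inE => /norP[/negPf-> /norP[/negPf-> /negPf->]].
apply: (@runs_for _ _ _ BM _ _ _ _ _ _ (r + n * s) I) => //.
- exact: size_le.
- by move=> s' fr /=; rewrite (fr 0%N) // st0.
- move=> k s' km fr s'I s'B Ik.
  apply: runs_seq; apply: (runs_asg _ BM) => //.
  have fr_cand j : s' aCand j = st aCand j by rewrite fr.
  have fr_tab j : s' tab j = st tab j.
    by rewrite fr // /= !inE; case: tab_out => -> [-> ->].
  rewrite /= s'I /=; set s1 := update _ _ _ _.
  pose J (j : nat) (s2 : store) := forall i, s2 aOut i =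
    if i == k then \sum_(j' < j) F i j' else s' aOut i.
  apply: (@runs_for _ _ _ BM _ _ _ _ _ _ N J) => //.
  + by have := size_le 0 t; rewrite add0n.
  + by move=> s2 fr2 /=; rewrite (fr2 0%N) // /s1 /update /= (fr 0%N) // st0.
  + by move=> i; rewrite /s1 /update /= big_ord0.
  + move=> j s2 jN fr2 s2J s2B Jj.
    have s2I : s2 vI 0%N = k%:Z by rewrite fr2.
    have s2_cand : s2 aCand j = st aCand j by rewrite fr2 // -fr_cand.
    have s2_tab j' : s2 tab j' = st tab j'.
      rewrite fr2 /s1 /update; last by rewrite /= !inE; case: tab_out => -> [_ ->].
      by case: tab_out => -> _; rewrite fr_tab.
    have t0 : (0 < t)%N by rewrite lt0n; apply: contraTneq jN => t0; rewrite /N t0 muln0.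
    have ev_mod : eval s2 (mod_expr #vJ (Cst t)) = (j %% t)%N%:Z.
      by apply: eval_mod; rewrite /= ?s2J.
    have term_ok row (x : nat) : (x < r + s)%N -> eval s2 row = x%:Z ->
        F k j = ent A x (j %% t) * st aCand j ->
        runs orc B M (add_to aOut #vI (Get tab (row [*] Cst t [+] mod_expr #vJ (Cst t))
          [*] Get aCand #vJ)) s2 (fun s3 => J j.+1 (update s3 vJ 0 j.+1%:Z)).
      move=> x_lt ev_row DF.
      have ev_term : eval s2 (Get aOut #vI [+] Get tab (row [*] Cst t [+] mod_expr #vJ (Cst t))
          [*] Get aCand #vJ) = \sum_(j' < j.+1) F k j'.
        rewrite big_ord_recr /= DF; move: ev_mod => /= ->; rewrite ev_row s2I s2J /=.
        rewrite (Jj k) eqxx s2_cand s2_tab.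
        by rewrite stA ?ltn_pmod.
      apply: (runs_asg _ BM); rewrite ev_term; first exact: sumF_le.
      move=> i; rewrite /update /= s2I /=.
      by have [->//|ik] := eqVneq i k; rewrite Jj (negPf ik).
    apply: (runs_if BM) => /=; rewrite s2I => lt_r.
      have kr : (k < r)%N by lia.
      apply: (term_ok _ k) => //; first by lia.
      by rewrite /F kr.
    have rk : (r <= k)%N by lia.
    have s0 : (0 < s)%N.
      by rewrite lt0n; apply: contraTneq km => ->; rewrite muln0 addn0 -leqNgt.
    have ev_i : eval s2 (#vI [-] Cst r) = (k - r)%N%:Z by rewrite /= s2I; lia.
    have /= ev_mod_i := eval_mod ev_i (erefl : eval s2 (Cst s) = s%:Z).
    apply: (runs_if BM) => /=; move: ev_i => /= ev_i; rewrite ?ev_i ?s2J !divz_nat => same.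
      apply: (term_ok _ (r + (k - r) %% s)%N).
      * by rewrite ltn_add2l ltn_pmod.
      * by rewrite /= ev_mod_i PoszD.
      rewrite /F ltnNge rk /=.
      have -> : ((k - r) %/ s == j %/ t)%N by move: same; nia.
      by [].
    apply: runs_skip => i; rewrite /update /=; have [->|ik] := eqVneq i k; last first.
      by rewrite Jj (negPf ik).
    have Fkj : F k j = 0.
      rewrite /F ltnNge rk /=; case: eqP => [E|_]; last by rewrite mul0r.
      by move: same; rewrite E subrr mul0r subr0.
    by rewrite big_ord_recr /= Jj eqxx Fkj addr0.
  move=> s2 fr2 s2B JN i; rewrite /update /= JN.
  have [->|ik] := eqVneq i k; first by rewrite ltnSn.
  by rewrite Ik ltnS [(i <= k)%N]leq_eqVlt (negPf ik).
move=> s' fr s'B Im i; rewrite Im; case: insubP => [i' lt_i Di|/negPf->//].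
by rewrite lt_i row_out Di.
Qed.

End Instance.
End Program.

(** * Penalties for violated bounds *)

Section Penalty.
Local Open Scope ring_scope.
Local Open Scope expr_scope.

(** Amount by which v violates a lower (upper) bound given by its tag and its
    finite value; a bound that no integer satisfies counts for 1, which keeps
    the penalty convex. *)
Definition pen_lower (tag fin v : int) : int :=
  if 0 < tag then 1
  else if 0 < tag + 1 then (if 0 < fin - v then fin - v else 0) else 0.

Definition pen_upper (tag fin v : int) : int :=
  if 0 < 0 - tag then 1
  else if 0 < 1 - tag then (if 0 < v - fin then v - fin else 0) else 0.

Definition penalty (tl fl tu fu v : int) : int :=
  pen_lower tl fl v + pen_upper tu fu v.

Definition squares (fl fu v : int) : int := v * v + fl * fl + fu * fu.

Lemma pen_lower_ge0 tag fin v : 0 <= pen_lower tag fin v.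
Proof. by rewrite /pen_lower; do 3!case: ifP => // ?; lia. Qed.

Lemma pen_upper_ge0 tag fin v : 0 <= pen_upper tag fin v.
Proof. by rewrite /pen_upper; do 3!case: ifP => // ?; lia. Qed.

Lemma penalty_ge0 tl fl tu fu v : 0 <= penalty tl fl tu fu v.
Proof. by rewrite addr_ge0 ?pen_lower_ge0 ?pen_upper_ge0. Qed.

Lemma squares_ge0 fl fu v : 0 <= squares fl fu v.
Proof. by rewrite /squares !addr_ge0 // -expr2 sqr_ge0. Qed.

Lemma convex1_pos_part (a b : int) :
  convex1 (fun v => if 0 < a * v + b then a * v + b else 0).
Proof.
move=> x y z xy yz /=.
have zy0 : 0 <= z - y by lia. have yx0 : 0 <= y - x by lia. have zx0 : 0 <= z - x by lia.
set hx := if 0 < a * x + b then _ else _; set hz := if 0 < a * z + b then _ else _.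
have [hx0 hxl] : 0 <= hx /\ a * x + b <= hx by rewrite /hx; case: ltP; lia.
have [hz0 hzl] : 0 <= hz /\ a * z + b <= hz by rewrite /hz; case: ltP; lia.
case: ltP => _; last by rewrite mulr0 addr_ge0 ?mulr_ge0.
have -> : (z - x) * (a * y + b) = (z - y) * (a * x + b) + (y - x) * (a * z + b) by ring.
by rewrite lerD ?ler_wpM2l.
Qed.

Lemma convex1_penalty tl fl tu fu : convex1 (penalty tl fl tu fu).
Proof.
apply: (@convex1_add (pen_lower tl fl) (pen_upper tu fu)).
  rewrite /pen_lower; case: ltP => _; first exact: convex1_cst.
  case: ltP => _; last exact: convex1_cst.
  have := convex1_pos_part (-1) fl; congr convex1; apply/funext => v.
  by rewrite mulN1r addrC.
rewrite /pen_upper; case: ltP => _; first exact: convex1_cst.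
case: ltP => _; last exact: convex1_cst.
have := convex1_pos_part 1 (- fu); congr convex1; apply/funext => v.
by rewrite mul1r.
Qed.

Lemma penalty_eq0 (l u : \bar int) v :
  penalty (etag l) (efin l) (etag u) (efin u) v = 0 <-> (l <= v%:E <= u)%E.
Proof.
have lower : pen_lower (etag l) (efin l) v = 0 <-> (l <= v%:E)%E.
  case: l => [l||] /=; rewrite /pen_lower /= ?lee_fin ?leye_eq ?leNye //.
  by case: ifP => ?; split; lia.
have upper : pen_upper (etag u) (efin u) v = 0 <-> (v%:E <= u)%E.
  case: u => [u||] /=; rewrite /pen_upper /= ?lee_fin ?leey ?leeNy_eq //.
  by case: ifP => ?; split; lia.
have := pen_lower_ge0 (etag l) (efin l) v; have := pen_upper_ge0 (etag u) (efin u) v.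
rewrite /penalty => u0 l0; split=> [pen0|/andP[/lower-> /upper->] //].
by apply/andP; split; [apply/lower | apply/upper]; lia.
Qed.

Lemma penalty_le tl fl tu fu v (c Y : nat) : (`|fl| <= c)%N -> (`|fu| <= c)%N ->
  (`|v| <= Y)%N -> penalty tl fl tu fu v <= ((Y + c).*2 + 2)%N%:Z.
Proof.
rewrite -addnn => flc fuc vY.
suff : pen_lower tl fl v <= ((Y + c) + 1)%N%:Z /\ pen_upper tu fu v <= ((Y + c) + 1)%N%:Z.
  by rewrite /penalty; lia.
by rewrite /pen_lower /pen_upper; split; do 3?case: ifP => ?; lia.
Qed.

Lemma squares_le fl fu v (c Y : nat) : (`|fl| <= c)%N -> (`|fu| <= c)%N ->
  (`|v| <= Y)%N -> squares fl fu v <= (Y * Y + c * c + c * c)%N%:Z.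
Proof.
move=> flc fuc vY.
have sq (a : int) (d : nat) : (`|a| <= d)%N -> a * a <= (d * d)%N%:Z.
  move=> ad; have -> : a * a = (`|a| * `|a|)%N%:Z by rewrite PoszM; lia.
  by rewrite lez_nat leq_mul.
by rewrite /squares !PoszD !lerD // sq.
Qed.

Definition penalize_lower (arr tl fl : nat) : acmd :=
  AIf (Get tl #vI) (assign vPhi (#vPhi [+] Cst 1))
    (AIf (Get tl #vI [+] Cst 1)
      (AIf (Get fl #vI [-] Get arr #vI)
        (assign vPhi (#vPhi [+] (Get fl #vI [-] Get arr #vI))) ASkip) ASkip).

Definition penalize_upper (arr tu fu : nat) : acmd :=
  AIf (Cst 0 [-] Get tu #vI) (assign vPhi (#vPhi [+] Cst 1))
    (AIf (Cst 1 [-] Get tu #vI)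
      (AIf (Get arr #vI [-] Get fu #vI)
        (assign vPhi (#vPhi [+] (Get arr #vI [-] Get fu #vI))) ASkip) ASkip).

(** Besides the total penalty the squares of all numbers involved are summed up:
    1 plus this sum is a step length that crosses every finite bound. *)
Definition penalize (c : nat) (size : expr) (arr tl fl tu fu : nat) : acmd :=
  AFor c 1 vI size
    (assign vAcc (#vAcc [+] (Get arr #vI [*] Get arr #vI [+]
       Get fl #vI [*] Get fl #vI [+] Get fu #vI [*] Get fu #vI)) ;;
     penalize_lower arr tl fl ;; penalize_upper arr tu fu).

Section Instance.
Variables (orc : oracle_name -> oracle) (B M : nat).
Hypotheses (BM : (bitlen B%:Z <= M)%N).

Lemma runs_penalize_lower arr tl fl st (i : nat) :
  let v := st vPhi 0%N + pen_lower (st tl i) (st fl i) (st arr i) in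
  st vI 0%N = i%:Z -> 0 <= v <= B%:Z ->
  runs orc B M (penalize_lower arr tl fl) st (fun st' => st' vPhi 0%N = v).
Proof.
move=> v stI; rewrite /v /pen_lower => le_B.
apply: (runs_if BM) => /=; rewrite stI /= => H1.
  by move: le_B; rewrite H1 => le_B; apply: (runs_asg _ BM); rewrite /update /=; [lia|].
move: le_B; rewrite ltNge H1 /= => le_B.
apply: (runs_if BM) => /=; rewrite stI /= => H2.
  move: le_B; rewrite H2 => le_B; apply: (runs_if BM) => /=; rewrite stI /= => H3.
    move: le_B; rewrite H3 => le_B.
    by apply: (runs_asg _ BM); rewrite /update /= ?stI /=; [lia|].
  by apply: runs_skip; rewrite ltNge H3 /= addr0.
by apply: runs_skip; rewrite ltNge H2 /= addr0.
Qed.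

Lemma runs_penalize_upper arr tu fu st (i : nat) :
  let v := st vPhi 0%N + pen_upper (st tu i) (st fu i) (st arr i) in
  st vI 0%N = i%:Z -> 0 <= v <= B%:Z ->
  runs orc B M (penalize_upper arr tu fu) st (fun st' => st' vPhi 0%N = v).
Proof.
move=> v stI; rewrite /v /pen_upper => le_B.
apply: (runs_if BM) => /=; rewrite stI /= => H1.
  by move: le_B; rewrite H1 => le_B; apply: (runs_asg _ BM); rewrite /update /=; [lia|].
move: le_B; rewrite ltNge H1 /= => le_B.
apply: (runs_if BM) => /=; rewrite stI /= => H2.
  move: le_B; rewrite H2 => le_B; apply: (runs_if BM) => /=; rewrite stI /= => H3.
    move: le_B; rewrite H3 => le_B.
    by apply: (runs_asg _ BM); rewrite /update /= ?stI /=; [lia|].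
  by apply: runs_skip; rewrite ltNge H3 /= addr0.
by apply: runs_skip; rewrite ltNge H2 /= addr0.
Qed.

Lemma runs_penalize c (m : nat) size arr tl fl tu fu st :
  let P (i : nat) := penalty (st tl i) (st fl i) (st tu i) (st fu i) (st arr i) in
  let S (i : nat) := squares (st fl i) (st fu i) (st arr i) in
    all (fun a => a \notin [:: vI; vPhi; vAcc]) [:: arr; tl; fl; tu; fu] ->
    (m <= c * M ^ 1)%N -> (m <= B)%N ->
    (forall s, (forall a, a \notin [:: vI; vPhi; vAcc] -> s a = st a) ->
       eval s size = m%:Z) ->
    0 <= st vPhi 0%N -> st vPhi 0%N + \sum_(i < m) P i <= B%:Z ->
    0 <= st vAcc 0%N -> st vAcc 0%N + \sum_(i < m) S i <= B%:Z ->
  runs orc B M (penalize c size arr tl fl tu fu) st (fun st' =>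
    st' vPhi 0%N = st vPhi 0%N + \sum_(i < m) P i /\
    st' vAcc 0%N = st vAcc 0%N + \sum_(i < m) S i).
Proof.
move=> P S /and5P[arr_f tl_f fl_f tu_f /andP[fu_f _]] mM mB ev_size phi0 phiB acc0 accB.
have partial_le (F : nat -> int) k : (forall i, 0 <= F i) -> (k <= m)%N ->
    \sum_(i < k) F i <= \sum_(i < m) F i.
  move=> F0 km; rewrite -(subnKC km) big_split_ord /= lerDl.
  by apply: sumr_ge0 => i _; apply: F0.
have P0 i : 0 <= P i by apply: penalty_ge0.
have S0 i : 0 <= S i by apply: squares_ge0.
pose I (k : nat) (s : store) := s vPhi 0%N = st vPhi 0%N + \sum_(i < k) P i /\
  s vAcc 0%N = st vAcc 0%N + \sum_(i < k) S i.
have fresh a x : a \notin [:: vI; vPhi; vAcc] -> x \in [:: vI; vPhi; vAcc] -> (a == x) = false.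
  by move=> aF; apply: contraTF => /eqP <-.
have fr_list (s s' : store) : (forall a, a \notin [:: vI; vAcc; vPhi; vPhi; vPhi; vPhi] -> s a = s' a) ->
    forall a, a \notin [:: vI; vPhi; vAcc] -> s a = s' a.
  move=> fr a aF; apply: fr; move: aF; rewrite !inE !negb_or => /and3P[-> -> ->].
  by [].
apply: (@runs_for _ _ _ BM _ _ _ _ _ _ m I) => //.
- by move=> s fr; apply: ev_size; apply: fr_list.
- by split; rewrite /update /= big_ord0 addr0.
- move=> k s km /fr_list fr sI sB [Iphi Iacc].
  have := partial_le P k.+1 P0 km; have := partial_le S k.+1 S0 km.
  have Pk0 : 0 <= \sum_(i < k) P i by apply: sumr_ge0.
  have Sk0 : 0 <= \sum_(i < k) S i by apply: sumr_ge0.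
  rewrite !big_ord_recr /= => le_S le_P.
  have Sk := S0 k.
  pose low := pen_lower (st tl k) (st fl k) (st arr k).
  pose up := pen_upper (st tu k) (st fu k) (st arr k).
  have low0 : 0 <= low by apply: pen_lower_ge0.
  have up0 : 0 <= up by apply: pen_upper_ge0.
  have [phi_low phi_up] : 0 <= st vPhi 0%N + \sum_(i < k) P i + low <= B%:Z /\
      0 <= st vPhi 0%N + \sum_(i < k) P i + low + up <= B%:Z.
    have PkE : P k = low + up by [].
    move: phi0 phiB le_P Pk0 low0 up0; rewrite PkE; clear.
    move: (\sum_(i < k) P i) (\sum_(i < m) P i) low up (st _ _) => x y z w v.
    by split; lia.
  apply: runs_seq; apply: (runs_asg _ BM) => /=; rewrite sI /= (fr arr) // (fr fl) // (fr fu) // Iacc.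
    rewrite -/(squares (st fl k) (st fu k) (st arr k)) -/(S k).
    move: acc0 accB le_S Sk0 Sk; clear.
    by move: (\sum_(i < k) S i) (\sum_(i < m) S i) (S k) (st _ _) => x y z w; lia.
  set s1 := update _ _ _ _.
  have fr1 a : a \notin [:: vI; vPhi; vAcc] -> s1 a = st a.
    move=> aF; rewrite -fr //; apply/funext => i.
    by rewrite /s1 /update (fresh a vAcc aF).
  have s1phi : s1 vPhi 0%N = st vPhi 0%N + \sum_(i < k) P i by [].
  apply: (runs_call (R := fun s2 => s2 vPhi 0%N =
      s1 vPhi 0%N + pen_lower (st tl k) (st fl k) (st arr k))).
    rewrite -(fr1 tl) // -(fr1 fl) // -(fr1 arr) //; apply: runs_penalize_lower => //.
    by rewrite (fr1 tl) // (fr1 fl) // (fr1 arr) // s1phi.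
  move=> s2 fr2 s2B s2phi.
  have {}fr2 a : a \notin [:: vPhi] -> s2 a = s1 a.
    by move=> aF; apply: fr2; move: aF; rewrite /= !inE !orbb.
  have fr2st a : a \notin [:: vI; vPhi; vAcc] -> s2 a = st a.
    move=> aF; rewrite fr2 ?fr1 //.
    by move: aF; rewrite !inE !negb_or => /and3P[_ -> _].
  apply: (runs_conseq (Q := fun s3 => s3 vPhi 0%N = s2 vPhi 0%N +
      pen_upper (s2 tu k) (s2 fu k) (s2 arr k))).
    apply: runs_penalize_upper; first by rewrite fr2.
    by rewrite s2phi s1phi (fr2st tu) // (fr2st fu) // (fr2st arr).
  move=> s3 fr3 s3B s3phi; split; rewrite /update /=.
    by rewrite s3phi s2phi s1phi (fr2st tu) // (fr2st fu) // (fr2st arr) // big_ord_recr /= /P /penalty !addrA.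
  by rewrite fr3 // fr2 // big_ord_recr /= [in RHS]addrA.
Qed.

End Instance.
End Penalty.

(** * Evaluation of a point *)

Section Evaluation.
Local Open Scope ring_scope.
Local Open Scope expr_scope.

Definition box_penalty m (l u : 'cV[\bar int]_m) (v : 'cV[int]_m) : int :=
  \sum_i penalty (etag (l i ord0)) (efin (l i ord0)) (etag (u i ord0)) (efin (u i ord0))
    (v i ord0).

Definition box_squares m (l u : 'cV[\bar int]_m) (v : 'cV[int]_m) : int :=
  \sum_i squares (efin (l i ord0)) (efin (u i ord0)) (v i ord0).

Lemma box_penalty_ge0 m (l u : 'cV[\bar int]_m) v : 0 <= box_penalty l u v.
Proof. by apply: sumr_ge0 => i _; apply: penalty_ge0. Qed.

Lemma box_penalty_eq0 m (l u : 'cV[\bar int]_m) v :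
  box_penalty l u v = 0 <-> in_box l u v.
Proof.
split=> [/eqP|in_l].
  rewrite psumr_eq0 => [/allP pen0 i|i _]; last exact: penalty_ge0.
  by apply/penalty_eq0/eqP/pen0; rewrite mem_index_enum.
by apply: big1 => i _; apply/penalty_eq0; apply: in_l.
Qed.

(** Equations are treated as pairs of equal bounds. *)
Definition finite_vec m (b : 'cV[int]_m) : 'cV[\bar int]_m := \col_i (b i ord0)%:E.

Lemma in_box_finite_vec m (b v : 'cV[int]_m) :
  in_box (finite_vec b) (finite_vec b) v <-> v = b.
Proof.
split=> [vb|-> i]; last by rewrite mxE lexx.
apply/colP => i; have := vb i; rewrite mxE !lee_fin.
by rewrite -eq_le => /eqP.
Qed.

Definition size_expr (c e : nat) := Cst c [+] #0 [*] Cst e.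

Definition evaluate (r s p q t : nat) : acmd :=
  assign vPhi (Cst 0) ;; assign vAcc (Cst 0) ;;
  mul_nfold r s t aTabA ;;
  penalize (r + s) (size_expr r s) aOut aZero 9 aZero 9 ;;
  mul_nfold p q t aTabW ;;
  penalize (p + q) (size_expr p q) aOut 5 6 7 8 ;;
  penalize t (size_expr 0 t) aCand 1 2 3 4 ;;
  AIf #vPhase
    (AIf #vPhi (assign vOk (Cst 0))
      (AAsk (p + q) OracleF aOut vF ;; AAsk t OracleG aCand vG ;;
       assign vVal (#vF [+] #vG) ;; assign vOk (Cst 1)))
    (assign vVal #vPhi ;; assign vOk (Cst 1)).

Section Instance.
Variables (r s p q t n : nat) (A : 'M[int]_(r + s, t)) (W : 'M[int]_(p + q, t)).
Variables (l u : 'cV[\bar int]_(n * t)) (lh uh : 'cV[\bar int]_(p + n * q)).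
Variables (b : 'cV[int]_(r + n * s)).
Variables (f : 'cV[int]_(p + n * q) -> int) (g : 'cV[int]_(n * t) -> int).
Let N := (n * t)%N.

Definition violation (y : 'cV[int]_N) : int :=
  box_penalty (finite_vec b) (finite_vec b) (nfold n A *m y) +
  box_penalty lh uh (nfold n W *m y) + box_penalty l u y.

Definition spread (y : 'cV[int]_N) : int :=
  box_squares (finite_vec b) (finite_vec b) (nfold n A *m y) +
  box_squares lh uh (nfold n W *m y) + box_squares l u y.

Lemma violation_ge0 y : 0 <= violation y.
Proof. by rewrite !addr_ge0 ?box_penalty_ge0. Qed.

Lemma violation_eq0 y : violation y = 0 <-> feasible A W l u lh uh b y.
Proof.
have pen0 := box_penalty_ge0; split.
  move/eqP; rewrite /violation !paddr_eq0 ?addr_ge0 ?pen0 //.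
  move=> /andP[/andP[/eqP/box_penalty_eq0/in_box_finite_vec Ay /eqP/box_penalty_eq0 Wy]].
  by move=> /eqP/box_penalty_eq0.
move=> [/in_box_finite_vec/box_penalty_eq0 Ay /box_penalty_eq0 Wy /box_penalty_eq0 ly].
by rewrite /violation Ay Wy ly !addr0.
Qed.

Definition objective (y : 'cV[int]_N) : int := f (nfold n W *m y) + g y.

(** The two phases: [goal] is minimized over the points without [defect], first
    the violation over all points, then the objective over the feasible ones. *)
Definition defect (ph : bool) y := if ph then violation y else 0.
Definition goal (ph : bool) y := if ph then objective y else violation y.

Variables (alpha beta Y : nat).
Hypotheses (A_le : forall i j, (`|ent A i j| <= alpha)%N)
  (W_le : forall i j, (`|ent W i j| <= alpha)%N)
  (lf_le : forall i, (`|efin (l i ord0)| <= beta)%N)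
  (uf_le : forall i, (`|efin (u i ord0)| <= beta)%N)
  (lhf_le : forall i, (`|efin (lh i ord0)| <= beta)%N)
  (uhf_le : forall i, (`|efin (uh i ord0)| <= beta)%N)
  (b_le : forall i, (`|b i ord0| <= beta)%N).

Definition num_rows := ((r + n * s) + (p + n * q) + N)%N.
Definition max_row := (N * (alpha * Y) + Y)%N.
Definition small (v : 'cV[int]_N) := forall i, (`|v i ord0| <= Y)%N.

Lemma nfold_le r' s' (A' : 'M[int]_(r' + s', t)) y i :
    (forall i j, (`|ent A' i j| <= alpha)%N) -> small y ->
  (`|(nfold n A' *m y) i ord0| <= N * (alpha * Y))%N.
Proof.
move=> A'_le yY; rewrite mxE.
have -> : (N * (alpha * Y) = \sum_(j < N) (alpha * Y))%N.
  by rewrite sum_nat_const card_ord.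
elim/big_rec2: _ => // j a c _ le_ca.
have : (`|(nfold n A' i j * y j ord0)%R| <= alpha * Y)%N.
  rewrite abszM leq_mul ?yY // nfold_entry; do 2 case: ifP => // _.
by move: (nfold n A' i j * y j ord0) => d; rewrite /=; lia.
Qed.

Lemma box_le (F : int -> int -> int -> int -> int -> int) (c : nat) m
    (l' u' : 'cV[\bar int]_m) (v : 'cV[int]_m) :
    (forall i, F (etag (l' i ord0)) (efin (l' i ord0)) (etag (u' i ord0))
                 (efin (u' i ord0)) (v i ord0) <= c%:Z) ->
  \sum_i F (etag (l' i ord0)) (efin (l' i ord0)) (etag (u' i ord0))
    (efin (u' i ord0)) (v i ord0) <= (m * c)%N%:Z.
Proof.
move=> Fc; have -> : (m * c)%N%:Z = \sum_(i < m) c%:Z.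
  by rewrite sumr_const card_ord -mulr_natl natz PoszM.
by apply: ler_sum => i _; apply: Fc.
Qed.

Lemma small_max_row y i : small y -> (`|y i ord0| <= max_row)%N.
Proof. by move=> yY; have := yY i; rewrite /max_row; lia. Qed.

Lemma nfold_max_row r' s' (A' : 'M[int]_(r' + s', t)) y i :
    (forall i j, (`|ent A' i j| <= alpha)%N) -> small y ->
  (`|(nfold n A' *m y) i ord0| <= max_row)%N.
Proof. by move=> A'_le yY; apply: leq_trans (nfold_le _ A'_le yY) _; apply: leq_addr. Qed.

Lemma finite_vec_le i : (`|efin (finite_vec b i ord0)| <= beta)%N.
Proof. by rewrite mxE b_le. Qed.

Lemma violation_le y : small y ->
  violation y <= (num_rows * ((max_row + beta).*2 + 2))%N%:Z.
Proof.
move=> yY; rewrite /num_rows (mulnDl _ N) (mulnDl (r + n * s)) !PoszD !lerD //;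
  apply: (box_le (F := penalty)) => i; apply: penalty_le;
  rewrite ?finite_vec_le //; solve [exact: nfold_max_row | exact: small_max_row].
Qed.

Lemma spread_le y : small y ->
  spread y <= (num_rows * (max_row * max_row + beta * beta + beta * beta))%N%:Z.
Proof.
move=> yY; rewrite /num_rows (mulnDl _ N) (mulnDl (r + n * s)) !PoszD !lerD //;
  apply: (box_le (F := fun _ fl _ fu v => squares fl fu v)) => i; apply: squares_le;
  rewrite ?finite_vec_le //; solve [exact: nfold_max_row | exact: small_max_row].
Qed.

Variables (ref : store) (B M : nat).
Hypotheses (BM : (bitlen B%:Z <= M)%N) (nM : (n <= M)%N).
Hypotheses (ref_n : ref 0%N 0%N = n%:Z)
  (ref_lt : forall i : 'I_N, ref 1 i = etag (l i ord0))
  (ref_lf : forall i : 'I_N, ref 2 i = efin (l i ord0))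
  (ref_ut : forall i : 'I_N, ref 3 i = etag (u i ord0))
  (ref_uf : forall i : 'I_N, ref 4 i = efin (u i ord0))
  (ref_lht : forall i : 'I_(p + n * q), ref 5 i = etag (lh i ord0))
  (ref_lhf : forall i : 'I_(p + n * q), ref 6 i = efin (lh i ord0))
  (ref_uht : forall i : 'I_(p + n * q), ref 7 i = etag (uh i ord0))
  (ref_uhf : forall i : 'I_(p + n * q), ref 8 i = efin (uh i ord0))
  (ref_b : forall i : 'I_(r + n * s), ref 9 i = b i ord0)
  (ref_A : forall i j, (i < r + s)%N -> (j < t)%N -> ref aTabA (i * t + j)%N = ent A i j)
  (ref_W : forall i j, (i < p + q)%N -> (j < t)%N -> ref aTabW (i * t + j)%N = ent W i j)
  (ref_0 : forall i, ref aZero i = 0).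
Hypotheses (rows_B : (num_rows.+1 <= B)%N)
  (row_B : (max_row <= B)%N)
  (violation_B : (num_rows * ((max_row + beta).*2 + 2) <= B)%N)
  (spread_B : (num_rows * (max_row * max_row + beta * beta + beta * beta) <= B)%N).

Definition env (st : store) := forall a, a \in iota 0 10 ++ [:: aTabA; aTabW; aZero] ->
  st a = ref a.

Lemma env_frame P st st' : env st -> frame P st st' ->
  all (fun a => a \notin writes (erase P)) (iota 0 10 ++ [:: aTabA; aTabW; aZero]) ->
  env st'.
Proof. by move=> Hst fr /allP sub a aE; rewrite fr ?sub ?Hst. Qed.

Lemma env_update st a i v : env st ->
  a \notin iota 0 10 ++ [:: aTabA; aTabW; aZero] -> env (update st a i v).
Proof.
move=> Hst aE a' a'E; rewrite -Hst //; apply/funext => j.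
by rewrite /update; case: eqP a'E aE => //= -> ->.
Qed.

Lemma size_exprE st c e : env st -> eval st (size_expr c e) = (c + n * e)%N%:Z.
Proof. by move=> Hst; rewrite /= Hst // ref_n PoszD PoszM. Qed.

Lemma runs_penalize_box c e arr tl fl tu fu (l' u' : 'cV[\bar int]_(c + n * e))
    (v : 'cV[int]_(c + n * e)) st :
    env st -> all (fun a => a \notin [:: vI; vPhi; vAcc]) [:: arr; tl; fl; tu; fu] ->
    (forall i, st tl (i : 'I__) = etag (l' i ord0)) ->
    (forall i, st fl (i : 'I__) = efin (l' i ord0)) ->
    (forall i, st tu (i : 'I__) = etag (u' i ord0)) ->
    (forall i, st fu (i : 'I__) = efin (u' i ord0)) ->
    (forall i, st arr (i : 'I__) = v i ord0) ->
    (c + n * e <= B)%N ->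
    0 <= st vPhi 0%N -> st vPhi 0%N + box_penalty l' u' v <= B%:Z ->
    0 <= st vAcc 0%N -> st vAcc 0%N + box_squares l' u' v <= B%:Z ->
  runs (oracles f g) B M (penalize (c + e) (size_expr c e) arr tl fl tu fu) st
    (fun st' => st' vPhi 0%N = st vPhi 0%N + box_penalty l' u' v /\
                st' vAcc 0%N = st vAcc 0%N + box_squares l' u' v).
Proof.
move=> Hst fresh tlE flE tuE fuE arrE mB phi0 phiB acc0 accB.
have penE : box_penalty l' u' v = \sum_(i < c + n * e)
    penalty (st tl i) (st fl i) (st tu i) (st fu i) (st arr i).
  by apply: eq_bigr => i _; rewrite tlE flE tuE fuE arrE.
have sqE : box_squares l' u' v = \sum_(i < c + n * e)
    squares (st fl i) (st fu i) (st arr i).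
  by apply: eq_bigr => i _; rewrite flE fuE arrE.
rewrite penE sqE; apply: (@runs_penalize _ B M BM _ (c + n * e)) => //.
- exact: (size_le BM nM).
- move=> st' fr; apply: size_exprE => a aE; rewrite fr ?Hst //.
  by move: a aE; apply/allP.
- by rewrite -penE.
by rewrite -sqE.
Qed.

(** The oracle values are bounded only at feasible points; at other points the
    program must not ask for them. *)
Lemma runs_evaluate (ph : bool) st :
  let y := read_vec st aCand N in
    env st -> small y -> st vPhase 0%N = (ph : nat)%:Z ->
    (ph -> violation y = 0 -> [/\ (`|f (nfold n W *m y)| <= B)%N, (`|g y| <= B)%N
                                & (`|objective y| <= B)%N]) ->
  runs (oracles f g) B M (evaluate r s p q t) st (fun st' =>
    [/\ st' vPhi 0%N = violation y, st' vAcc 0%N = spread y,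
        st' vOk 0%N = ((defect ph y == 0) : nat)%:Z &
        defect ph y = 0 -> st' vVal 0%N = goal ph y]).
Proof.
move=> y Hst yY stPh oracle_B.
have phiB : violation y <= B%:Z by apply: le_trans (violation_le yY) _; rewrite lez_nat.
have accB : spread y <= B%:Z by apply: le_trans (spread_le yY) _; rewrite lez_nat.
rewrite /violation in phiB; rewrite /spread in accB.
have pen0 m (l' u' : 'cV_m) v : 0 <= box_penalty l' u' v by apply: box_penalty_ge0.
have sq0 m (l' u' : 'cV_m) v : 0 <= box_squares l' u' v.
  by apply: sumr_ge0 => i _; apply: squares_ge0.
have [[PA PW] Pl] := (pen0 _ (finite_vec b) (finite_vec b) (nfold n A *m y),
  pen0 _ lh uh (nfold n W *m y), pen0 _ l u y).
have [[SA SW] Sl] := (sq0 _ (finite_vec b) (finite_vec b) (nfold n A *m y),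
  sq0 _ lh uh (nfold n W *m y), sq0 _ l u y).
have y_le j : (j < N)%N -> (`|st aCand j| <= Y)%N.
  by move=> jN; have := yY (Ordinal jN); rewrite mxE.
have NB : (N <= B)%N by move: rows_B; rewrite /num_rows; lia.
have mB : (r + n * s <= B)%N by move: rows_B; rewrite /num_rows; lia.
have mB' : (p + n * q <= B)%N by move: rows_B; rewrite /num_rows; lia.
have sumB : (N * (alpha * Y) <= B)%N by move: row_B; rewrite /max_row; lia.
apply: runs_seq; apply: (runs_asg _ BM) => //.
apply: runs_seq; apply: (runs_asg _ BM) => //=.
set s1 := update _ _ _ _.
have Hs1 : env s1 by rewrite /s1; do 2 apply: env_update => //.
have y1 : read_vec s1 aCand N = y by [].
apply: runs_call.
  apply: (@runs_mul_nfold n t _ B M BM nM r s A aTabA _ alpha Y) => //.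
  - by rewrite Hs1.
  - by move=> i j ir jt; rewrite Hs1 // ref_A.
rewrite y1 => s2 fr2 s2B out2; have Hs2 := env_frame Hs1 fr2 isT.
have phi2 : s2 vPhi 0%N = 0 by rewrite fr2.
have acc2 : s2 vAcc 0%N = 0 by rewrite fr2.
apply: runs_call.
  apply: (@runs_penalize_box r s _ _ _ _ _ (finite_vec b) (finite_vec b)
    (nfold n A *m y)) => //.
  - by move=> i; rewrite Hs2 // ref_0 mxE.
  - by move=> i; rewrite Hs2 // ref_b mxE.
  - by move=> i; rewrite Hs2 // ref_0 mxE.
  - by move=> i; rewrite Hs2 // ref_b mxE.
  - by move=> i; rewrite out2 valK.
  - by rewrite phi2.
  - by rewrite phi2; lia.
  - by rewrite acc2.
  - by rewrite acc2; lia.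
rewrite phi2 acc2 !add0r => s3 fr3 s3B [phi3 acc3].
have Hs3 := env_frame Hs2 fr3 isT.
have y3 : read_vec s3 aCand N = y by apply/colP => i; rewrite !mxE fr3 // fr2.
apply: runs_call.
  apply: (@runs_mul_nfold n t _ B M BM nM p q W aTabW _ alpha Y) => //.
  - by rewrite Hs3.
  - by move=> i j ir jt; rewrite Hs3 // ref_W.
  - by move=> j jN; rewrite fr3 // fr2 // y_le.
rewrite y3 => s4 fr4 s4B out4; have Hs4 := env_frame Hs3 fr4 isT.
have phi4 : s4 vPhi 0%N = box_penalty (finite_vec b) (finite_vec b) (nfold n A *m y).
  by rewrite fr4.
have acc4 : s4 vAcc 0%N = box_squares (finite_vec b) (finite_vec b) (nfold n A *m y).
  by rewrite fr4.
apply: runs_call.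
  apply: (@runs_penalize_box p q _ _ _ _ _ lh uh (nfold n W *m y)) => //.
  - by move=> i; rewrite Hs4 // ref_lht.
  - by move=> i; rewrite Hs4 // ref_lhf.
  - by move=> i; rewrite Hs4 // ref_uht.
  - by move=> i; rewrite Hs4 // ref_uhf.
  - by move=> i; rewrite out4 valK.
  - by rewrite phi4.
  - by rewrite phi4; lia.
  - by rewrite acc4.
  - by rewrite acc4; lia.
rewrite phi4 acc4 => s5 fr5 s5B [phi5 acc5].
have Hs5 := env_frame Hs4 fr5 isT.
have cand5 j : s5 aCand j = st aCand j by rewrite fr5 // fr4 // fr3 // fr2.
apply: runs_call.
  apply: (@runs_penalize_box 0 t _ _ _ _ _ l u y) => //.
  - by move=> i; rewrite Hs5 // ref_lt.
  - by move=> i; rewrite Hs5 // ref_lf.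
  - by move=> i; rewrite Hs5 // ref_ut.
  - by move=> i; rewrite Hs5 // ref_uf.
  - by move=> i; rewrite cand5 mxE.
  - by rewrite phi5 addr_ge0.
  - by rewrite phi5.
  - by rewrite acc5 addr_ge0.
  - by rewrite acc5.
rewrite phi5 acc5 => s6 fr6 s6B [phi6 acc6].
have {}phi6 : s6 vPhi 0%N = violation y by [].
have {}acc6 : s6 vAcc 0%N = spread y by [].
have ph6 : s6 vPhase 0%N = (ph : nat)%:Z by rewrite fr6 // fr5 // fr4 // fr3 // fr2.
have {}phiB : violation y <= B%:Z by [].
have phi0 := violation_ge0 y.
have B0 : (0 < B)%N by move: rows_B; lia.
apply: (runs_if BM); rewrite /= ph6; case: ph {ph6} oracle_B stPh => // oracle_B stPh _; last first.
  apply: runs_seq; apply: (runs_asg _ BM); rewrite /= phi6; first by lia.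
  by apply: (runs_asg _ BM).
apply: (runs_if BM); rewrite /= phi6 => phi_y.
  apply: (runs_asg _ BM) => //; rewrite /defect /update /= gt_eqF //.
  by split=> // phi_y0; rewrite phi_y0 in phi_y.
have {phi_y} phi_y : violation y = 0 by lia.
have [fB gB objB] := oracle_B isT phi_y.
have M0 : (0 < M)%N by apply: leq_trans BM.
have out6 : read_vec s6 aOut (p + n * q) = nfold n W *m y.
  by apply/colP => i; rewrite mxE fr6 // fr5 // out4 valK.
have cand6 : read_vec s6 aCand N = y by apply/colP => i; rewrite !mxE fr6 // cand5.
apply: runs_seq; apply: (runs_ask BM) => /=; rewrite ?out6 //.
  by have := size_le BM nM p q; rewrite expn1.
apply: runs_seq; apply: (runs_ask BM) => /=.
- by have := size_le BM nM 0 t; rewrite expn1.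
- by rewrite [read_vec _ _ _](_ : _ = y) // -cand6.
rewrite [read_vec _ _ _](_ : _ = y); last by rewrite -cand6.
apply: runs_seq; apply: (runs_asg _ BM) => //.
apply: (runs_asg _ BM) => //; rewrite /update /= /defect phi_y eqxx.
by split; rewrite ?phi6.
Qed.

End Instance.
End Evaluation.

(** * Enumeration of the test vectors *)

Section TestVectors.
Local Open Scope ring_scope.
Local Open Scope expr_scope.

Section Decoding.
Variable N : nat.

Definition unit_vec (a : nat) : 'cV[int]_N := \col_i ((i == a :> nat) : nat)%:Z.

(** The digits of c in base N + 1, read in pairs (a, b), stand for differences
    of unit vectors; the digit N stands for the zero vector. *)
Fixpoint decoding (k c : nat) : 'cV[int]_N :=
  if k is k'.+1 then
    unit_vec (c %% N.+1) - unit_vec (c %/ N.+1 %% N.+1) + decoding k' (c %/ N.+1 %/ N.+1)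
  else 0.

Definition num_codes k := (N.+1 ^ (k + k))%N.

Lemma decoding_le k c i : (`|decoding k c i ord0| <= k)%N.
Proof.
elim: k c => [|k IHk] c /=; first by rewrite mxE.
rewrite !mxE; have := IHk (c %/ N.+1 %/ N.+1)%N; move: (decoding _ _ _ _) => d.
by case: (_ == _); case: (_ == _) => /=; lia.
Qed.

Lemma unit_vecN : unit_vec N = 0.
Proof. by apply/colP => i; rewrite !mxE ltn_eqF. Qed.

Lemma norm1_neq0 (v : 'cV[int]_N) : v != 0 -> exists i, v i ord0 != 0.
Proof.
move=> v0; apply/existsP; apply: contraNT v0 => /existsPn no_i.
by apply/eqP/colP => i; rewrite mxE; apply/eqP; rewrite -[_ == _]negbK no_i.
Qed.

(** Such a vector is a sum of at most k signed unit vectors, and each signed unit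
    vector is a difference of a unit vector and the zero vector. *)
Lemma decoding_surj k (v : 'cV[int]_N) : (norm1 v <= k)%N ->
  exists2 c, (c < num_codes k)%N & decoding k c = v.
Proof.
elim: k v => [|k IHk] v vk.
  by exists 0%N => //=; rewrite (norm1_eq0 (v := v)) //; lia.
suff [a [b [w [aN bN wk Dv]]]] : exists a b w, [/\ (a <= N)%N, (b <= N)%N,
    (norm1 w <= k)%N & v = unit_vec a - unit_vec b + w].
  have [c c_lt Dc] := IHk w wk; exists (a + N.+1 * (b + N.+1 * c))%N.
    move: c_lt; rewrite /num_codes addnS addSn !expnS; move: (N.+1 ^ _)%N => X.
    by nia.
  have divE x y : (x <= N)%N -> ((x + N.+1 * y) %/ N.+1 = y)%N.
    by move=> xN; rewrite addnC mulnC divnMDl // divn_small ?addn0.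
  have modE x y : (x <= N)%N -> ((x + N.+1 * y) %% N.+1 = x)%N.
    by move=> xN; rewrite addnC mulnC modnMDl modn_small.
  by rewrite /= !divE // !modE // Dc.
have [->|v0] := eqVneq v 0.
  exists N, N, 0; split=> //; first by rewrite /norm1 big1 // => i _; rewrite mxE.
  by rewrite subrr addr0.
have [i vi] := norm1_neq0 v0.
have unit_le (j : 'I_N) : (j <= N)%N := ltnW (ltn_ord j).
have norm_sub (w : 'cV[int]_N) : (forall j, (`|w j ord0| + (j == i) <= `|v j ord0|)%N) ->
    (norm1 w <= k)%N.
  move=> le_w; rewrite -ltnS; apply: leq_trans vk.
  have -> : (norm1 w).+1 = (\sum_j (`|w j ord0| + (j == i)))%N.
    rewrite big_split /= -/(norm1 w) (bigD1 i) //= eqxx big1 ?addn0 ?addn1 //.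
    by move=> j /negPf->.
  by apply: leq_sum => j _; apply: le_w.
have unitE (j : 'I_N) : unit_vec i j ord0 = ((j == i) : nat)%:Z by rewrite mxE.
have [v_lt|v_gt|/eqP] := ltgtP (v i ord0) 0; last by rewrite (negPf vi).
  exists N, i, (v + unit_vec i); split=> //; last by rewrite unit_vecN sub0r addrC addrK.
  apply: norm_sub => j; rewrite mxE unitE; case: eqP => [->|_] /=; first by lia.
  by rewrite addr0 addn0.
exists i, N, (v - unit_vec i); split=> //; last by rewrite unit_vecN subr0 subrKC.
apply: norm_sub => j; rewrite mxE [(- _ : 'cV_N) _ _]mxE unitE.
case: eqP => [->|_] /=; first by lia.
by rewrite oppr0 addr0 addn0.
Qed.

End Decoding.

Lemma num_codes_le n t K M : (0 < M)%N -> (n <= M)%N ->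
  (num_codes (n * t) K <= t.+1 ^ (K + K) * M ^ (K + K))%N.
Proof.
move=> M0 nM; rewrite -expnMn /num_codes; have le_N : (n * t < t.+1 * M)%N by nia.
by case: (K + K)%N => // k; rewrite leq_exp2r.
Qed.


Definition base_expr (t : nat) := #0 [*] Cst t [+] Cst 1.

Definition decode_step t (sign : int) : acmd :=
  add_to aZ (mod_expr #vDigits (base_expr t)) (Cst sign) ;;
  assign vDigits (#vDigits [/] base_expr t).

Definition decode (t K : nat) : acmd :=
  AFor t.+1 1 vI (base_expr t) (AAsg aZ #vI (Cst 0)) ;;
  assign vDigits #vCode ;;
  AFor K 0 vI (Cst K) (decode_step t 1 ;; decode_step t (-1)).

Definition candidate (t : nat) : acmd :=
  AFor t 1 vI (#0 [*] Cst t) (AAsg aCand #vI (Get aX #vI [+] #vLam [*] Get aZ #vI)).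

Definition copy (t src dst : nat) : acmd :=
  AFor t 1 vI (#0 [*] Cst t) (AAsg dst #vI (Get src #vI)).

Section Instance.
Variables (n t : nat) (orc : oracle_name -> oracle) (B M : nat).
Hypotheses (BM : (bitlen B%:Z <= M)%N) (nM : (n <= M)%N).
Let N := (n * t)%N.
Hypothesis NB : (N.+1 <= B)%N.

Lemma runs_copy src dst st : st 0%N 0%N = n%:Z ->
    0%N != dst -> src != dst -> src != vI -> dst != vI ->
  runs orc B M (copy t src dst) st
    (fun st' => read_vec st' dst N = read_vec st src N).
Proof.
move=> st0 dst0 sd sI dI.
pose I (k : nat) (s : store) := forall i, (i < k)%N -> s dst i = st src i.
apply: (@runs_for _ _ _ BM _ _ _ _ _ _ N I) => //.
- by rewrite /= inE eq_sym.
- by have := size_le BM nM 0 t; rewrite !add0n.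
- exact: (ltnW NB).
- by move=> s fr /=; rewrite (fr 0%N) ?st0 //= !inE negb_or.
- move=> k s kN fr sI' sB Ik; apply: (runs_asg _ BM); rewrite /= sI' //.
  move=> i; rewrite ltnS leq_eqVlt /update (negPf dI) /= eqxx /=.
  have [-> _|_ /= ik] := eqVneq i k; last exact: Ik.
  by rewrite fr // !inE negb_or sI sd.
by move=> s fr sB IN; apply/colP => i; rewrite !mxE IN.
Qed.

Lemma runs_candidate st : st 0%N 0%N = n%:Z ->
    (forall i, (i < N)%N -> (`|(st aX i + st vLam 0%N * st aZ i)%R| <= B)%N) ->
  runs orc B M (candidate t) st (fun st' =>
    read_vec st' aCand N = read_vec st aX N + st vLam 0%N *: read_vec st aZ N).
Proof.
move=> st0 le_B.
pose I (k : nat) (s : store) := forall i, (i < k)%N ->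
  s aCand i = st aX i + st vLam 0%N * st aZ i.
apply: (@runs_for _ _ _ BM _ _ _ _ _ _ N I) => //.
- by have := size_le BM nM 0 t; rewrite !add0n.
- exact: (ltnW NB).
- by move=> s fr /=; rewrite (fr 0%N) // st0.
- move=> k s kN fr sI sB Ik; apply: (runs_asg _ BM); rewrite /= sI /= !fr //.
    exact: le_B.
  move=> i; rewrite ltnS leq_eqVlt /update /=.
  by have [->//|_ /= ik] := eqVneq i k; apply: Ik.
by move=> s fr sB IN; apply/colP => i; rewrite !mxE IN.
Qed.

Lemma runs_decode K st (c : nat) : st 0%N 0%N = n%:Z -> st vCode 0%N = c%:Z ->
    (c <= B)%N -> (K.+1 <= B)%N ->
  runs orc B M (decode t K) st (fun st' => read_vec st' aZ N = decoding N K c).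
Proof.
move=> st0 stc cB KB.
have M0 : (0 < M)%N by apply: leq_trans BM.
pose I0 (k : nat) (s : store) := forall i, (i < k)%N -> s aZ i = 0.
apply: (runs_call (R := I0 N.+1)).
  apply: (@runs_for _ _ _ BM _ _ _ _ _ _ N.+1 I0) => //.
  - rewrite expn1 mulSn -addn1 addnC leq_add // /N mulnC leq_mul2l nM orbT.
    by [].
  - by move=> s fr /=; rewrite (fr 0%N) // st0 /N; lia.
  - move=> k s kN fr sI sB Ik; apply: (runs_asg _ BM); rewrite /= ?sI //.
    move=> i; rewrite ltnS leq_eqVlt /update /=.
    by have [->//|_ /= ik] := eqVneq i k; apply: Ik.
move=> s1 fr1 s1B z1.
apply: runs_seq; apply: (runs_asg _ BM); rewrite /= fr1 // stc //.
set s2 := update _ _ _ _.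
pose J (k : nat) (s : store) := exists2 d : nat,
  s vDigits 0%N = d%:Z /\ (d <= B)%N &
  read_vec s aZ N + decoding N (K - k) d = decoding N K c /\
  forall i, (i <= N)%N -> (`|s aZ i| <= k)%N.
have baseE s : s 0%N 0%N = n%:Z -> eval s (base_expr t) = N.+1%:Z.
  by move=> s0; rewrite /= s0 /N; lia.
have step s (d k : nat) (sign : int) (Q : store -> Prop) : s 0%N 0%N = n%:Z ->
    s vDigits 0%N = d%:Z -> (d <= B)%N -> (`|sign| <= 1)%N -> (k < B)%N ->
    (forall i, (i <= N)%N -> (`|s aZ i| <= k)%N) ->
    (forall s', frame (decode_step t sign) s s' ->
       s' vDigits 0%N = (d %/ N.+1)%N%:Z ->
       (forall i, s' aZ i = s aZ i + sign * ((i == d %% N.+1)%N : nat)%:Z) -> Q s') ->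
    runs orc B M (decode_step t sign) s Q.
  move=> s0 sd dB sign1 kB le_k HQ.
  have ev_mod : eval s (mod_expr #vDigits (base_expr t)) = (d %% N.+1)%N%:Z.
    by apply: eval_mod; [rewrite /= sd | exact: baseE].
  have dN : (d %% N.+1 <= N)%N by rewrite -ltnS ltn_mod.
  apply: (runs_conseq (Q := fun s' => s' vDigits 0%N = (d %/ N.+1)%N%:Z /\
    forall i, s' aZ i = s aZ i + sign * ((i == d %% N.+1)%N : nat)%:Z)); last first.
    by move=> s' fr _ [? ?]; apply: HQ.
  apply: runs_seq; apply: (runs_asg _ BM).
    by move: ev_mod (le_k _ dN) => /= -> /=; lia.
  rewrite ev_mod; set s' := update _ _ _ _.
  have s'0 : s' 0%N 0%N = n%:Z by [].
  apply: (runs_asg _ BM).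
    move: (baseE _ s'0) => /= ->; rewrite /s' /update /= sd divz_nat.
    by rewrite (leq_trans (leq_div _ _)).
  split.
    by move: (baseE _ s'0) => /= ->; rewrite /s' /update /= sd divz_nat.
  move=> i; rewrite /s' /update /=; move: ev_mod => /= ->.
  by case: eqP => [->|_] /=; rewrite ?mulr1 ?mulr0 ?addr0.
apply: (@runs_for _ _ _ BM _ _ _ _ _ _ K J) => //.
- by rewrite expn0 muln1.
- exact: (ltnW KB).
- exists c; first by split.
  rewrite subn0; split; last by move=> i iN; rewrite /s2 /update /= z1.
  rewrite (_ : read_vec _ _ _ = 0) ?add0r //; apply/colP => i.
  by rewrite !mxE /s2 /update /= z1 // ltnS ltnW.
- move=> k s kK fr sI sB [d [sd dB] [Dz le_k]].
  have s0 : s 0%N 0%N = n%:Z by rewrite fr // /s2 /update /= fr1.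
  apply: runs_seq; apply: (step s d k) => //; first by lia.
  move=> s3 fr3 s3d s3z; apply: (step s3 (d %/ N.+1)%N k.+1) => //.
  + by rewrite fr3.
  + by rewrite (leq_trans (leq_div _ _)).
  + by lia.
  + by move=> i iN; rewrite s3z; have := le_k i iN; case: (_ == _) => /=; lia.
  move=> s4 fr4 s4d s4z; exists (d %/ N.+1 %/ N.+1)%N.
    by rewrite /update /= s4d; split=> //; rewrite !(leq_trans (leq_div _ _)).
  split; last first.
    move=> i iN; rewrite /update /= s4z s3z; have := le_k i iN.
    by case: (_ == _); case: (_ == _) => /=; lia.
  rewrite -Dz -(subnSK kK) /= addrA; congr (_ + _); apply/colP => i.
  by rewrite !mxE /update /= s4z s3z; ring.
move=> s fr sB [d _ [Dz _]]; by move: Dz; rewrite subnn /= addr0.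
Qed.

End Instance.
End TestVectors.

(** * Line search and descent *)

Section Descent.
Local Open Scope ring_scope.
Local Open Scope expr_scope.

(** Best step along the direction in [aZ] among the powers of 2 that are
    feasible and, each in turn, an improvement; the best point seen so far in
    any direction is kept in [aBest]. *)
Definition line_search (r s p q t : nat) : acmd :=
  assign vLam (Cst 1) ;; assign vPrev #vCur ;; assign vGo (Cst 1) ;;
  AWhile 1 1 #vGo
    (candidate t ;; evaluate r s p q t ;;
     AIf (#vOk [*] (#vPrev [-] #vVal))
       (assign vPrev #vVal ;;
        AIf (#vBest [-] #vVal) (assign vBest #vVal ;; copy t aCand aBest) ASkip ;;
        assign vLam (Cst 2 [*] #vLam))
       (assign vGo (Cst 0))).

Fixpoint pow_expr (e : expr) (k : nat) : expr :=
  if k is k'.+1 then e [*] pow_expr e k' else Cst 1.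

Definition codes_expr (t K : nat) := pow_expr (base_expr t) (K + K).

(** Each round gains at least the fraction 1 / (2C) of the distance to the
    optimal value, C being the number of codes; the iteration bound follows from
    C <= (t + 1)^(2K) M^(2K). *)
Definition augment (K r s p q t : nat) : acmd :=
  assign vLam (Cst 0) ;; candidate t ;; evaluate r s p q t ;;
  assign vCur #vVal ;; assign vGoOn (Cst 1) ;;
  AWhile (4 * t.+1 ^ (K + K)) (K + K).+1 #vGoOn
    (assign vBest #vCur ;;
     AFor (t.+1 ^ (K + K)) (K + K) vCode (codes_expr t K)
       (decode t K ;; line_search r s p q t) ;;
     AIf (#vCur [-] #vBest) (assign vCur #vBest ;; copy t aBest aX)
       (assign vGoOn (Cst 0))).

Lemma eval_pow st e (m k : nat) : eval st e = m%:Z -> eval st (pow_expr e k) = (m ^ k)%N%:Z.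
Proof. by move=> ev_e; elim: k => [|k IHk] //=; rewrite ev_e IHk expnS PoszM. Qed.

Lemma gap_decrease (a z o : int) (c : nat) : (1 < c)%N -> o <= z -> z < a ->
  a - o <= c%:Z * (a - z) -> (c * `|z - o| <= c.-1 * `|a - o|)%N.
Proof.
by move=> c1 oz za gain; rewrite -lez_nat !PoszM !gez0_abs; lia.
Qed.

Section Abstract.
Variables (r s p q t n : nat) (orc : oracle_name -> oracle) (B M Y : nat) (ref : store).
Hypotheses (BM : (bitlen B%:Z <= M)%N) (nM : (n <= M)%N) (ref_n : ref 0%N 0%N = n%:Z).
Let N := (n * t)%N.
Variables (R : nat) (C : 'M[int]_(R, N)) (D F V S : 'cV[int]_N -> int) (ph : bool).
Hypotheses (cD : convex_along C D) (cF : convex_along C F) (D_ge0 : forall y, 0 <= D y).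
Hypothesis evaluate_spec : forall st, let y := read_vec st aCand N in
  env ref st -> small Y y -> st vPhase 0%N = (ph : nat)%:Z ->
  runs orc B M (evaluate r s p q t) st (fun st' =>
    [/\ st' vPhi 0%N = V y, st' vAcc 0%N = S y,
        st' vOk 0%N = ((D y == 0) : nat)%:Z & D y = 0 -> st' vVal 0%N = F y]).
(** [hi] is the value at the starting point and [G] bounds what can be gained. *)
Variables (K X0 G : nat) (hi lo : int).
Hypotheses (F_ge_lo : forall y, D y = 0 -> lo <= F y) (hi_lo : hi - lo <= G%:Z).
Hypotheses (NB : (N.+1 <= B)%N) (KB : (K.+1 <= B)%N) (GB : (4 * G + 2 <= B)%N)
  (YB : (Y <= B)%N) (XY : (X0 + 2 * K * G + (4 * G + 1) * K <= Y)%N).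

Definition near_start (y : 'cV[int]_N) (v : int) :=
  forall i, `|y i ord0| <= X0%:Z + 2 * K%:Z * (hi - v).

(** The invariant of the descent. The point has moved from the start by at most
    2K times the total gain, whatever the number of steps. *)
Definition current (st : store) := let x := read_vec st aX N in
  [/\ env ref st, st vPhase 0%N = (ph : nat)%:Z, D x = 0, st vCur 0%N = F x &
      F x <= hi /\ near_start x (F x)].

Definition best_point (st : store) := let y := read_vec st aBest N in
  st vBest 0%N <= st vCur 0%N /\
  (st vBest 0%N < st vCur 0%N ->
    [/\ D y = 0, F y = st vBest 0%N & near_start y (F y)]).

Lemma current_agree st st' : current st ->
  {in iota 0 10 ++ [:: aTabA; aTabW; aZero; vPhase; vCur; aX], forall a, st' a = st a} ->
  current st'.
Proof.
move=> [Hst st_ph Dx st_cur Hx] keep.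
rewrite /current /read_vec !keep //; split=> //.
move=> a aE; rewrite keep ?Hst //; move: aE; rewrite !mem_cat => /orP[->//|aE].
by apply/orP; right; move: aE; rewrite !inE => /or3P[]->; rewrite ?orbT.
Qed.

Lemma current_gap st y : current st -> D y = 0 -> st vCur 0%N - F y <= G%:Z.
Proof. by move=> [_ _ _ -> [x_hi _]] /F_ge_lo; lia. Qed.

Section Line.
Variable x d : 'cV[int]_N.
Let h (k : int) := F (x + k *: d).
Let e (k : int) := D (x + k *: d).

(** The state of a line search after [j] successful doublings: the length
    2^j is tried next, and half of it, which is 0 at the beginning, is the best
    so far. The last clause keeps accepted lengths within twice
    the gain. *)
Definition doubling (j : nat) (prev : int) :=
  [/\ prev = h (2 ^ j)./2%:Z, e (2 ^ j)./2%:Z = 0,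
      forall i, (i < j)%N -> prev <= h (2 ^ i)%N%:Z, prev <= h 0 &
      (2 ^ j)./2%:Z <= 2 * (h 0 - prev)].

Lemma doubling0 : D x = 0 -> doubling 0 (F x).
Proof.
have h0 : h 0 = F x by rewrite /h scale0r addr0.
move=> Dx; split=> //=; rewrite ?h0 ?subrr //.
by rewrite /e scale0r addr0.
Qed.

(** The step length is twice a length at which the function still decreased
    by [convex1_slope]. *)
Lemma doubling_step j prev : doubling j prev -> e (2 ^ j)%N%:Z = 0 ->
    h (2 ^ j)%N%:Z < prev ->
  doubling j.+1 (h (2 ^ j)%N%:Z) /\ (2 ^ j)%N%:Z <= 2 * (h 0 - h (2 ^ j)%N%:Z).
Proof.
move=> [prevE half0 prev_le prev0 half_le] ej lt_prev.
have half : ((2 ^ j.+1)./2 = 2 ^ j)%N by rewrite expnS mul2n doubleK.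
have gain : (2 ^ j)%N%:Z <= 2 * (h 0 - h (2 ^ j)%N%:Z).
  case: j prevE half0 prev_le half_le ej lt_prev half => [|j] prevE _ prev_le _ _ lt_prev _.
    by rewrite expn0 in lt_prev *; lia.
  have half : ((2 ^ j.+1)./2 = 2 ^ j)%N by rewrite expnS mul2n doubleK.
  rewrite half in prevE.
  have := @convex1_slope h (2 ^ j) (convex_along_line cF x d).
  have -> : (2 ^ j * 2 = 2 ^ j.+1)%N by rewrite expnS mulnC.
  rewrite -prevE => /(_ lt_prev); move: lt_prev; rewrite {2}expnS.
  by move: (h _) (h _) (2 ^ j)%N => a c z; lia.
split=> //; split; rewrite ?half //.
  move=> i; rewrite ltnS leq_eqVlt => /predU1P[->//|ij].
  by apply: le_trans (ltW lt_prev) (prev_le _ ij).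
by apply: le_trans (ltW lt_prev) prev0.
Qed.

End Line.

Lemma runs_line_search st :
  let x := read_vec st aX N in let d := read_vec st aZ N in
    current st -> best_point st -> (forall i, (`|d i ord0| <= K)%N) ->
  runs orc B M (line_search r s p q t) st (fun st' =>
    [/\ best_point st', st' vBest 0%N <= st vBest 0%N &
        forall k : nat, D (x + d *+ k) = 0 ->
          F x - F (x + d *+ k) <= 2 * (st' vCur 0%N - st' vBest 0%N)]).
Proof.
move=> x d Hst best_st dK; apply: runs_bounded => stB.
have [Henv st_ph Dx st_cur [x_hi x_near]] := Hst.
rewrite -/x in Dx st_cur x_hi x_near.
have M0 : (0 < M)%N by apply: leq_trans BM.
apply: runs_seq; apply: (runs_asg _ BM) => /=; first by lia.
apply: runs_seq; apply: (runs_asg _ BM) => /=; first exact: stB.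
apply: runs_seq; apply: (runs_asg _ BM) => /=; first by lia.
set s1 := update _ _ _ _.
pose gain_le (st' : store) := forall k : nat, D (x + d *+ k) = 0 ->
  F x - F (x + d *+ k) <= 2 * (st' vCur 0%N - st' vBest 0%N).
pose I (j : nat) (s' : store) := [/\ best_point s', s' vBest 0%N <= st vBest 0%N &
  if 0 < s' vGo 0%N then
    [/\ s' vLam 0%N = (2 ^ j)%N%:Z, doubling x d j (s' vPrev 0%N) &
        s' vBest 0%N <= s' vPrev 0%N]
  else gain_le s'].
have Henv1 : env ref s1 by rewrite /s1; do 3 apply: env_update => //.
have h0E : F (x + 0 *: d) = F x by rewrite scale0r addr0.
have e0E : D (x + 0 *: d) = 0 by rewrite scale0r addr0.
have ch := convex_along_line cF x d; have ce := convex_along_line cD x d.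
apply: (runs_while BM (I := I)).
- split=> //=; split=> //; last by case: best_st; rewrite /s1 /update /= st_cur.
  by rewrite /s1 /update /= st_cur; apply: doubling0.
- move=> j s' fr s'B [best_s' best_le].
  have keep a : a \in iota 0 10 ++ [:: aX; aTabA; aTabW; aZero; aZ; vPhase; vCur] ->
    s' a = s1 a by move=> aE; apply: fr; move: a aE; apply/allP.
  move=> goal_s' /= go; rewrite go in goal_s'; case: goal_s' => lamE dbl best_prev.
  have [prevE half0 prev_le prev0 half_le] := dbl.
  have Henv' : env ref s'.
    move=> a aE; rewrite keep ?Henv1 //; move: aE; rewrite !mem_cat => /orP[->//|].
    by rewrite !inE => /or3P[]->; rewrite ?orbT.
  have x' : read_vec s' aX N = x by rewrite /read_vec keep.
  have d' : read_vec s' aZ N = d by rewrite /read_vec keep.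
  have gap y : D y = 0 -> F x - F y <= G%:Z by move=> Dy; rewrite -st_cur; apply: current_gap.
  have lam_le : (2 ^ j <= 4 * G + 1)%N.
    have := gap _ half0; rewrite -[F (x + _)]/(F (x + (2 ^ j)./2%:Z *: d)) -prevE.
    have : (2 ^ j <= (2 ^ j)./2 + (2 ^ j)./2 + 1)%N.
      by have := odd_double_half (2 ^ j); case: odd; lia.
    by move: half_le; rewrite h0E; move: (F x) (2 ^ j)%N (2 ^ j)./2 => v a c; lia.
  have xX i : (`|x i ord0| <= X0 + 2 * K * G)%N.
    have : hi - F x <= G%:Z by have := F_ge_lo Dx; lia.
    have KG (w : int) : w <= G%:Z -> 2 * K%:Z * w <= (2 * K * G)%N%:Z.
      by move=> wG; rewrite PoszM ler_wpM2l.
    move=> /KG; have := x_near i; move: (2 * K%:Z * _) (2 * K * G)%N (x i ord0) => a c z.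
    by lia.
  split.
    rewrite mul1n expn1; apply: leq_trans BM; rewrite /bitlen ltnS.
    by rewrite -(@leq_exp2l 2) // (leq_trans _ (up_logP _ _)) //; lia.
  have s'0 : s' 0%N 0%N = n%:Z by rewrite Henv'.
  pose y := x + (2 ^ j)%N%:Z *: d.
  have yY : small Y y.
    move=> i; rewrite /y mxE [X in _ + X]mxE; have := xX i; have := dK i.
    have := leq_mul lam_le (dK i); move: lam_le XY.
    have : `|((2 ^ j)%N%:Z * d i ord0)%R|%N = (2 ^ j * `|d i ord0|)%N by rewrite abszM.
    by move: (_ * d i ord0) (x i ord0) (_ * `|_|)%N => a c z; lia.
  apply: (runs_call (R := fun s2 => read_vec s2 aCand N = y)).
    rewrite /y -lamE -x' -d'. apply: (runs_candidate _ BM nM NB) => // i iN.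
    apply: leq_trans YB; have := yY (Ordinal iN).
    by rewrite /y -lamE -x' -d' !mxE.
  move=> s2 fr2 s2B cand2.
  have Henv2 := env_frame Henv' fr2 isT.
  apply: (runs_call (R := fun s3 => [/\ s3 vPhi 0%N = V y, s3 vAcc 0%N = S y,
        s3 vOk 0%N = ((D y == 0) : nat)%:Z & D y = 0 -> s3 vVal 0%N = F y])).
    by rewrite -cand2; apply: evaluate_spec; rewrite ?cand2 // fr2 // keep.
  move=> s3 fr3 s3B [_ _ ok3 val3].
  have back a : a \notin writes (erase (candidate t)) ->
      a \notin writes (erase (evaluate r s p q t)) -> s3 a = s' a.
    by move=> a2 a3; rewrite fr3 // fr2.
  have s'_cur : s' vCur 0%N = F x by rewrite keep.
  have prev_x : s' vPrev 0%N <= F x by rewrite -h0E.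
  apply: (runs_if BM) => /=; rewrite ok3 (back vPrev) //; last first.
    move=> stop; apply: (runs_asg _ BM) => //=.
    split; rewrite /update /=; first by rewrite /best_point /read_vec /= !back.
      by rewrite back.
    rewrite /gain_le /= !back // s'_cur => k Dk.
    have stop_prev : D y = 0 -> s' vPrev 0%N <= F y.
      by move=> Dy; move: stop; rewrite Dy eqxx mul1r (val3 Dy); lia.
    have := @doubling_gain (fun k => F (x + k *: d)) (fun k => D (x + k *: d)) ch ce
      (fun _ => D_ge0 _) e0E j (s' vPrev 0%N) prev_le prev0 prevE stop_prev k.
    rewrite /= scalez_nat h0E => /(_ Dk) gain; apply: le_trans gain _.
    by rewrite ler_pM2l //; lia.
  case: eqP => [Dy|_]; last by rewrite mul0r.
  rewrite mul1r subr_gt0 (val3 Dy) => lt_val.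
  have [dbl' gain] := doubling_step dbl Dy lt_val.
  apply: runs_seq; apply: (runs_asg _ BM) => /=; first exact: s3B.
  set s4 := update _ _ _ _.
  have keep4 a : a \in [:: vCur; vBest; vLam; vGo; aBest; 0%N] -> s4 a = s' a.
    move=> aE; have -> : s4 a = s3 a.
      by apply/funext => i; rewrite /s4 /update; case: eqP aE => [->|].
    by apply: back; move: a aE; apply/allP.
  have s4_val : s4 vVal 0%N = F y by apply: val3.
  pose s_best (s5 : store) := [/\ best_point s5, s5 vBest 0%N <= s' vBest 0%N &
    s5 vBest 0%N <= F y].
  apply: (runs_call (R := s_best)).
    apply: (runs_if BM) => /=; rewrite keep4 // s4_val ?subr_gt0 ?subr_le0 => lt_best.
      apply: runs_seq; apply: (runs_asg _ BM) => /=; first exact: s3B.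
      set s5 := update _ _ _ _.
      have s5_best : s5 vBest 0%N = F y by [].
      apply: (runs_conseq (runs_copy _ BM nM NB _ _ _ _ _)) => //.
        by rewrite /s5 /update /= keep4.
      move=> s6 fr6 s6B copy6.
      have s6_best : s6 vBest 0%N = F y by rewrite fr6.
      have s6_cur : s6 vCur 0%N = F x by rewrite fr6 // /s5 /update /= keep4.
      have s6_y : read_vec s6 aBest N = y.
        by rewrite copy6 -cand2; apply/colP => i; rewrite !mxE /s5 /s4 /update /= fr3.
      split; rewrite ?s6_best //; last exact: ltW.
      rewrite /best_point s6_best s6_cur s6_y; split; first by lia.
      split=> // i; have yE : y i ord0 = x i ord0 + (2 ^ j)%N%:Z * d i ord0.
        by rewrite mxE [X in _ + X]mxE.
      have step_le : `|(2 ^ j)%N%:Z * d i ord0| <= 2 * K%:Z * (F x - F y).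
        rewrite normrM mulrAC ler_pM //; first by move: gain; rewrite h0E ger0_norm.
        by have := dK i; lia.
      rewrite yE; apply: le_trans (ler_normD _ _) _; move: (x_near i) step_le.
      by move: (`|x i ord0|) (`|_ * _|) (F x) (F y) (K%:Z) => a c z w v; lia.
    by apply: runs_skip; split; rewrite ?keep4 // /best_point /read_vec !keep4.
  move=> s5 fr5 s5B [best5 best5_le best5_y].
  have s5_lam : s5 vLam 0%N = (2 ^ j)%N%:Z by rewrite fr5 // keep4.
  have s5_go : s5 vGo 0%N = s' vGo 0%N by rewrite fr5 // keep4.
  have s5_prev : s5 vPrev 0%N = F y by rewrite fr5 // /s4 /update /= val3.
  apply: (runs_asg _ BM); rewrite /= s5_lam.
    have := gap _ Dy; move: gain; rewrite h0E -/y; move: GB.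
    by move: (2 ^ j)%N (F x) (F y) => a c z; lia.
  split=> //; rewrite /update /=; first exact: le_trans best5_le best_le.
  rewrite s5_go go; split; rewrite ?s5_prev //.
  by rewrite expnS PoszM.
move=> j s' fr s'B [best_s' best_le]; rewrite /= ltNge => + ge; rewrite ge /= => gain.
by split.
Qed.

Lemma exists_minimum x : D x = 0 ->
  exists2 y, D y = 0 & forall z, D z = 0 -> F y <= F z.
Proof.
move=> Dx; have ex_m : exists m, `[< exists2 y, D y = 0 & F y = lo + m%:Z >].
  by exists `|F x - lo|%N; apply/asboolP; exists x => //; have := F_ge_lo Dx; lia.
have [m /asboolP[y Dy Fy] m_min] := ex_minnP ex_m; exists y => // z Dz.
have Fz := F_ge_lo Dz; have Ez : F z = lo + (absz (F z - lo))%:Z by lia.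
have : (m <= absz (F z - lo)%R)%N by apply: m_min; apply/asboolP; exists z.
by lia.
Qed.

Hypothesis basis : forall y, y != 0 ->
  exists2 c : 'I_(num_codes N K), decoding N K c != 0 & conformal C (decoding N K c) y.
Hypothesis codesB : (num_codes N K <= B)%N.

Lemma runs_augment st : let x0 := read_vec st aX N in
    env ref st -> st vPhase 0%N = (ph : nat)%:Z -> D x0 = 0 -> F x0 = hi ->
    (forall i, (`|x0 i ord0| <= X0)%N) ->
  runs orc B M (augment K r s p q t) st (fun st' =>
    current st' /\ forall y, D y = 0 -> st' vCur 0%N <= F y).
Proof.
move=> x0 Hst st_ph Dx0 Fx0 x0_le; apply: runs_bounded => stB.
have M0 : (0 < M)%N by apply: leq_trans BM.
have [ymin Dmin min_le] := exists_minimum Dx0; set opt := F ymin in min_le.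
apply: runs_seq; apply: (runs_asg _ BM) => //=; set s1 := update _ _ _ _.
have Hs1 : env ref s1 by rewrite /s1; apply: env_update.
have X0Y : (X0 <= Y)%N by lia.
apply: (runs_call (R := fun s2 => read_vec s2 aCand N = x0)).
  apply: (runs_conseq (runs_candidate _ BM nM NB _ _)).
  - by rewrite Hs1.
  - move=> i iN; rewrite /s1 /update /= mul0r addr0; apply: stB.
  by move=> s2 _ _ ->; rewrite /s1 /update /= scale0r addr0.
move=> s2 fr2 s2B cand2; have Hs2 := env_frame Hs1 fr2 isT.
have frx2 : s2 aX = st aX by rewrite fr2.
apply: (runs_call (R := fun s3 => s3 vVal 0%N = F x0)).
  apply: runs_conseq; first apply: evaluate_spec => //.
  - by rewrite cand2 => i; apply: leq_trans (x0_le i) X0Y.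
  - by rewrite fr2.
  by rewrite cand2 => s3 _ _ [_ _ _ ->].
move=> s3 fr3 s3B val3; have Hs3 := env_frame Hs2 fr3 isT.
apply: runs_seq; apply: (runs_asg _ BM) => /=; first exact: s3B.
apply: runs_seq; apply: (runs_asg _ BM) => /=; first by lia.
set s4 := update _ _ _ _.
have near0 v : v <= hi -> near_start x0 v.
  move=> v_hi i; have := x0_le i; have : 0 <= 2 * K%:Z * (hi - v).
    by rewrite mulr_ge0 //; lia.
  by lia.
have cur4 : current s4.
  have x4 : read_vec s4 aX N = x0 by rewrite /read_vec /s4 /update /= fr3 // frx2.
  rewrite /current x4; split=> //.
  - by rewrite /s4; do 2 apply: env_update => //.
  - by rewrite /s4 /update /= fr3 // fr2.
  by rewrite Fx0; split=> //; apply: near0.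
(* The distance to the optimal value shrinks by c2.-1 / c2 in each round. *)
pose c2 := (num_codes N K).*2.
have c2_gt1 : (1 < c2)%N.
  have : (0 < num_codes N K)%N by rewrite /num_codes expn_gt0.
  by rewrite /c2 -addnn; lia.
pose gap (s' : store) := `|s' vCur 0%N - opt|%N.
pose I (k : nat) (s' : store) := current s' /\
  if 0 < s' vGoOn 0%N then
    (k <= c2 * M + 1)%N /\ (c2 ^ k * gap s' <= c2.-1 ^ k * gap s4)%N
  else forall y, D y = 0 -> s' vCur 0%N <= F y.
apply: (runs_while BM (I := I)).
- by split.
- move=> k s' fr' s'B [cur' go'] /= go; rewrite go in go'; have [k_le gap_le] := go'.
  split.
    have codes_le := num_codes_le t K M0 nM.
    rewrite expnS; move: k_le codes_le; rewrite /c2 -addnn.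
    have : (0 < t.+1 ^ (K + K) * M ^ (K + K))%N by rewrite muln_gt0 !expn_gt0 M0.
    by move: (t.+1 ^ _)%N (M ^ (K + K))%N (num_codes N K) => a z c; nia.
  pose x := read_vec s' aX N.
  have [Hs' _ Dx s'_cur [x_hi x_near]] := cur'.
  rewrite -/x in Dx s'_cur x_hi x_near.
  apply: runs_seq; apply: (runs_asg _ BM) => /=; first exact: s'B.
  set s5 := update _ _ _ _.
  have keep5 (s6 : store) : (forall a, a \notin vCode :: writes (erase
      (decode t K ;; line_search r s p q t)) -> s6 a = s5 a) ->
      {in iota 0 10 ++ [:: aTabA; aTabW; aZero; vPhase; vCur; aX], forall a, s6 a = s' a}.
    move=> fr a aE; have -> : s6 a = s5 a by apply: fr; move: a aE; apply/allP.
    by apply/funext => i; rewrite /s5 /update; case: eqP aE => [->|].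
  pose J (j : nat) (s6 : store) := best_point s6 /\
    forall c (k : nat), (c < j)%N -> D (x + decoding N K c *+ k) = 0 ->
      F x - F (x + decoding N K c *+ k) <= 2 * (s6 vCur 0%N - s6 vBest 0%N).
  apply: (runs_call (R := fun s6 =>
    {in iota 0 10 ++ [:: aTabA; aTabW; aZero; vPhase; vCur; aX], forall a, s6 a = s' a} /\
    J (num_codes N K) s6)).
    apply: (@runs_for _ _ _ BM _ _ _ _ _ _ (num_codes N K) J) => //.
    + exact: (num_codes_le _ _ M0 nM).
    + move=> s6 /keep5 fr6; apply: eval_pow.
      by rewrite /= fr6 // Hs' // ref_n /N; lia.
    + by split=> //; split; rewrite /s5 /update //= ltxx.
    + move=> j s6 j_lt /keep5 fr6 s6j s6B [best6 gain6].
      have cur6 := current_agree cur' fr6.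
      have s60 : s6 0%N 0%N = n%:Z by rewrite fr6 // Hs'.
      apply: (runs_call (runs_decode _ BM nM NB s60 s6j _ KB)).
        exact: leq_trans (ltnW j_lt) codesB.
      move=> s7 fr7 s7B z7.
      have keep7 a : a \in [:: vBest; vCur; aBest; aX] -> s7 a = s6 a.
        by move=> aE; apply: fr7; move: a aE; apply/allP.
      have cur7 : current s7.
        by apply: current_agree cur6 _ => a aE; apply: fr7; move: a aE; apply/allP.
      apply: (runs_conseq (runs_line_search cur7 _ _)).
      * by rewrite /best_point /read_vec !keep7.
      * by move=> i; rewrite z7 decoding_le.
      have x7 : read_vec s7 aX N = x by rewrite /read_vec keep7 // fr6.
      rewrite z7 x7 keep7 // => s8 fr8 s8B [best8 best_le gain8].
      split=> // c m; rewrite ltnS leq_eqVlt => /predU1P[->|cj] Dc.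
        exact: gain8.
      apply: le_trans (gain6 c m cj Dc) _.
      have s8_cur : s8 vCur 0%N = s6 vCur 0%N by rewrite fr8 // keep7.
      by rewrite ler_pM2l // /update /= s8_cur; lia.
    by move=> s6 /keep5.
  move=> s6 fr6 s6B [keep6 [best6 gain6]].
  have cur6 := current_agree cur' keep6.
  have s6_cur : s6 vCur 0%N = F x by rewrite keep6.
  have total y : D y = 0 -> F x - F y <= c2%:Z * (F x - s6 vBest 0%N).
    move=> Dy; have := @progress _ _ C _ (fun c : 'I_(num_codes N K) => decoding N K c)
      basis D F cD cF D_ge0 x y (2 * (F x - s6 vBest 0%N)) Dx Dy.
    rewrite card_ord mulrA => H; have -> : c2%:Z = (num_codes N K)%:Z * 2.
      by rewrite /c2 -muln2 PoszM.
    by apply: H => c m Dc; have := gain6 c m (ltn_ord c) Dc; rewrite s6_cur.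
  apply: (runs_if BM) => /=; rewrite s6_cur ?subr_gt0 ?subr_le0 => best_lt; last first.
    apply: (runs_asg _ BM) => //=; split; first by apply: current_agree cur6 _ => a aE;
      apply/funext => i; rewrite /update; case: eqP aE => [->|].
    rewrite /update /= s6_cur => y Dy; have := total y Dy.
    case: best6; rewrite s6_cur => le6 _; have -> : s6 vBest 0%N = F x by lia.
    by rewrite subrr mulr0; lia.
  apply: runs_seq; apply: (runs_asg _ BM) => /=; first exact: s6B.
  set s7 := update _ _ _ _.
  apply: (runs_conseq (runs_copy _ BM nM NB _ _ _ _ _)) => //.
    by rewrite /s7 /update /= keep6 // Hs'.
  move=> s8 fr8 s8B copy8.
  have bp8 : read_vec s8 aX N = read_vec s6 aBest N by rewrite copy8.
  have s8_cur : s8 vCur 0%N = s6 vBest 0%N by rewrite fr8.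
  have [_ ] := best6; rewrite s6_cur => /(_ best_lt)[D8 F8 near8].
  split.
    rewrite /current bp8 s8_cur; split=> //.
    - by apply: env_frame _ fr8 _ => //; apply: env_update => // a aE; rewrite keep6 ?Hs' //;
        move: a aE; apply/allP.
    - by rewrite fr8 // /s7 /update /= keep6 //; case: cur'.
    by rewrite F8; split; [lia | rewrite -F8].
  have s8_go : s8 vGoOn 0%N = s' vGoOn 0%N by rewrite fr8 // /s7 /update /= fr6.
  rewrite s8_go go.
  have opt_le : opt <= s6 vBest 0%N by rewrite -F8; apply: min_le.
  (* There was an improvement, hence the point was not yet optimal. *)
  have gap_lt : (0 < gap s')%N by rewrite /gap s'_cur -/x; lia.
  have gap4 : (gap s4 < 2 ^ M)%N.
    apply: (@leq_ltn_trans B).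
      rewrite /gap; have [_ _ D4 -> [le_hi _]] := cur4; have := F_ge_lo Dmin.
      have := min_le _ D4; rewrite -/opt; move: (F _) le_hi => v le_hi.
      by move: hi_lo GB; clear -le_hi; lia.
    apply: (@leq_trans (2 ^ up_log 2 B.+1)); first exact: up_logP.
    by rewrite leq_exp2l //; apply: leq_trans BM; apply: leqnSn.
  have c2E : c2.-1.+1 = c2 by lia.
  split.
    rewrite addn1 ltnS -c2E; apply: geometric_bound; first by lia.
    rewrite c2E; apply: (@leq_trans (c2 ^ k * gap s')); first by rewrite leq_pmulr.
    by apply: leq_trans gap_le _; rewrite leq_mul2l ltnW ?orbT.
  have gap8 : (c2 * gap s8 <= c2.-1 * gap s')%N.
    rewrite /gap s8_cur s'_cur -/x; apply: gap_decrease => //.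
    exact: total.
  rewrite !expnS -!mulnA mulnCA; apply: leq_trans (leq_mul (leqnn _) gap8) _.
  by rewrite mulnCA leq_mul.
move=> k s' _ _ [cur']; rewrite /= ltNge => + ge; rewrite ge /= => opt_cur.
by split.
Qed.

End Abstract.
End Descent.

(** * The algorithm *)

Section MainProgram.
Local Open Scope ring_scope.
Local Open Scope expr_scope.

Fixpoint load (a i : nat) (vs : seq int) : acmd :=
  if vs is v :: vs' then AAsg a (Cst i) (Cst v) ;; load a i.+1 vs' else ASkip.

Definition table m t (A : 'M[int]_(m, t)) : seq int :=
  [seq ent A (k %/ t) (k %% t) | k <- iota 0 (m * t)].

(** The step length in [vLam] exceeds all finite bounds, so that reaching a
    feasible point along a nonzero direction shows the direction to be unbounded. *)
Definition scan (K r s p q t : nat) : acmd :=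
  assign vInf (Cst 0) ;;
  AFor (t.+1 ^ (K + K)) (K + K) vCode (codes_expr t K)
    (decode t K ;; candidate t ;; evaluate r s p q t ;;
     assign vNorm (Cst 0) ;;
     AFor t 1 vI (#0 [*] Cst t) (add_to vNorm (Cst 0) (Get aZ #vI [*] Get aZ #vI)) ;;
     AIf #vNorm (AIf #vPhi ASkip (assign vInf (Cst 1))) ASkip).

(** [vPhase] is 0 initially, so that the first run of [augment] minimizes the
    violation; a solution is announced after the second run only. *)
Definition main_program (K r s p q t : nat) (A : 'M[int]_(r + s, t))
    (W : 'M[int]_(p + q, t)) : acmd :=
  load aTabA 0 (table A) ;; load aTabW 0 (table W) ;;
  augment K r s p q t ;;
  AIf #vCur ASkip
    (assign vLam (Cst 0) ;; candidate t ;; evaluate r s p q t ;;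
     assign vLam (#vAcc [+] Cst 1) ;; scan K r s p q t ;;
     AIf #vInf ASkip
       (assign vPhase (Cst 1) ;; augment K r s p q t ;; assign aFlag (Cst 1))).

Lemma size_table m t (A : 'M[int]_(m, t)) : size (table A) = (m * t)%N.
Proof. by rewrite size_map size_iota. Qed.

Lemma nth_table m t (A : 'M[int]_(m, t)) i j : (i < m)%N -> (j < t)%N ->
  nth 0 (table A) (i * t + j) = ent A i j.
Proof.
move=> im jt; have t0 : (0 < t)%N by apply: leq_ltn_trans jt.
have ij : (i * t + j < m * t)%N by nia.
rewrite (nth_map 0%N) ?size_iota // nth_iota // add0n.
by rewrite divnMDl // modnMDl divn_small // modn_small // addn0.
Qed.

Lemma runs_load orc B M a i vs st : (bitlen B%:Z <= M)%N -> {in vs, forall v, (`|v| <= B)%N} ->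
  runs orc B M (load a i vs) st (fun st' =>
    (forall a', a' != a -> st' a' = st a') /\
    forall j, st' a j = if (i <= j < i + size vs)%N then nth 0 vs (j - i) else st a j).
Proof.
move=> BM; elim: vs i st => [|v vs IHvs] i st vsB /=.
  by apply: runs_skip; split=> // j; case: ifP => //; lia.
apply: runs_seq; apply: (runs_asg _ BM) => /=; first by apply: vsB; rewrite mem_head.
apply: runs_conseq (IHvs i.+1 _ _) _ => [w w_vs|st' _ _ [keep new]].
  by apply: vsB; rewrite inE w_vs orbT.
split=> [a' a'a|j]; first by rewrite keep // /update (negPf a'a).
rewrite new /update eqxx /=; case: (ltngtP i j) => [ij|ji|<-].
- rewrite /= addSnnS; case: ifP => // _.
  by have -> : (j - i = (j - i.+1).+1)%N by lia.
- by [].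
by rewrite /= subnn addnS ltnS leq_addr.
Qed.

Section Abstract.
Variables (r s p q t n : nat) (orc : oracle_name -> oracle) (B M Y : nat) (ref : store).
Hypotheses (BM : (bitlen B%:Z <= M)%N) (nM : (n <= M)%N).
Let N := (n * t)%N.

Hypothesis ref_n : ref 0%N 0%N = n%:Z.
Variables (D F V S : 'cV[int]_N -> int).
Hypothesis evaluate_spec : forall st, let y := read_vec st aCand N in
  env ref st -> small Y y -> st vPhase 0%N = 0 ->
  runs orc B M (evaluate r s p q t) st (fun st' =>
    [/\ st' vPhi 0%N = V y, st' vAcc 0%N = S y,
        st' vOk 0%N = ((D y == 0) : nat)%:Z & D y = 0 -> st' vVal 0%N = F y]).
Variables (K : nat).
Hypotheses (NB : (N.+1 <= B)%N) (KB : (K.+1 <= B)%N) (YB : (Y <= B)%N)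
  (codesB : (num_codes N K <= B)%N) (normB : (N * (K * K) <= B)%N).
Hypothesis V_ge0 : forall y, 0 <= V y.

Lemma runs_scan st : let x := read_vec st aX N in let L := st vLam 0%N in
    env ref st -> st vPhase 0%N = 0 ->
    (forall c, small Y (x + L *: decoding N K c)) ->
  runs orc B M (scan K r s p q t) st (fun st' =>
    if 0 < st' vInf 0%N then
      exists2 c, decoding N K c != 0 & V (x + L *: decoding N K c) = 0
    else forall c, (c < num_codes N K)%N -> decoding N K c != 0 ->
      V (x + L *: decoding N K c) <> 0).
Proof.
move=> x L Hst st_ph xY; have M0 : (0 < M)%N by apply: leq_trans BM.
apply: runs_seq; apply: (runs_asg _ BM) => //=; set s1 := update _ _ _ _.
have Hs1 : env ref s1 by apply: env_update.
pose I (j : nat) (s' : store) := if 0 < s' vInf 0%N then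
      exists2 c, decoding N K c != 0 & V (x + L *: decoding N K c) = 0
    else forall c, (c < j)%N -> decoding N K c != 0 -> V (x + L *: decoding N K c) <> 0.
have keep (s' : store) a : (forall a, a \notin vCode :: writes (erase
    (decode t K ;; candidate t ;; evaluate r s p q t ;;
     assign vNorm (Cst 0) ;;
     AFor t 1 vI (#0 [*] Cst t) (add_to vNorm (Cst 0) (Get aZ #vI [*] Get aZ #vI)) ;;
     AIf #vNorm (AIf #vPhi ASkip (assign vInf (Cst 1))) ASkip)) -> s' a = s1 a) ->
  a \in iota 0 10 ++ [:: aTabA; aTabW; aZero; aX; vLam; vPhase] -> s' a = s1 a.
  by move=> fr aE; apply: fr; move: a aE; apply/allP.
have keep_env (s' : store) : {in iota 0 10 ++ [:: aTabA; aTabW; aZero; aX; vLam; vPhase],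
    forall a, s' a = s1 a} -> env ref s'.
  move=> keep' a aE; rewrite keep' ?Hs1 //; move: aE; rewrite !mem_cat => /orP[->//|].
  by rewrite !inE => /or3P[]->; rewrite ?orbT.
apply: (@runs_for _ _ _ BM _ _ _ _ _ _ (num_codes N K) I) => //.
- exact: (num_codes_le _ _ M0 nM).
- move=> s' fr; apply: eval_pow; rewrite /= (keep _ 0%N fr) // Hs1 // ref_n /N; lia.
- move=> j s' j_lt fr s'j s'B Ij.
  have {}keep a := keep s' a fr.
  have Hs' : env ref s' by apply: keep_env => a; apply: keep.
  have s'0 : s' 0%N 0%N = n%:Z by rewrite Hs'.
  pose d := decoding N K j.
  apply: (runs_call (runs_decode _ BM nM NB s'0 s'j _ KB)).
    exact: leq_trans (ltnW j_lt) codesB.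
  move=> s2 fr2 s2B z2; rewrite -/d in z2.
  have Hs2 := env_frame Hs' fr2 isT.
  have cand_eq : read_vec s2 aX N + s2 vLam 0%N *: read_vec s2 aZ N = x + L *: d.
    by rewrite z2 /read_vec !fr2 // !keep.
  apply: (runs_call (R := fun s3 => read_vec s3 aCand N = x + L *: d)).
    rewrite -cand_eq; apply: (runs_candidate _ BM nM NB); first by rewrite Hs2.
    move=> i iN; apply: leq_trans YB; have := xY j (Ordinal iN).
    by rewrite -/d -cand_eq !mxE.
  move=> s3 fr3 s3B cand3; have Hs3 := env_frame Hs2 fr3 isT.
  apply: (runs_call (R := fun s4 => s4 vPhi 0%N = V (x + L *: d))).
    apply: runs_conseq; first apply: evaluate_spec => //.
    + by rewrite cand3; apply: xY.
    + by rewrite fr3 // fr2 // keep.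
    by rewrite cand3 => s4 _ _ [].
  move=> s4 fr4 s4B phi4.
  apply: runs_seq; apply: (runs_asg _ BM) => //=; set s5 := update _ _ _ _.
  have z5 i : s5 aZ i = s2 aZ i by rewrite /s5 /update /= fr4 // fr3.
  have s50 : s5 0%N 0%N = n%:Z by rewrite /s5 /update /= fr4 // fr3 // fr2.
  have sq_le k : (k <= N)%N ->
      0 <= \sum_(i < k) s2 aZ i * s2 aZ i <= (k * (K * K))%N%:Z.
    elim: k => [|k IHk] kN; first by rewrite big_ord0.
    have := IHk (ltnW kN); rewrite big_ord_recr /= mulSn.
    have dk : (`|s2 aZ k| <= K)%N.
      have := congr1 (fun v : 'cV_N => v (Ordinal kN) ord0) z2.
      by rewrite mxE => ->; apply: decoding_le.
    have : s2 aZ k * s2 aZ k = (`|s2 aZ k| * `|s2 aZ k|)%N%:Z by rewrite PoszM; lia.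
    have := leq_mul dk dk; move: (\sum_(_ < k) _) (s2 aZ k * _) => a c.
    by move: (absz _ * absz _)%N (K * K)%N => z w; lia.
  pose J (k : nat) (s' : store) := s' vNorm 0%N = \sum_(i < k) s2 aZ i * s2 aZ i.
  apply: (runs_call (R := J N)).
    apply: (@runs_for _ _ _ BM _ _ _ _ _ _ N J) => //.
    + by have := size_le BM nM 0 t; rewrite !add0n.
    + exact: (ltnW NB).
    + by move=> s6 fr6 /=; rewrite fr6 // s50.
    + by rewrite /J big_ord0.
    + move=> k s6 kN fr6 s6k s6B J6.
      have z6 : s6 aZ k = s2 aZ k by rewrite fr6.
      have sumE : s6 vNorm 0%N + s2 aZ k * s2 aZ k = \sum_(i < k.+1) s2 aZ i * s2 aZ i.
        by rewrite J6 big_ord_recr.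
      apply: (runs_asg _ BM); rewrite /= s6k /= z6 sumE //.
      have := sq_le k.+1 kN; have : (k.+1 * (K * K) <= B)%N.
        by apply: leq_trans normB; rewrite leq_mul2r kN orbT.
      by move: (\sum_(_ < _) _) => a; lia.
  move=> s6 fr6 s6B norm6.
  have inf6 : s6 vInf 0%N = s' vInf 0%N by rewrite fr6 // /s5 /update /= fr4 // fr3 // fr2.
  have phi6 : s6 vPhi 0%N = V (x + L *: d) by rewrite fr6.
  have norm_eq0 : d = 0 <-> \sum_(i < N) s2 aZ i * s2 aZ i = 0.
    split=> [d0|/eqP].
      apply: big1 => i _; have := congr1 (fun v : 'cV_N => v i ord0) z2.
      by rewrite d0 !mxE => ->; rewrite mul0r.
    rewrite psumr_eq0 => [/allP sq0|i _]; last by rewrite -expr2 sqr_ge0.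
    apply/colP => i; rewrite -z2 !mxE.
    by have := sq0 i (mem_index_enum i); rewrite -expr2 sqrf_eq0 => /eqP.
  have next (s7 : store) : s7 vInf 0%N = s' vInf 0%N ->
      (d != 0 -> V (x + L *: d) <> 0) -> I j.+1 s7.
    rewrite /I => -> Vd; move: Ij; rewrite /I; case: ifP => // _ Ij c.
    by rewrite ltnS leq_eqVlt => /predU1P[->//|]; apply: Ij.
  apply: (runs_if BM) => /=; rewrite norm6 => norm_pos; last first.
    apply: runs_skip; apply: next => // /eqP[]; apply/norm_eq0.
    by have := sq_le N (leqnn _); lia.
  have d0 : d != 0 by apply/eqP => /norm_eq0 E; rewrite E in norm_pos.
  apply: (runs_if BM) => /=; rewrite phi6 => phi_pos.
    by apply: runs_skip; apply: next => // _ E; rewrite E in phi_pos.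
  apply: (runs_asg _ BM) => //=; first by lia.
  rewrite /I /update /=; exists j => //.
  by have := V_ge0 (x + L *: d); rewrite -/d; lia.
Qed.

End Abstract.
End MainProgram.

(** * Unbounded directions, convexity and the initial store *)

Section Feasibility.
Local Open Scope ring_scope.

Lemma max_abs_ge m (S : set 'cV[int]_m) (h : 'cV[int]_m -> int) y :
  finite_set S -> S y -> (`|h y| <= max_abs S h)%N.
Proof.
move=> finS Sy; rewrite /max_abs.
by rewrite (big_rem y) ?leq_maxl //= in_fset_set // inE.
Qed.

(** A step this long crosses every finite bound in its way. *)
Lemma penalty_ray (l u : \bar int) (v a L k : int) :
    squares (efin l) (efin u) v < L -> 0 <= k ->
    (l <= v%:E <= u)%E -> (l <= (v + L * a)%:E <= u)%E ->
  (l <= (v + k * a)%:E <= u)%E.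
Proof.
move=> long k0 /andP[lv vu] /andP[lvL vLu].
have sq1 (c : int) : `|c| <= c * c by have [c0|c0|->] := ltgtP c 0; nia.
have sq (c d : int) : `|c - d| <= c * c + d * d by have := sq1 c; have := sq1 d; lia.
have L0 : 0 < L by apply: le_lt_trans long; apply: squares_ge0.
apply/andP; split.
  case: l lv lvL long => [l||]; [|by rewrite leye_eq|by rewrite !leNye].
  rewrite !lee_fin /squares /= => lv lvL long.
  have [a0|a0] := leP 0 a; first by have := mulr_ge0 k0 a0; lia.
  have : L * a <= - L by nia.
  by have := sq l v; have := sqr_ge0 (efin u); rewrite expr2; lia.
case: u vu vLu long => [u||]; [|by rewrite !leey|by rewrite leeNy_eq].
rewrite !lee_fin /squares /= => vu vLu long.
have [a0|a0] := leP a 0; first by have := mulr_ge0_le0 k0 a0; lia.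
have : L <= L * a by nia.
by have := sq u v; have := sqr_ge0 (efin l); rewrite expr2; lia.
Qed.

Section Instance.
Variables (r s p q t n : nat) (A : 'M[int]_(r + s, t)) (W : 'M[int]_(p + q, t)).
Variables (l u : 'cV[\bar int]_(n * t)) (lh uh : 'cV[\bar int]_(p + n * q)).
Variables (b : 'cV[int]_(r + n * s)).
Variables (f : 'cV[int]_(p + n * q) -> int) (g : 'cV[int]_(n * t) -> int).
Let N := (n * t)%N.
Let V := violation A W l u lh uh b.
Let C := col_mx (nfold n A) (nfold n W).

Lemma box_ray m (l' u' : 'cV[\bar int]_m) (v a : 'cV[int]_m) (L k : int) :
    box_squares l' u' v < L -> 0 <= k -> in_box l' u' v -> in_box l' u' (v + L *: a) ->
  in_box l' u' (v + k *: a).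
Proof.
move=> long k0 v_in vL_in i; have := vL_in i; rewrite !mxE; apply: penalty_ray => //.
apply: le_lt_trans long; rewrite /box_squares (bigD1 i) //= lerDl.
by apply: sumr_ge0 => j _; apply: squares_ge0.
Qed.

Lemma violation_ray x d (L k : int) : spread A W l u lh uh b x < L -> 0 <= k ->
  V x = 0 -> V (x + L *: d) = 0 -> V (x + k *: d) = 0.
Proof.
have sq0 m (l' u' : 'cV_m) v : 0 <= box_squares l' u' v.
  by apply: sumr_ge0 => i _; apply: squares_ge0.
rewrite /spread => long k0 /violation_eq0[Ax Wx lx] /violation_eq0[AxL WxL lxL].
have := sq0 _ (finite_vec b) (finite_vec b) (nfold n A *m x).
have := sq0 _ lh uh (nfold n W *m x); have := sq0 _ l u x.
move: long; set sA := box_squares _ _ (nfold n A *m x).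
set sW := box_squares lh _ _; set sl := box_squares l _ _ => long l0 W0 A0.
have lin m (C' : 'M_(m, N)) c : C' *m (x + c *: d) = C' *m x + c *: (C' *m d).
  by rewrite mulmxDr scalemxAr.
apply/violation_eq0; split.
- apply/in_box_finite_vec; rewrite lin; apply: box_ray (k0) _ _; last 2 first.
  + by apply/in_box_finite_vec; exact: Ax.
  + by rewrite -lin; apply/in_box_finite_vec; exact: AxL.
  by rewrite -/sA; lia.
- rewrite lin; apply: box_ray (k0) Wx _; last by rewrite -lin; exact: WxL.
  by rewrite -/sW; lia.
by apply: box_ray (k0) lx lxL; rewrite -/sl; lia.
Qed.

(** No finite bound lies beyond the step of length L, so the whole ray is
    feasible. *)
Lemma infinite_ray x d (L : int) : spread A W l u lh uh b x < L -> d != 0 ->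
  V x = 0 -> V (x + L *: d) = 0 -> infinite_set (feasible A W l u lh uh b).
Proof.
move=> long d0 Vx VxL finS; apply: infinite_nat.
have -> : [set: nat]%classic = ((fun k : nat => x + k%:Z *: d) @^-1`
    feasible A W l u lh uh b)%classic.
  apply/seteqP; split=> // k _; apply/violation_eq0.
  exact: (@violation_ray x d L).
apply: finite_preimage finS => j k _ _ /addrI E.
have [i di] := norm1_neq0 d0.
have := congr1 (fun v : 'cV_N => v i ord0) E; rewrite !mxE.
by move=> /(mulIf di) [].
Qed.

Lemma convex_along_sum (h : 'I_N -> int -> int) (kA : 'I_(r + n * s) -> int -> int)
    (kW : 'I_(p + n * q) -> int -> int) :
    (forall i, convex1 (h i)) -> (forall i, convex1 (kA i)) -> (forall i, convex1 (kW i)) ->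
  convex_along C (fun y => \sum_i kA i ((nfold n A *m y) i ord0) +
    \sum_i kW i ((nfold n W *m y) i ord0) + \sum_i h i (y i ord0)).
Proof.
move=> ch cA cW.
pose k (j : 'I_((r + n * s) + (p + n * q))) :=
  match fintype.split j with inl i => kA i | inr i => kW i end.
exists h, k; split=> // [j|y]; first by rewrite /k; case: fintype.split.
rewrite [RHS]addrC [in RHS]big_split_ord /= /C mul_col_mx; congr (_ + _ + _).
  by apply: eq_bigr => i _; rewrite col_mxEu /k (unsplitK (inl i)).
by apply: eq_bigr => i _; rewrite col_mxEd /k (unsplitK (inr i)).
Qed.

Lemma convex_along_violation : convex_along C V.
Proof.
pose pen m (l' u' : 'cV[\bar int]_m) i :=
  penalty (etag (l' i ord0)) (efin (l' i ord0)) (etag (u' i ord0)) (efin (u' i ord0)).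
have cpen m (l' u' : 'cV[\bar int]_m) i : convex1 (pen m l' u' i) by apply: convex1_penalty.
exact: (convex_along_sum (cpen _ l u) (cpen _ (finite_vec b) (finite_vec b))
  (cpen _ lh uh)).
Qed.

Lemma convex_along_objective : separable_convex f -> separable_convex g ->
  convex_along C (objective W f g).
Proof.
move=> [fi [cf fE]] [gi [cg gE]].
have := @convex_along_sum gi (fun _ _ => 0) fi cg (fun _ => convex1_cst 0) cf.
congr convex_along; apply/funext => y.
by rewrite /objective fE gE [X in X + _ + _]big1 // add0r.
Qed.

Lemma convex_along_zero : convex_along C (fun=> 0).
Proof.
exists (fun _ _ => 0), (fun _ _ => 0); split=> [i|i|y]; rewrite ?big1 ?addr0 //;
  exact: convex1_cst.
Qed.

End Instance.

Lemma nth_entries (T : Type) (U : Type) (x0 : U) (h : T -> U) m (v : 'cV[T]_m) (i : 'I_m) :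
  nth x0 (map h (entries v)) i = h (v i ord0).
Proof.
by rewrite /entries -map_comp (nth_map i) ?size_enum_ord ?ltn_ord // nth_ord_enum.
Qed.

Lemma nth_entries_id (m : nat) (v : 'cV[int]_m) (i : 'I_m) :
  nth 0 (entries v) i = v i ord0.
Proof. by rewrite -[entries v]map_id nth_entries. Qed.

Lemma absz_bitlen (z : int) (k : nat) : (bitlen z <= k)%N -> (`|z| <= 2 ^ k)%N.
Proof.
rewrite /bitlen => zk; apply: ltnW; apply: leq_trans (up_logP `|z|.+1 (isT : (1 < 2)%N)) _.
by rewrite leq_exp2l // ltnW.
Qed.

Lemma bitlen_entry m (v : 'cV[int]_m) i : (bitlen (v i ord0) <= vbitlen v)%N.
Proof. by rewrite /vbitlen (bigD1 i) //= leq_addr. Qed.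

Lemma bitlen_efin m (v : 'cV[\bar int]_m) i : (bitlen (efin (v i ord0)) <= vebitlen v)%N.
Proof.
apply: (@leq_trans (ebitlen (v i ord0))); last by rewrite /vebitlen (bigD1 i) //= leq_addr.
by case: (v i ord0) => //=; rewrite /bitlen up_log1.
Qed.

Lemma init_store_bounded mx mw mb n (l u : 'cV[\bar int]_mx) (lh uh : 'cV[\bar int]_mw)
    (b : 'cV[int]_mb) (G : nat) : (0 < G)%N -> (n <= G)%N ->
    (forall i, (`|efin (l i ord0)| <= G)%N) -> (forall i, (`|efin (u i ord0)| <= G)%N) ->
    (forall i, (`|efin (lh i ord0)| <= G)%N) -> (forall i, (`|efin (uh i ord0)| <= G)%N) ->
    (forall i, (`|b i ord0| <= G)%N) ->
  bounded G (init_store n l u lh uh b).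
Proof.
move=> G0 nG lG uG lhG uhG bG a i.
have nth_le (vs : seq int) : {in vs, forall v, (`|v| <= G)%N} -> (`|nth 0%R vs i| <= G)%N.
  move=> vsG; have [lt_i|le_i] := ltnP i (size vs); last by rewrite nth_default.
  by apply: vsG; apply: mem_nth.
have tag_le m (v : 'cV[\bar int]_m) : {in map etag (entries v), forall w, (`|w| <= G)%N}.
  by move=> w /mapP[z _ ->]; case: z.
have fin_le m (v : 'cV[\bar int]_m) : (forall i, (`|efin (v i ord0)| <= G)%N) ->
    {in map efin (entries v), forall w, (`|w| <= G)%N}.
  by move=> vG w /mapP[z /mapP[j _ ->] ->].
rewrite /init_store.
case: a => [|a] /=; first by apply: nth_le => w; rewrite inE => /eqP->.
do 8 (case: a => [|a] /=; first by apply: nth_le; solve [exact: tag_le | exact: fin_le]).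
case: a => [|a] /=; first by apply: nth_le => w /mapP[j _ ->].
by rewrite !nth_nil.
Qed.

End Feasibility.

(** * Correctness of the algorithm *)

Section Correctness.
Local Open Scope ring_scope.

(** Bounds on all numbers that occur, given a bound [g] on the input numbers, on
    the oracle values at feasible points and on n + 1. The three summands of
    [point_bound] are for the candidates of the first descent, of the search for
    unbounded directions and of the second descent. *)
Section Bounds.
Variables (r s p q t K alpha : nat).
Local Open Scope nat_scope.

Definition rows_bound (g : nat) := (r + s + p + q + t).+1 * g.
Definition row_bound (Y : nat -> nat) g := t * g * (alpha * Y g) + Y g.
Definition violation_bound Y g := rows_bound g * (2 * (row_bound Y g + g) + 2).
Definition spread_bound Y g :=
  rows_bound g * (row_bound Y g * row_bound Y g + g * g + g * g).
Definition gap1_bound g := violation_bound (fun=> 0) g.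
Definition point1_bound g := 2 * K * gap1_bound g.
Definition ray_bound g := spread_bound point1_bound g + 1.
Definition point_bound g :=
  (point1_bound g + (4 * gap1_bound g + 1) * K) + (point1_bound g + ray_bound g * K)
  + (point1_bound g + 2 * K * (4 * g) + (4 * (4 * g) + 1) * K).
Definition cell_bound g :=
  rows_bound g + row_bound point_bound g + violation_bound point_bound g
  + spread_bound point_bound g + K + (4 * gap1_bound g + 2) + (4 * (4 * g) + 2)
  + point_bound g + (t * g + 1) ^ (K + K) + t * g * (K * K) + ray_bound g
  + 4 * g + alpha + g + 2.

End Bounds.

Section Instance.
Variables (r s p q t n : nat) (A : 'M[int]_(r + s, t)) (W : 'M[int]_(p + q, t)).
Variables (l u : 'cV[\bar int]_(n * t)) (lh uh : 'cV[\bar int]_(p + n * q)).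
Variables (b : 'cV[int]_(r + n * s)).
Variables (f : 'cV[int]_(p + n * q) -> int) (g : 'cV[int]_(n * t) -> int).
Hypotheses (cf : separable_convex f) (cg : separable_convex g).
Let N := (n * t)%N.
Let Cm := col_mx (nfold n A) (nfold n W).
Let S := feasible A W l u lh uh b.
Variables (K alpha G M : nat).
Hypothesis graver : forall z : 'cV[int]_N, z != 0 ->
  exists v, [/\ v != 0, (norm1 v <= K)%N & conformal Cm v z].
Hypotheses (A_le : forall i j, (`|ent A i j| <= alpha)%N)
  (W_le : forall i j, (`|ent W i j| <= alpha)%N)
  (nG : (n < G)%N)
  (lG : forall i, (`|efin (l i ord0)| <= G)%N) (uG : forall i, (`|efin (u i ord0)| <= G)%N)
  (lhG : forall i, (`|efin (lh i ord0)| <= G)%N)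
  (uhG : forall i, (`|efin (uh i ord0)| <= G)%N)
  (bG : forall i, (`|b i ord0| <= G)%N)
  (fG : (max_abs S (fun x => f (nfold n W *m x)) <= G)%N) (gG : (max_abs S g <= G)%N).
Let Y := point_bound r s p q t K alpha G.
Let B := cell_bound r s p q t K alpha G.
Hypotheses (BM : (bitlen B%:Z <= M)%N) (nM : (n <= M)%N).

Let obj := objective W f g.
Let viol := violation A W l u lh uh b.

Lemma num_rows_le : (num_rows r s p q t n < rows_bound r s p q t G)%N.
Proof. rewrite /num_rows /rows_bound; nia. Qed.

Lemma max_row_le (Y' : nat -> nat) :
  (max_row t n alpha (Y' G) <= row_bound t alpha Y' G)%N.
Proof.
rewrite /max_row /row_bound leq_add2r leq_mul2r; apply/orP; right.
by rewrite mulnC leq_mul2l ltnW ?orbT.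
Qed.

Lemma violation_bound_le (Y' : nat -> nat) :
  (num_rows r s p q t n * ((max_row t n alpha (Y' G) + G).*2 + 2)
    <= violation_bound r s p q t alpha Y' G)%N.
Proof.
rewrite /violation_bound leq_mul //; first exact: (ltnW num_rows_le).
by rewrite -mul2n leq_add2r leq_mul2l leq_add2r max_row_le.
Qed.

Lemma spread_bound_le (Y' : nat -> nat) :
  (num_rows r s p q t n * (max_row t n alpha (Y' G) * max_row t n alpha (Y' G) +
    G * G + G * G) <= spread_bound r s p q t alpha Y' G)%N.
Proof.
rewrite /spread_bound leq_mul //; first exact: (ltnW num_rows_le).
by rewrite !leq_add2r leq_mul ?max_row_le.
Qed.

Lemma cell_bounds :
  [/\ (num_rows r s p q t n < B)%N, (max_row t n alpha Y <= B)%N,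
      (num_rows r s p q t n * ((max_row t n alpha Y + G).*2 + 2) <= B)%N &
      (num_rows r s p q t n * (max_row t n alpha Y * max_row t n alpha Y + G * G + G * G)
        <= B)%N] /\
  [/\ (N.+1 <= B)%N, (K.+1 <= B)%N, (4 * gap1_bound r s p q t alpha G + 2 <= B)%N,
      (4 * (4 * G) + 2 <= B)%N & (Y <= B)%N] /\
  [/\ (num_codes N K <= B)%N, (N * (K * K) <= B)%N,
      (ray_bound r s p q t K alpha G <= B)%N, (4 * G <= B)%N & (alpha <= B)%N] /\
  (G <= B)%N.
Proof.
have rB : (rows_bound r s p q t G <= B)%N by rewrite /B /cell_bound; lia.
have row := max_row_le (point_bound r s p q t K alpha).
have vio := violation_bound_le (point_bound r s p q t K alpha).
have spr := spread_bound_le (point_bound r s p q t K alpha).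
have N_le : (N <= t * G)%N by rewrite /N mulnC leq_mul2l ltnW ?orbT.
have codes : (num_codes N K <= (t * G + 1) ^ (K + K))%N.
  by rewrite /num_codes; case: (K + K)%N => // k; rewrite leq_exp2r //; lia.
have norm : (N * (K * K) <= t * G * (K * K))%N by rewrite leq_mul2r N_le orbT.
have rows := num_rows_le.
have NB : (N < num_rows r s p q t n + 1)%N by rewrite /num_rows addn1 ltnS leq_addl.
move: rows row vio spr NB codes norm; rewrite /B /cell_bound /Y.
by split; [split; lia|split; [split; lia|split; [split; lia|lia]]].
Qed.

Lemma test_vector y : y != 0 ->
  exists2 c : 'I_(num_codes N K), decoding N K c != 0 & conformal Cm (decoding N K c) y.
Proof.
move=> /graver[v [v0 vK v_conf]]; have [c c_lt Dc] := decoding_surj vK.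
by exists (Ordinal c_lt); rewrite /= Dc.
Qed.

Let P := main_program K A W.
Let orc := oracles f g.

Lemma runs_main : runs orc B M P (init_store n l u lh uh b) (fun st' =>
  solves S (fun x => f (nfold n W *m x) + g x) (output N st')).
Proof.
have [[B1 B2 B3 B4] [[B5 B6 B7 B8 B9] [[B10 B11 B12 B13 B14] B15]]] := cell_bounds.
have M0 : (0 < M)%N by apply: leq_trans BM.
pose st0 := init_store n l u lh uh b; rewrite -/st0.
have table_le m (A' : 'M[int]_(m, t)) : (forall i j, (`|ent A' i j| <= alpha)%N) ->
    {in table A', forall v, (`|v| <= B)%N}.
  by move=> A'_le v /mapP[k _ ->]; apply: leq_trans B14.
have st0_high a : (9 < a)%N -> forall i, st0 a i = 0.
  by move=> a9 i; rewrite /st0 /init_store [nth [::] _ a]nth_default ?nth_nil.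
rewrite /P /main_program; apply: runs_call.
  by apply: (@runs_load orc B M _ _ _ _ BM); apply: table_le.
move=> st1 _ st1B [keep1 tab1].
apply: runs_call.
  by apply: (@runs_load orc B M _ _ _ _ BM); apply: table_le.
move=> st2 _ st2B [keep2 tab2].
have keep a : a != aTabA -> a != aTabW -> st2 a = st0 a by move=> a1 a2; rewrite keep2 ?keep1.
have st2_n : st2 0%N 0%N = n%:Z by rewrite keep.
have ev (ph : bool) st : let y := read_vec st aCand N in
    env st2 st -> small Y y -> st vPhase 0%N = (ph : nat)%:Z ->
    (ph -> viol y = 0 -> [/\ (`|f (nfold n W *m y)| <= B)%N, (`|g y| <= B)%N
                            & (`|obj y| <= B)%N]) ->
    runs orc B M (evaluate r s p q t) st (fun st' =>
      [/\ st' vPhi 0%N = viol y, st' vAcc 0%N = spread A W l u lh uh b y,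
          st' vOk 0%N = ((defect A W l u lh uh b ph y == 0) : nat)%:Z &
          defect A W l u lh uh b ph y = 0 ->
            st' vVal 0%N = goal A W l u lh uh b f g ph y]).
  apply: (runs_evaluate (alpha := alpha) (beta := G)) => //.
  - by move=> i; rewrite keep // /st0 /init_store /= nth_entries.
  - by move=> i; rewrite keep // /st0 /init_store /= nth_entries.
  - by move=> i; rewrite keep // /st0 /init_store /= nth_entries.
  - by move=> i; rewrite keep // /st0 /init_store /= nth_entries.
  - by move=> i; rewrite keep // /st0 /init_store /= nth_entries.
  - by move=> i; rewrite keep // /st0 /init_store /= nth_entries.
  - by move=> i; rewrite keep // /st0 /init_store /= nth_entries.
  - by move=> i; rewrite keep // /st0 /init_store /= nth_entries.
  - by move=> i; rewrite keep // /st0 /init_store /= nth_entries_id.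
  - move=> i j ir jt; rewrite keep2 // tab1 size_table add0n subn0 leq0n nth_table //.
    by rewrite ifT //; nia.
  - move=> i j ir jt; rewrite tab2 size_table add0n subn0 leq0n nth_table //.
    by rewrite ifT //; nia.
  by move=> i; rewrite keep // st0_high.
have ev1 st : let y := read_vec st aCand N in
    env st2 st -> small Y y -> st vPhase 0%N = (false : nat)%:Z ->
    runs orc B M (evaluate r s p q t) st (fun st' =>
      [/\ st' vPhi 0%N = viol y, st' vAcc 0%N = spread A W l u lh uh b y,
          st' vOk 0%N = ((0 == 0 :> int) : nat)%:Z & 0 = 0 :> int -> st' vVal 0%N = viol y]).
  by move=> y st_env yY st_ph; apply: (ev false).
have viol_ge0 y : 0 <= viol y by apply: violation_ge0.
have x0E : read_vec st2 aX N = 0 by apply/colP => i; rewrite !mxE keep // st0_high.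
have hi1 : viol 0 - 0 <= (gap1_bound r s p q t alpha G)%:Z.
  rewrite subr0; apply: (@le_trans _ _ (num_rows r s p q t n *
      ((max_row t n alpha 0 + G).*2 + 2))%N%:Z); last first.
    by rewrite lez_nat; apply: (violation_bound_le (fun=> 0%N)).
  by apply: violation_le => // i; rewrite mxE.
have phase1_Y : (0 + 2 * K * gap1_bound r s p q t alpha G +
    (4 * gap1_bound r s p q t alpha G + 1) * K <= Y)%N.
  by rewrite /Y /point_bound /point1_bound; lia.
apply: runs_call.
  apply: (runs_augment (C := Cm) (D := fun=> 0) (F := viol) (ph := false) (hi := viol 0) (lo := 0) BM nM st2_n
    _ _ _ ev1 _ hi1 B5 B6 B7 B9 phase1_Y test_vector B10) => //.
  - exact: convex_along_zero.
  - exact: convex_along_violation.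
  - by rewrite keep // st0_high.
  - by rewrite x0E.
  by move=> i; rewrite x0E mxE.
move=> st3 fr3 st3B [[env3 ph3 _ cur3 [hi3 near3]] min3].
set x := read_vec st3 aX N in cur3 hi3 near3.
have flag3 : st3 aFlag 0%N = 0 by rewrite fr3 // keep // st0_high.
apply: (runs_if BM) => /=; rewrite cur3 => viol_x.
  apply: runs_skip; rewrite /output flag3 /=; right.
  apply/seteqP; split=> // y /violation_eq0 viol_y.
  by have := min3 y erefl; rewrite cur3 (viol_y : viol y = 0); lia.
have {}viol_x : viol x = 0 by have := viol_ge0 x; lia.
have xX i : (`|x i ord0| <= point1_bound r s p q t K alpha G)%N.
  have := near3 i; rewrite viol_x subr0 add0r => near_x.
  have : 2 * K%:Z * viol 0 <= (point1_bound r s p q t K alpha G)%:Z.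
    by rewrite /point1_bound PoszM ler_wpM2l //; move: hi1; rewrite subr0.
  by move=> le_p; rewrite -lez_nat abszE; apply: le_trans near_x le_p.
pose k := absz (spread A W l u lh uh b x).
have spread0 : 0 <= spread A W l u lh uh b x.
  by rewrite !addr_ge0 //; apply: sumr_ge0 => i _; apply: squares_ge0.
have k_le : (k.+1 <= ray_bound r s p q t K alpha G)%N.
  rewrite /ray_bound addn1 ltnS -lez_nat /k gez0_abs //.
  apply: (@le_trans _ _ (num_rows r s p q t n * (max_row t n alpha
    (point1_bound r s p q t K alpha G) * max_row t n alpha
    (point1_bound r s p q t K alpha G) + G * G + G * G))%N%:Z); last first.
    by rewrite lez_nat; apply: spread_bound_le.
  by apply: spread_le.
have xY : small Y x.
  by move=> i; apply: leq_trans (xX i) _; rewrite /Y /point_bound; lia.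
apply: runs_seq; apply: (runs_asg _ BM) => //=; set st4 := update _ _ _ _.
have env4 : env st2 st4 by apply: env_update.
apply: (runs_call (R := fun st5 => read_vec st5 aCand N = x)).
  apply: (runs_conseq (runs_candidate _ BM nM B5 _ _)).
  - by rewrite env4.
  - move=> i iN; rewrite /st4 /update /= mul0r addr0; apply: leq_trans B9.
    by have := xY (Ordinal iN); rewrite mxE.
  by move=> st5 _ _ ->; rewrite /st4 /update /= scale0r addr0.
move=> st5 fr5 st5B cand5; have env5 := env_frame env4 fr5 isT.
have ph5 : st5 vPhase 0%N = 0 by rewrite fr5.
apply: (runs_call (R := fun st6 => st6 vAcc 0%N = k%:Z)).
  apply: runs_conseq; first by apply: ev1 => //; rewrite cand5.
  by rewrite cand5 => st6 _ _ [_ -> _ _]; rewrite /k gez0_abs.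
move=> st6 fr6 st6B acc6; have env6 := env_frame env5 fr6 isT.
apply: runs_seq; apply: (runs_asg _ BM) => /=; rewrite acc6.
  by move: k_le B12; lia.
have LE : k%:Z + 1 = k.+1%:Z by lia.
rewrite LE; set st7 := update _ _ _ _.
have env7 : env st2 st7 by apply: env_update.
have x7 : read_vec st7 aX N = x by rewrite /read_vec /st7 /update /= fr6 // fr5.
have step_small c : small Y (x + k.+1%:Z *: decoding N K c).
  move=> i; rewrite mxE [X in _ + X]mxE; have := xX i; have := decoding_le K c i.
  have := leq_mul k_le (decoding_le K c i).
  have : `|(k.+1%:Z * decoding N K c i ord0)%R|%N = (k.+1 * `|decoding N K c i ord0|)%N.
    by rewrite abszM.
  have : (ray_bound r s p q t K alpha G * `|decoding N K c i ord0| <=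
      ray_bound r s p q t K alpha G * K)%N by rewrite leq_mul2l decoding_le orbT.
  rewrite /Y /point_bound; move: (_ * decoding N K c i ord0) (x i ord0) => a c'.
  move: (_ * `|_|)%N (_ * `|_|)%N => z z'; lia.
apply: runs_call.
  apply: (runs_scan (D := fun=> 0) BM nM st2_n ev1 B5 B6 B9 B10 B11 viol_ge0 env7).
    by rewrite /st7 /update /= fr6.
  by rewrite x7.
rewrite x7 => st8 fr8 st8B scan8.
have env8 := env_frame env7 fr8 isT.
have flag8 : st8 aFlag 0%N = 0 by rewrite fr8 // /st7 /update /= fr6 // fr5.
have long : spread A W l u lh uh b x < k.+1%:Z by rewrite -LE /k gez0_abs //; lia.
apply: (runs_if BM) => /= inf8.
  apply: runs_skip; rewrite /output flag8 /=; left.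
  move: scan8; rewrite inf8 => -[c dec_c viol_c].
  exact: (infinite_ray long dec_c viol_x viol_c).
have no_ray : forall c : 'I_(num_codes N K), decoding N K c != 0 ->
    viol (x + decoding N K c *+ k.+1) <> 0.
  move=> c dec_c; move: scan8; rewrite ltNge inf8 /= => /(_ c (ltn_ord c) dec_c).
  by rewrite /st7 /update /= scalez_nat.
have cviol := convex_along_violation A W l u lh uh b.
have finS : finite_set S.
  have := finite_feasible test_vector cviol viol_ge0 viol_x no_ray.
  by apply: sub_finite_set => y /violation_eq0.
have f_le y : viol y = 0 -> (`|f (nfold n W *m y)| <= G)%N.
  by move=> /violation_eq0 Sy; apply: leq_trans fG; apply: (max_abs_ge _ finS Sy).
have g_le y : viol y = 0 -> (`|g y| <= G)%N.
  by move=> /violation_eq0 Sy; apply: leq_trans gG; apply: (max_abs_ge _ finS Sy).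
have obj_le y : viol y = 0 -> `|obj y| <= (2 * G)%N%:Z.
  by move=> viol_y; have := f_le y viol_y; have := g_le y viol_y; rewrite /obj /objective; lia.
apply: runs_seq; apply: (runs_asg _ BM) => /=; first by lia.
set st9 := update _ _ _ _.
have env9 : env st2 st9 by apply: env_update.
have x9 : read_vec st9 aX N = x.
  by rewrite -x7 /read_vec /st9 /update /= fr8.
have ev2 st : let y := read_vec st aCand N in
    env st2 st -> small Y y -> st vPhase 0%N = (true : nat)%:Z ->
    runs orc B M (evaluate r s p q t) st (fun st' =>
      [/\ st' vPhi 0%N = viol y, st' vAcc 0%N = spread A W l u lh uh b y,
          st' vOk 0%N = ((viol y == 0) : nat)%:Z & viol y = 0 -> st' vVal 0%N = obj y]).
  move=> y st_env yY st_ph; apply: (ev true) => // _ viol_y; split.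
  - exact: leq_trans (f_le y viol_y) B15.
  - exact: leq_trans (g_le y viol_y) B15.
  by have := obj_le y viol_y; move: B13; move: (obj y) => v; lia.
have lo2 y : viol y = 0 -> - (2 * G)%N%:Z <= obj y.
  by move=> /obj_le; rewrite ler_norml => /andP[].
have hi2 : obj x - - (2 * G)%N%:Z <= (4 * G)%N%:Z by have := obj_le x viol_x; move: (obj x) => v; lia.
have phase2_Y : (point1_bound r s p q t K alpha G + 2 * K * (4 * G) +
    (4 * (4 * G) + 1) * K <= Y)%N by rewrite /Y /point_bound; lia.
apply: runs_call.
  apply: (runs_augment (C := Cm) (D := viol) (F := obj) (ph := true) BM nM st2_n
    cviol _ viol_ge0 ev2 lo2 hi2 B5 B6 B8 B9 phase2_Y test_vector B10) => //.
  - exact: convex_along_objective.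
  - by rewrite x9.
  - by rewrite x9.
  by move=> i; rewrite x9.
move=> st10 fr10 st10B [[env10 ph10 viol10 cur10 _] min10].
apply: (runs_asg _ BM) => //=; first by lia.
rewrite /output /update /=; split; first by apply/violation_eq0.
move=> y /violation_eq0 viol_y; have := min10 y viol_y; rewrite cur10.
by [].
Qed.

End Instance.
End Correctness.

(** * Polynomial running time *)

Section Polynomials.

Lemma cell_bound_poly r s p q t K alpha : poly_bounded (cell_bound r s p q t K alpha).
Proof.
have row Y : poly_bounded Y -> poly_bounded (row_bound t alpha Y).
  move=> pY; apply: poly_bounded_add (pY); apply: poly_bounded_mul.
    exact: poly_bounded_mul (poly_bounded_cst t) poly_bounded_id.
  exact: poly_bounded_mul (poly_bounded_cst alpha) pY.
have rows : poly_bounded (rows_bound r s p q t).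
  exact: poly_bounded_mul (poly_bounded_cst _) poly_bounded_id.
have vio Y : poly_bounded Y -> poly_bounded (violation_bound r s p q t alpha Y).
  move=> /row pY; apply: poly_bounded_mul (rows) _.
  apply: poly_bounded_add (poly_bounded_cst 2); apply: poly_bounded_mul (poly_bounded_cst 2) _.
  exact: poly_bounded_add pY poly_bounded_id.
have gg : poly_bounded (fun g => g * g) by apply: poly_bounded_mul poly_bounded_id poly_bounded_id.
have spr Y : poly_bounded Y -> poly_bounded (spread_bound r s p q t alpha Y).
  move=> /row pY; apply: poly_bounded_mul (rows) _.
  by do 2!apply: poly_bounded_add => //; apply: poly_bounded_mul.
have gap1 : poly_bounded (gap1_bound r s p q t alpha) by apply/vio/poly_bounded_cst.
have pt1 : poly_bounded (point1_bound r s p q t K alpha).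
  exact: poly_bounded_mul (poly_bounded_cst _) gap1.
have ray : poly_bounded (ray_bound r s p q t K alpha).
  exact: poly_bounded_add (spr _ pt1) (poly_bounded_cst 1).
have lin (T : nat -> nat) c1 c2 : poly_bounded T -> poly_bounded (fun g => c1 * T g + c2).
  move=> pT; apply: poly_bounded_add (poly_bounded_cst c2).
  exact: poly_bounded_mul (poly_bounded_cst c1) pT.
have mulc (T : nat -> nat) c1 : poly_bounded T -> poly_bounded (fun g => T g * c1).
  by move=> pT; apply: poly_bounded_mul pT (poly_bounded_cst c1).
have mul_c (T : nat -> nat) c1 : poly_bounded T -> poly_bounded (fun g => c1 * T g).
  by move=> pT; apply: poly_bounded_mul (poly_bounded_cst c1) pT.
have four : poly_bounded (fun g => 4 * g) by apply: mul_c; apply: poly_bounded_id.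
have pt : poly_bounded (point_bound r s p q t K alpha).
  apply: poly_bounded_add; first apply: poly_bounded_add; apply: poly_bounded_add => //.
  - by apply/mulc/lin.
  - exact: mulc.
  - by apply: poly_bounded_add => //; apply: mul_c.
  by apply/mulc/lin.
have exp : poly_bounded (fun g => (t * g + 1) ^ (K + K)).
  apply: poly_bounded_exp; apply: poly_bounded_add (poly_bounded_cst 1).
  by apply: mul_c; apply: poly_bounded_id.
have norm : poly_bounded (fun g => t * g * (K * K)).
  by apply: mulc; apply: mul_c; apply: poly_bounded_id.
have cst := poly_bounded_cst.
apply: poly_bounded_add (cst 2); apply: poly_bounded_add poly_bounded_id.
apply: poly_bounded_add (cst alpha); apply: poly_bounded_add (four).
apply: poly_bounded_add (ray); apply: poly_bounded_add (norm).
apply: poly_bounded_add (exp); apply: poly_bounded_add (pt).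
apply: poly_bounded_add (lin _ 4 2 four); apply: poly_bounded_add (lin _ 4 2 gap1).
apply: poly_bounded_add (cst K); apply: poly_bounded_add (spr _ pt).
by apply: poly_bounded_add (vio _ pt); apply: poly_bounded_add (row _ pt).
Qed.

Lemma bitlen_mul (x y : nat) : bitlen (x * y)%N <= bitlen x + bitlen y.
Proof. by apply: bitlen_mono; rewrite /= !mulSn mulnS; lia. Qed.

Lemma bitlen_exp (x k : nat) : bitlen (x ^ k)%N <= k * bitlen x + 2.
Proof.
elim: k => [|k IHk]; first by rewrite expn0.
by rewrite expnS mulSn; apply: leq_trans (bitlen_mul _ _) _; rewrite -addnA leq_add2l.
Qed.

Lemma bitlen_scale (n len : nat) : bitlen (n.+1 * 2 ^ len)%N <= (n + len).+1 + 4.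
Proof.
apply: leq_trans (bitlen_mul _ _) _; rewrite /bitlen /=.
have H1 : up_log 2 n.+2 <= n.+2 by apply: up_log_min => //; apply: ltnW; apply: ltn_expl.
have H2 : up_log 2 (2 ^ len).+1 <= len.+1.
  by apply: up_log_min => //; rewrite expnS mul2n -addnn -addn1 leq_add2l expn_gt0.
by lia.
Qed.

Lemma exists_ent_bound m n (A : 'M[int]_(m, n)) :
  exists a, forall i j, (`|ent A i j| <= a)%N.
Proof.
exists (\sum_i \sum_j `|A i j|)%N => i j; rewrite /ent.
case: insubP => [i' _ _|_] //; case: insubP => [j' _ _|_] //.
by rewrite (bigD1 i') //= (bigD1 j') //= -addnA leq_addr.
Qed.

End Polynomials.

Theorem theorem1p5 (r s p q t : nat)
    (A : 'M[int]_(r + s, t)) (W : 'M[int]_(p + q, t)) :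
  exists (P : cmd) (pol : {poly nat}),
  forall (n : nat) (l u : 'cV[\bar int]_(n * t))
         (lh uh : 'cV[\bar int]_(p + n * q)) (b : 'cV[int]_(r + n * s))
         (f : 'cV[int]_(p + n * q) -> int) (g : 'cV[int]_(n * t) -> int),
    (0 < n)%N -> separable_convex f -> separable_convex g ->
    let S := feasible A W l u lh uh b in
    let fW := fun x : 'cV[int]_(n * t) => f (nfold n W *m x)%R in
    let fhat := max_abs S fW in
    let ghat := max_abs S g in
    let len := (vebitlen l + vebitlen u + vebitlen lh + vebitlen uh
                 + vbitlen b + bitlen (Posz fhat) + bitlen (Posz ghat))%N in
    exists (time : nat) (st : store),
      [/\ exec (oracles f g) P (init_store n l u lh uh b) time st,
          (time <= pol.[(n + len)%N]%R)%N &
          solves S (fun x => fW x + g x)%R (output (n * t) st)].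
Proof.
have [K graver] := nfold_graver A W.
have [alphaA A_le] := exists_ent_bound A; have [alphaW W_le] := exists_ent_bound W.
pose alpha := (alphaA + alphaW)%N.
have [cB [eB cell_le]] := cell_bound_poly r s p q t K alpha.
pose P := main_program K A W.
(* [M m] bounds the length of [cell_bound G] for G = n.+1 * 2 ^ len, which has
   at most m + 4 digits for m = n + len + 1. *)
pose M m := (bitlen cB + (eB * (m + 4) + 2) + m)%N.
have M_poly : poly_bounded M.
  apply: poly_bounded_add poly_bounded_id; apply: poly_bounded_add; first exact: poly_bounded_cst.
  apply: poly_bounded_add (poly_bounded_cst 2); apply: poly_bounded_mul (poly_bounded_cst eB) _.
  exact: poly_bounded_add poly_bounded_id (poly_bounded_cst 4).
have [|c [k time_le]] := poly_bounded_comp _ (time_poly P) M_poly.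
  by move=> m m0; rewrite /M addn_gt0 m0 orbT.
exists (erase P), (c%:P * ('X + 1) ^+ k)%R => n l u lh uh b f g n0 cf cg S fW fhat ghat len.
(* A number with [len] digits is at most 2 ^ len. *)
pose G := (n.+1 * 2 ^ len)%N.
have G_len : (2 ^ len <= G)%N by rewrite /G leq_pmull.
have nG : (n < G)%N by rewrite /G leq_pmulr // expn_gt0.
have small_len z : (bitlen z <= len)%N -> (`|z| <= G)%N.
  by move=> /absz_bitlen zl; apply: leq_trans zl G_len.
have efin_small m (v : 'cV[\bar int]_m) : (vebitlen v <= len)%N ->
    forall i, (`|efin (v i ord0)| <= G)%N.
  by move=> vl i; apply: small_len; apply: leq_trans (bitlen_efin v i) vl.
have lG := efin_small _ l ltac:(rewrite /len; lia).
have uG := efin_small _ u ltac:(rewrite /len; lia).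
have lhG := efin_small _ lh ltac:(rewrite /len; lia).
have uhG := efin_small _ uh ltac:(rewrite /len; lia).
have bG i : (`|b i ord0| <= G)%N.
  by apply: small_len; apply: leq_trans (bitlen_entry b i) _; rewrite /len; lia.
have fG : (max_abs S fW <= G)%N.
  by apply: (small_len (Posz fhat)); rewrite /len; lia.
have gG : (max_abs S g <= G)%N.
  by apply: (small_len (Posz ghat)); rewrite /len; lia.
pose m := (n + len).+1.
have BM : (bitlen (cell_bound r s p q t K alpha G) <= M m)%N.
  have G0 : (0 < G)%N by apply: leq_ltn_trans nG.
  apply: leq_trans (bitlen_le _) (_ : (bitlen (cB * G ^ eB)%N <= _)%N); first exact: cell_le.
  apply: leq_trans (bitlen_mul _ _) _; rewrite /M -addnA leq_add2l.
  apply: leq_trans (bitlen_exp _ _) _; apply: leq_trans (leq_addr _ _).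
  by rewrite leq_add2r leq_mul2l bitlen_scale orbT.
have nM : (n <= M m)%N by rewrite /M /m; lia.
have A_le' i j : (`|ent A i j| <= alpha)%N by rewrite (leq_trans (A_le i j)) ?leq_addr.
have W_le' i j : (`|ent W i j| <= alpha)%N by rewrite (leq_trans (W_le i j)) ?leq_addl.
have [] := runs_main cf cg (graver n) A_le' W_le' nG lG uG lhG uhG bG fG gG BM nM.
  have G0 : (0 < G)%N by apply: leq_ltn_trans nG.
  have GB : (G <= cell_bound r s p q t K alpha G)%N by rewrite /cell_bound; lia.
  by move=> a i; apply: leq_trans GB; apply: init_store_bounded => //; apply: ltnW.
move=> time [st [E time_le' _ sol]]; exists time, st; split=> //.
apply: leq_trans time_le' _; apply: leq_trans (time_le m isT) _.
have -> : (c%:P * ('X + 1) ^+ k)%R.[(n + len)%N]%R = (c * m ^ k)%N.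
  rewrite hornerM hornerC horner_exp hornerD hornerX hornerC.
  by rewrite natrXE /m -addn1.
by [].
Qed.
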